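(* Let $A$ be a $\sigma$-unital $C_0(X)$-algebra with base map $\phi$ and suppose that $\mathrm{Orc}(A)<\infty$. Write $\phi=\psi\circ\phi_A$, where $\phi_A$ is the complete regularization map for $\mathrm{Prim}(A)$, with image $X_{\phi_A}$, and $\psi:X_{\phi_A}\to X_\phi$ is continuous. Let $E$ be a non-empty closed subset of $X_\phi$. Consider the following conditions: (i) $H_E$ is strictly closed in $M(A)$; (ii) $J_E$ is locally modular and $\psi:X_{\phi_A}\to X_\phi$ is locally closed at $E$. Then (ii) implies (i), and (i) and (ii) are equivalent if $A$ is separable.
   Context: For a C$^*$-algebra $A$, $\mathrm{Prim}(A)$ is the primitive ideal space with the hull-kernel topology and $M(A)$ is the multiplier algebra. $A$ is a $C_0(X)$-algebra with base map $\phi$ if $X$ is a locally compact Hausdorff space and $\phi:\mathrm{Prim}(A)\to X$ is continuous; $X_\phi$ denotes the image of $\phi$ with the subspace topology. For a closed two-sided ideal $J$ of $A$, $\tilde J=\{b\in M(A): ba,ab\in J \text{ for all } a\in A\}$. If $P\in\mathrm{Prim}(A)$ then $\tilde P\in\mathrm{Prim}(M(A))$, and $P\mapsto\tilde P$ is a homeomorphism onto a dense open subset of $\mathrm{Prim}(M(A))$. The map $\phi$ has a unique extension to a continuous map $\overline\phi:\mathrm{Prim}(M(A))\to\beta X$ (the Stone-Čech compactification) with $\overline\phi(\tilde P)=\phi(P)$ for all $P\in\mathrm{Prim}(A)$. ''Strictly closed'' means closed in the strict topology of $M(A)$. For a closed subset $E$ of $X_\phi$, $J_E=\bigcap\{P\in\mathrm{Prim}(A):\phi(P)\in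 E\}$ and $H_E=\bigcap\{Q\in\mathrm{Prim}(M(A)):\overline\phi(Q)\in E\}$. Let $H(E)=\phi^{-1}(E)$, with boundary $\partial H(E)$ and interior $U(E)$ in $\mathrm{Prim}(A)$. $J_E$ is locally modular if for each $P\in\partial H(E)$ there is a relatively open neighbourhood $V$ of $P$ in $\mathrm{Prim}(A)\setminus U(E)$ such that $A/\ker V$ is unital, where $\ker V=\bigcap_{Q\in V}Q$. Complete regularization: identify $P,Q\in\mathrm{Prim}(A)$ when $f(P)=f(Q)$ for all bounded continuous real-valued $f$ on $\mathrm{Prim}(A)$; the quotient set $X_{\phi_A}$, with the weakest topology making all functions induced by such $f$ continuous, is a completely regular Hausdorff space, and the quotient map $\phi_A:\mathrm{Prim}(A)\to X_{\phi_A}$ is the complete regularization map. Every continuous map from $\mathrm{Prim}(A)$ to a locally compact Hausdorff space factors continuously through $\phi_A$. The map $\psi$ is locally closed at $E\subseteq X_\phi$ if whenever $W$ is a closed subset of $X_{\phi_A}$ with $\psi(W)\cap E=\emptyset$, then the closure of $\psi(W)$ in $X_\phi$ does not meet $E$. Connecting order: for $P,Q\in\mathrm{Prim}(A)$ write $P\sim Q$ if $P$ and $Q$ cannot be separated by disjoint open subsets of $\mathrm{Prim}(A)$. View $\mathrm{Prim}(A)$ as a graph with $P,Q$ adjacent if $P\sim Q$; $d_A(P,Q)$ is the length of a shortest path from $P$ to $Q$ ($\infty$ if none exists). The diameter of a $\sim$-component (connected component of the graph) is the supremum of the distances between its points, with the convention that a singleton component has diameter $1$. $\mathrm{Orc}(A)\in\{1,2,\dots,\infty\}$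 is the supremum of the diameters of the $\sim$-components. *)

(* Defs.v *)
From HB Require Import structures.
From mathcomp Require Import all_boot all_order all_algebra.
From mathcomp Require Import all_classical all_reals all_analysis.
From mathcomp Require Import sesquilinear generic_quotient.
From mathcomp Require Import complex.

Set Implicit Arguments.
Unset Strict Implicit.
Unset Printing Implicit Defensive.

Import Order.TTheory GRing.Theory Num.Theory.
Import numFieldNormedType.Exports.

Local Open Scope classical_set_scope.
Local Open Scope ring_scope.

HB.mixin Record Lmodule_isStarAlgebra (R : realType) A & GRing.Lmodule R[i] A := {
  smul : A -> A -> A;
  star : A -> A;
  smulA : forall a b c, smul a (smul b c) = smul (smul a b) c;
  smul_linearl : forall b, linear (smul^~ b);
  smul_linearr : forall a, linear (smul a);
  starD : forall a b, star (a + b) = star a + star b;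
  starZ : forall (k : R[i]) a, star (k *: a) = Num.conj k *: star a;
  starM : forall a b, star (smul a b) = smul (star b) (star a);
  starK : forall a, star (star a) = a
}.

(* Complex *-algebras; neither the existence of a unit nor 1 <> 0 is required. *)
#[short(type="starAlgType")]
HB.structure Definition StarAlgebra (R : realType) :=
  {A of GRing.Lmodule R[i] A & Lmodule_isStarAlgebra R A}.

HB.mixin Record isCStarNorm (R : realType) A
    & NormedModule R[i] A & StarAlgebra R A := {
  norm_smul : forall a b : A, `|smul a b| <= `|a| * `|b|;
  norm_starM : forall a : A, `|smul (star a) a| = `|a| ^+ 2
}.

#[short(type="cstarAlgType")]
HB.structure Definition CStarAlgebra (R : realType) :=
  {A of CompleteNormedModule R[i] A & StarAlgebra R A & isCStarNorm R A}.

Notation "a ** b" := (smul a b) (at level 40, left associativity) : ring_scope.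

Section PrimitiveIdeals.
Variables (R : realType) (A : starAlgType R).

Definition star_representation (H : completeNormedModType R[i])
    (dot : {dot H for Num.conj}) (pi : A -> H -> H) :=
  [/\ forall a, linear (pi a) /\ continuous (pi a),
      forall x, linear (pi^~ x),
      forall a b x, pi (a ** b) x = pi a (pi b x) &
      forall a x y, dot (pi a x) y = dot x (pi (star a) y)].

Definition closed_subspace (H : completeNormedModType R[i]) (L : set H) :=
  [/\ L 0, forall (k : R[i]) x y, L x -> L y -> L (k *: x + y) & closed L].

Definition irreducible (H : completeNormedModType R[i]) (pi : A -> H -> H) :=
  (exists a x, pi a x != 0) /\
  forall L : set H, closed_subspace L -> (forall a x, L x -> L (pi a x)) ->
    L = [set 0] \/ L = setT.

(* No norm on A enters: on a C*-algebra a *-representation by bounded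
   operators is automatically contractive.  The condition on [dot] says that
   it induces the (complete) norm of H, i.e. that H is a Hilbert space. *)
Definition primitive (P : set A) :=
  exists (H : completeNormedModType R[i]) (dot : {dot H for Num.conj})
         (pi : A -> H -> H),
    [/\ forall x, dot x x = `|x| ^+ 2,
        star_representation dot pi,
        irreducible pi &
        P = [set a | forall x, pi a x = 0]].

Record Prim := MkPrim { ideal_of :> set A; primP : primitive ideal_of }.

HB.instance Definition _ := gen_eqMixin Prim.
HB.instance Definition _ := gen_choiceMixin Prim.

Definition ker (V : set Prim) : set A := \bigcap_(Q in V) (Q : set A).

Definition hull (I : set A) : set Prim := [set P : Prim | I `<=` P].

(* The closed sets of the hull-kernel topology are those containing the hull
   of their kernel. *)
Definition hk_open (U : set Prim) := hull (ker (~` U)) `<=` ~` U.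

Lemma linear_at0 (U V : lmodType R[i]) (f : U -> V) : linear f -> f 0 = 0.
Proof. by move=> lf; have := lf (-1) 0 0; rewrite scaler0 addr0 scaleN1r addNr. Qed.

Lemma prim_ideal (P : Prim) a b :
  ideal_of P a -> ideal_of P (a ** b) /\ ideal_of P (b ** a).
Proof.
have [H [dot [pi [_ [rl _ rM _] _ ->]]]] := primP P.
move=> /= Pa; split => x; rewrite rM.
  by rewrite Pa.
by rewrite Pa; apply: linear_at0; exact: (rl b).1.
Qed.

Lemma hk_openT : hk_open setT.
Proof.
move=> P kP _; have [H [dot [pi [_ _ [[a [x pax]] _] PE]]]] := primP P.
have /kP : ker (~` [set: Prim]) a by move=> Q; rewrite setCT.
by rewrite PE /= => /(_ x) /eqP; rewrite (negbTE pax).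
Qed.

Lemma hk_openI : setI_closed hk_open.
Proof.
move=> U V oU oV P kP [UP VP].
have kerM a b : ker (~` U) a -> ker (~` V) b -> ideal_of P (a ** b).
  move=> ka kb; apply: kP => Q; rewrite setCI => -[UQ|VQ].
    exact: (prim_ideal b (ka Q UQ)).1.
  exact: (prim_ideal a (kb Q VQ)).2.
have nU : ~ ker (~` U) `<=` P by move/(oU P); exact.
have nV : ~ ker (~` V) `<=` P by move/(oV P); exact.
have [H [dot [pi [_ [rl _ rM _] [_ irr] PE]]]] := primP P.
rewrite {}PE /= in nU nV kerM.
have pi0 a : pi a 0 = 0 by apply: linear_at0; exact: (rl a).1.
pose L := [set x | forall a, ker (~` U) a -> pi a x = 0].
have [||L0|LT] := irr L.
- split.
  + by move=> a _; rewrite pi0.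
  + move=> k x y Lx Ly a ka.
    by rewrite (rl a).1 Lx // Ly // scaler0 addr0.
  + have -> : L = \bigcap_(a in ker (~` U)) (pi a @^-1` [set 0]) by [].
    apply: closed_bigI => a _; apply: closed_comp; last first.
      exact/accessible_closed_set1/hausdorff_accessible/norm_hausdorff.
    by move=> x _; exact: (rl a).2.
- move=> b x Lx a ka; rewrite -rM; apply: Lx => Q UQ.
  exact: (prim_ideal b (ka Q UQ)).1.
- apply: nV => b kb x.
  have : L (pi b x) by move=> a ka; rewrite -rM; exact: kerM.
  by rewrite L0.
- apply: nU => a ka x.
  have : L x by rewrite LT.
  exact.
Qed.

Lemma hk_open_bigU (J : Type) (f : J -> set Prim) :
  (forall i, hk_open (f i)) -> hk_open (\bigcup_i f i).
Proof.
move=> of_ P kP [i _ fiP]; apply: (of_ i P) fiP.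
apply: subset_trans kP => a ka Q nfQ; apply: ka => fQ.
by apply: nfQ; exists i.
Qed.

HB.instance Definition _ :=
  isOpenTopological.Build Prim hk_openT hk_openI hk_open_bigU.

End PrimitiveIdeals.

Section Multipliers.
Variables (R : realType) (A : cstarAlgType R).

Lemma norm_star (a : A) : `|star a| = `|a|.
Proof.
suff le (b : A) : `|b| <= `|star b|.
  by apply/eqP; rewrite eq_le le -{2}(starK a) le.
have [->|b0] := eqVneq b 0; first by rewrite normr0.
by rewrite -(ler_pM2r (_ : 0 < `|b|)) ?normr_gt0 // -expr2 -norm_starM norm_smul.
Qed.

Lemma star_continuous : continuous (star : A -> A).
Proof.
move=> a; apply/cvgrPdist_lt => e e0; near=> b.
have <- : star (a - b) = star a - star b.
  by rewrite starD -scaleN1r starZ rmorphN rmorph1 scaleN1r.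
by rewrite norm_star; near: b; exact: cvgr_dist_lt.
Unshelve. all: by end_near. Qed.

(* A multiplier is a double centralizer: the pair (L, R) stands for the
   operators a |-> b a and a |-> a b. *)
Definition double_centralizer (p : (A -> A) * (A -> A)) :=
  [/\ linear p.1 /\ continuous p.1,
      linear p.2 /\ continuous p.2,
      forall a b, p.1 (a ** b) = p.1 a ** b,
      forall a b, p.2 (a ** b) = a ** p.2 b &
      forall a b, p.2 a ** b = a ** p.1 b].

Definition double_centralizerb : {pred (A -> A) * (A -> A)} :=
  fun p => `[< double_centralizer p >].

Lemma smul0r (a : A) : a ** 0 = 0.
Proof. exact/linear_at0/smul_linearr. Qed.

Lemma smul0l (a : A) : 0 ** a = 0.
Proof. exact/(@linear_at0 _ _ _ (smul^~ a))/smul_linearl. Qed.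

Lemma double_centralizer_submod : submod_closed double_centralizerb.
Proof.
split=> [|k p q /asboolP[[lp1 cp1] [lp2 cp2] p1M p2M pM]
              /asboolP[[lq1 cq1] [lq2 cq2] q1M q2M qM]]; apply/asboolP.
  split=> /=.
  - split; last exact: cst_continuous.
    by move=> k a b; rewrite scaler0 addr0.
  - split; last exact: cst_continuous.
    by move=> k a b; rewrite scaler0 addr0.
  - by move=> a b; rewrite smul0l.
  - by move=> a b; rewrite smul0r.
  - by move=> a b; rewrite smul0l smul0r.
have lin (f g : A -> A) : linear f -> linear g -> linear (k *: f + g).
  move=> lf lg j a b; rewrite !fctE lf lg !scalerDr !scalerA mulrC -!scalerA.
  by rewrite addrACA.
have cont (f g : A -> A) : continuous f -> continuous g ->
    continuous (k *: f + g).
  move=> cf cg a; apply: cvgD; [apply: cvgZl_tmp; exact: cf|exact: cg].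
split=> /=.
- by split; [exact: lin|exact: cont].
- by split; [exact: lin|exact: cont].
- by move=> a b; rewrite !fctE p1M q1M smul_linearl.
- by move=> a b; rewrite !fctE p2M q2M smul_linearr.
- by move=> a b; rewrite !fctE smul_linearl smul_linearr pM qM.
Qed.

HB.instance Definition _ :=
  GRing.isSubmodClosed.Build R[i] ((A -> A) * (A -> A))%type
    double_centralizerb double_centralizer_submod.

Record multiplier := Multiplier {
  mult_pair : (A -> A) * (A -> A);
  _ : mult_pair \in double_centralizerb
}.

HB.instance Definition _ := [isSub for mult_pair].
HB.instance Definition _ := [Choice of multiplier by <:].
HB.instance Definition _ := [SubChoice_isSubLmodule of multiplier by <:].

Definition lmult (b : multiplier) (a : A) : A := (mult_pair b).1 a.

Definition rmult (a : A) (b : multiplier) : A := (mult_pair b).2 a.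

Lemma multP (b : multiplier) : double_centralizer (mult_pair b).
Proof. by apply/asboolP; exact: (valP b). Qed.

Lemma mult_smul_subproof (b c : multiplier) :
  (lmult b \o lmult c, (rmult^~ c) \o (rmult^~ b)) \in double_centralizerb.
Proof.
have [[lb1 cb1] [lb2 cb2] b1M b2M bM] := multP b.
have [[lc1 cc1] [lc2 cc2] c1M c2M cM] := multP c.
apply/asboolP; split => /=.
- split=> [k x y|x]; first by rewrite /= /lmult lc1 lb1.
  by apply: continuous_comp; [exact: cc1|exact: cb1].
- split=> [k x y|x]; first by rewrite /= /rmult lb2 lc2.
  by apply: continuous_comp; [exact: cb2|exact: cc2].
- by move=> x y; rewrite /lmult c1M b1M.
- by move=> x y; rewrite /rmult b2M c2M.
- by move=> x y; rewrite /lmult /rmult cM bM.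
Qed.

Definition mult_smul b c := Multiplier (mult_smul_subproof b c).

Lemma mult_star_subproof (b : multiplier) :
  ((fun a => star (rmult (star a) b)), (fun a => star (lmult b (star a))))
    \in double_centralizerb.
Proof.
have [[lb1 cb1] [lb2 cb2] b1M b2M bM] := multP b.
have lin (f : A -> A) : linear f -> linear (fun a => star (f (star a))).
  by move=> lf k x y; rewrite starD starZ lf starD starZ conjCK.
have cont (f : A -> A) : continuous f ->
    continuous (fun a => star (f (star a))).
  move=> cf x; apply: (@continuous_comp _ _ _ (f \o star) star); last first.
    exact: star_continuous.
  by apply: continuous_comp; [exact: star_continuous|exact: cf].
apply/asboolP; split => /=.
- by split; [exact: lin|exact: cont].
- by split; [exact: lin|exact: cont].
- by move=> x y; rewrite /rmult starM b2M starM starK.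
- by move=> x y; rewrite /lmult starM b1M starM starK.
- move=> x y; apply: (can_inj (@starK _ A)).
  by rewrite !starM !starK /lmult /rmult bM.
Qed.

Definition mult_star b := Multiplier (mult_star_subproof b).

Lemma mult_ext (b c : multiplier) :
  (forall a, lmult b a = lmult c a) -> (forall a, rmult a b = rmult a c) ->
  b = c.
Proof.
move=> l r; apply: val_inj => /=; rewrite [LHS]surjective_pairing.
by rewrite [RHS]surjective_pairing; congr pair; apply/funext.
Qed.

Fact mult_smulA b c d :
  mult_smul b (mult_smul c d) = mult_smul (mult_smul b c) d.
Proof. exact: mult_ext. Qed.

Fact mult_smul_linearl c : linear (mult_smul^~ c).
Proof.
have [_ [lc _] _ _ _] := multP c.
by move=> k x y; apply: mult_ext => a //; exact: lc.
Qed.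

Fact mult_smul_linearr b : linear (mult_smul b).
Proof.
have [[lb _] _ _ _ _] := multP b.
by move=> k x y; apply: mult_ext => a //; exact: lb.
Qed.

Fact mult_starD b c : mult_star (b + c) = mult_star b + mult_star c.
Proof. by apply: mult_ext => a; rewrite /lmult /rmult /= starD. Qed.

Fact mult_starZ (k : R[i]) b :
  mult_star (k *: b) = Num.conj k *: mult_star b.
Proof. by apply: mult_ext => a; rewrite /lmult /rmult /= starZ. Qed.

Fact mult_starM b c :
  mult_star (mult_smul b c) = mult_smul (mult_star c) (mult_star b).
Proof. by apply: mult_ext => a; rewrite /lmult /rmult /= /lmult /rmult /= !starK. Qed.

Fact mult_starK b : mult_star (mult_star b) = b.
Proof. by apply: mult_ext => a; rewrite /lmult /rmult /= /lmult /rmult /= !starK. Qed.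

HB.instance Definition _ := Lmodule_isStarAlgebra.Build R multiplier
  mult_smulA mult_smul_linearl mult_smul_linearr
  mult_starD mult_starZ mult_starM mult_starK.

Definition ideal_tilde (J : set A) : set multiplier :=
  [set b | forall a, J (lmult b a) /\ J (rmult a b)].

(* The multiplier algebra with the strict topology, generated by the seminorms
   b |-> `|b a| and b |-> `|a b|. *)
Definition strict : Type := multiplier.

Definition strict_subbase : set_system multiplier :=
  [set U | exists c a (e : R[i]), 0 < e /\
    (U = [set b | `|lmult (b - c) a| < e] \/
     U = [set b | `|rmult a (b - c)| < e])].

HB.instance Definition _ := Choice.on strict.
HB.instance Definition _ := isSubBaseTopological.Build strict strict_subbase id.

End Multipliers.

(* The quotient of T by the bounded continuous real functions on it, with the
   weakest topology making the induced functions continuous. *)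
Section CompleteRegularization.
Variables (R : realType) (T : topologicalType).

Definition bounded_continuous (f : T -> R) :=
  continuous f /\ [bounded f x | x in [set: T]].

Definition creg_rel : rel T :=
  fun x y => `[< forall f, bounded_continuous f -> f x = f y >].

Lemma creg_rel_refl : reflexive creg_rel.
Proof. by move=> x; apply/asboolP. Qed.

Lemma creg_rel_sym : symmetric creg_rel.
Proof.
by move=> x y; apply/idP/idP => /asboolP xy; apply/asboolP => f cf; rewrite xy.
Qed.

Lemma creg_rel_trans : transitive creg_rel.
Proof.
by move=> y x z /asboolP xy /asboolP yz; apply/asboolP => f cf; rewrite xy ?yz.
Qed.

Canonical creg_equiv :=
  EquivRel creg_rel creg_rel_refl creg_rel_sym creg_rel_trans.

Definition creg : Type := {eq_quot creg_equiv}%qT.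

HB.instance Definition _ := Choice.on creg.

Definition creg_map (x : T) : creg := (\pi_{eq_quot creg_equiv} x)%qT.

(* [repr] is only used to descend f, which is constant on the classes. *)
Definition creg_induced (f : {f : T -> R | bounded_continuous f})
  (q : creg) : R := sval f (repr (q : {eq_quot creg_equiv}%qT)).

HB.instance Definition _ := Topological.copy creg
  (sup_topology (fun f : {f : T -> R | bounded_continuous f} =>
    Topological.class (initial_topology (creg_induced f)))).

Lemma creg_inducedE f x : creg_induced f (creg_map x) = sval f x.
Proof.
rewrite /creg_induced /creg_map; case: piP => y /eqP.
by rewrite eqmodE => /asboolP /(_ _ (svalP f)) <-.
Qed.

End CompleteRegularization.

(* The closure of the image of X in the cube indexed by C(X, [0, 1]). *)
Section StoneCech.
Variables (R : realType) (X : topologicalType).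

Definition unit_continuous (f : X -> R) :=
  continuous f /\ forall x, 0 <= f x <= 1.

Definition stone_cech_eval (x : X) :
    prod_topology (fun _ : {f | unit_continuous f} => R) :=
  fun f => sval f x.

Definition stone_cech : topologicalType :=
  set_type (closure (range stone_cech_eval)).

Definition to_stone_cech (x : X) : stone_cech :=
  exist _ (stone_cech_eval x)
    (mem_set (@subset_closure _ (range stone_cech_eval) _ (imageT _ x))).

End StoneCech.

Section Corestriction.
Variables (T : Type) (X : topologicalType) (f : T -> X).

(* The image of f with the subspace topology. *)
Definition image_space : topologicalType := set_type (range f).

Definition corestriction (t : T) : image_space :=
  exist _ (f t) (mem_set (imageT f t)).

End Corestriction.

Definition locally_closed_at (Y Z : topologicalType) (psi : Y -> Z)
    (E : set Z) :=
  forall W : set Y, closed W ->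
    psi @` W `&` E = set0 -> closure (psi @` W) `&` E = set0.

Section CStarNotions.
Variables (R : realType) (A : cstarAlgType R).

Definition separable := exists D : set A, countable D /\ dense D.

Definition positive (a : A) := exists b, a = star b ** b.

Definition sigma_unital := exists u : nat -> A,
  [/\ forall n, positive (u n) /\ `|u n| <= 1,
      forall n, positive (u n.+1 - u n),
      forall a, u n ** a @[n --> \oo] --> a &
      forall a, a ** u n @[n --> \oo] --> a].

(* A/J has a unit. *)
Definition unital_quotient (J : set A) :=
  exists e, forall a, J (e ** a - a) /\ J (a ** e - a).

End CStarNotions.

(* Prim(A) as a graph, two points being adjacent when they cannot be
   separated by disjoint open sets. *)
Section ConnectingOrder.
Variables (R : realType) (A : cstarAlgType R).

Definition inseparable (P Q : Prim A) :=
  ~ exists U V : set (Prim A),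
      [/\ open U, open V, U P, V Q & U `&` V = set0].

Fixpoint walk (n : nat) (P Q : Prim A) : Prop :=
  if n is m.+1 then exists2 S, inseparable P S & walk m S Q else P = Q.

Definition connecting_dist (P Q : Prim A) : \bar R :=
  ereal_inf [set (n%:R)%:E | n in [set n | walk n P Q]].

Definition component (P : Prim A) : set (Prim A) :=
  [set Q | exists n, walk n P Q].

(* By convention a singleton component has diameter 1. *)
Definition diameter (C : set (Prim A)) : \bar R :=
  if `[< exists P, C = [set P] >] then 1%E
  else ereal_sup [set connecting_dist PQ.1 PQ.2 | PQ in C `*` C].

Definition Orc : \bar R := ereal_sup (range (diameter \o component)).

End ConnectingOrder.

Section ContinuousFields.
Variables (R : realType) (A : cstarAlgType R) (X : topologicalType).
Variables (phi : Prim A -> X) (phibar : Prim (multiplier A) -> stone_cech R X).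
Variable E : set (image_space phi).

(* H(E), J_E and H_E, for E a subset of X_phi, which is viewed inside the
   Stone-Cech compactification of X through X_phi -> X -> beta X. *)
Definition hull_over : set (Prim A) := corestriction phi @^-1` E.

Definition ideal_over : set A := ker hull_over.

Definition multiplier_ideal_over : set (multiplier A) :=
  ker (phibar @^-1` (@to_stone_cech R X @` (set_val @` E))).

(* Local modularity of the ideal J_E = [ideal_over]; note that H(E) =
   [hull_over] is the hull of J_E in Prim(A). *)
Definition locally_modular :=
  forall P : Prim A, (closure hull_over `\` hull_over°) P ->
    exists V : set (Prim A),
      [/\ exists2 O : set (Prim A), open O & V = O `&` ~` hull_over°,
          V P & unital_quotient (ker V)].

End ContinuousFields.

(* Main.v *)
(* Write H for the hull of J_E in Prim(A), and P~ for the primitive ideal of M(A)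
   attached to P.  In both directions strict closedness of H_E means that H_E is
   {b | bA, Ab in J_E}.

   (ii) => (i).  Let b be in this ideal and let W be the set of P at which b* b
   exceeds e > 0.  The sets {P | |a + P| >= e} are compact, so a unit modulo ker V
   near a boundary point of H shows that the closure of W misses H.  Since
   Orc(A) is finite and Prim(A) is sigma-compact, a quotient of Prim(A) in which
   only bounded walks are collapsed is normal, and Urysohn's lemma gives a
   continuous function that is 1 on H and 0 on W.  Hence the closure of W in the
   complete regularization misses the preimage of E; as psi is locally closed at
   E, the image of W stays away from E in X, and the density of {P~} in
   Prim(M(A)) forces b into H_E.

   (i) => (ii).  If either condition of (ii) fails, there are an increasing
   approximate unit v_k and compact sets Z_k off H, whose images accumulate at a
   point of E, with v_(k+1) - v_k bounded below on Z_k.  The strictly convergent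
   sum of (v_(k+1) - v_k) e_k (v_(k+1) - v_k), with e_k in J_E close to 1 on Z_k,
   is a multiplier b with bA, Ab in J_E that is bounded below on all the Z_k.
   By compactness it is nonzero at some Q over E, so it is not in H_E.

   The primitive ideals needed throughout come from irreducible representations
   of prescribed norm, obtained from extreme functionals by the GNS
   construction. *)
Require Import Defs.
From HB Require Import structures.
From mathcomp Require Import all_boot all_order all_algebra.
From mathcomp Require Import all_classical all_reals all_analysis.
From mathcomp Require Import sesquilinear generic_quotient.
From mathcomp Require Import complex.
From mathcomp Require Import ring lra.
From Stdlib Require Ncring Ncring_tac.
Set Implicit Arguments.
Unset Strict Implicit.
Unset Printing Implicit Defensive.
Import Order.TTheory GRing.Theory Num.Theory.
Import numFieldNormedType.Exports.
Local Open Scope classical_set_scope.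
Local Open Scope complex_scope.
Local Open Scope ring_scope.

(** * Real-valued norms and sequences *)

(** [Prim A] is in general not Hausdorff: compact sets need not be closed, and the set of points
    joined to a closed set by walks need not be closed either. A finite connecting order makes that
    set the result of boundedly many neighbour steps, and one step from a compact set is closed. So
    the point is to keep walks inside sets that are both compact and closed; local modularity
    provides these near the hull of J_E, off the hull itself.

    Neither the quotients A/P nor spectra of elements are formed. Norms modulo P are witnessed by
    vectors of irreducible representations ([attains]), inequalities by quadratic forms
    ([bounded_at]), positivity by a norm inequality ([pos]), and square roots come from an
    iteration. Computations that need a unit take place in [multiplier A], into which A is embedded
    by [mulin].

    Separability enters the converse twice: it gives J_E a strictly positive element, hence a
    sequential approximate unit, and it gives a boundary point countably many test
    neighbourhoods. *)

Section RealNorm.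
Variables (R : realType) (V : normedModType R[i]).
Implicit Types (x y l : V) (u : nat -> V).

(** The norm of a space over [R[i]] has values in [R[i]]. Its real part is the same number in [R],
    where linear and nonlinear arithmetic apply. *)
Definition rn x : R := complex.Re `|x|.

Lemma rnE x : `|x| = (rn x)%:C.
Proof. by rewrite /rn RRe_real // normr_real. Qed.

Lemma rn_ge0 x : 0 <= rn x.
Proof. by rewrite -ler0c -rnE. Qed.

Lemma rn0 : rn (0 : V) = 0.
Proof. by apply: complexI; rewrite -rnE normr0. Qed.

Lemma rn0_eq0 x : rn x = 0 -> x = 0.
Proof. by move=> x0; apply/eqP; rewrite -normr_eq0 rnE x0. Qed.

Lemma rn_gt0 x : x != 0 -> 0 < rn x.
Proof. by rewrite -normr_gt0 rnE ltcR. Qed.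

Lemma rn_le0_eq0 x : rn x <= 0 -> x = 0.
Proof. by move=> x0; apply: rn0_eq0; apply/le_anti; rewrite x0 rn_ge0. Qed.

Lemma rnN x : rn (- x) = rn x.
Proof. by rewrite /rn normrN. Qed.

Lemma rnBC x y : rn (x - y) = rn (y - x).
Proof. by rewrite -rnN opprB. Qed.

Lemma rnD x y : rn (x + y) <= rn x + rn y.
Proof. by rewrite -lecR rmorphD /= -!rnE ler_normD. Qed.

Lemma rnB x y : rn (x - y) <= rn x + rn y.
Proof. by rewrite -(rnN y) rnD. Qed.

Lemma rn_triangle y x z : rn (x - z) <= rn (x - y) + rn (y - z).
Proof. by rewrite (le_trans _ (rnD _ _)) // addrA subrK. Qed.

Lemma rn_subl x y : rn x <= rn (x - y) + rn y.
Proof. by rewrite (le_trans _ (rnD _ _)) // subrK. Qed.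

Lemma rnZ (k : R[i]) x : rn (k *: x) = complex.Re `|k| * rn x.
Proof.
by apply: complexI; rewrite rmorphM /= -!rnE normrZ.
Qed.

Lemma rnZr (t : R) x : rn (t%:C *: x) = `|t| * rn x.
Proof. by rewrite rnZ normc_def /= expr0n addr0 sqrtr_sqr. Qed.

Definition scvg u l :=
  forall e : R, 0 < e -> exists N, forall n, (N <= n)%N -> rn (u n - l) < e.

Definition scauchy u :=
  forall e : R, 0 < e ->
    exists N, forall n m, (N <= n)%N -> (N <= m)%N -> rn (u n - u m) < e.

Lemma scvgP u l : scvg u l <-> u @ \oo --> l.
Proof.
split=> [ul|/cvgrPdist_lt ul e e0].
  apply/cvgrPdist_lt => e e0.
  have er : e = (complex.Re e)%:C by rewrite RRe_real // gtr0_real.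
  have [|N ulN] := ul (complex.Re e); first by rewrite -ltcR -er.
  by exists N => // n /= Nn; rewrite er rnE ltcR rnBC ulN.
have [|N _ ulN] := ul e%:C; first by rewrite ltcR.
by exists N => n Nn; rewrite rnBC -ltcR -rnE; apply: ulN.
Qed.

Lemma closed_scvg (L : set V) u l :
  closed L -> (forall n, L (u n)) -> scvg u l -> L l.
Proof.
move=> cL Lu /scvgP ul.
by apply: (closed_cvg L cL _ _ ul); exists 0%N => // n _; exact: Lu.
Qed.

Lemma exists_invS_lt (e : R) : 0 < e -> exists N, forall n, (N <= n)%N ->
  n.+1%:R^-1 < e.
Proof.
move=> e0; exists (Num.truncn e^-1) => n Nn.
rewrite -[ltRHS]invrK ltf_pV2 ?posrE ?invr_gt0 ?ltr0n //.
by rewrite (lt_le_trans (truncnS_gt _)) // ler_nat ltnS.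
Qed.

Lemma scvg_closed (L : set V) :
  (forall u l, (forall n, L (u n)) -> scvg u l -> L l) -> closed L.
Proof.
move=> sL x cLx.
have near n : exists y, L y /\ rn (y - x) < n.+1%:R^-1.
  have [|y [Ly yx]] := cLx (ball x (n.+1%:R^-1)%:C).
    by apply: nbhsx_ballx; rewrite ltcR invr_gt0.
  exists y; split=> //; rewrite rnBC.
  by move: yx; rewrite -ball_normE /= rnE ltcR.
have [u uP] := boolp.choice near.
apply: (sL u) => [n|e e0]; first by case: (uP n).
have [N NP] := exists_invS_lt e0.
by exists N => n Nn; apply: lt_trans (uP n).2 (NP n Nn).
Qed.

Lemma scvg_cst l : scvg (fun=> l) l.
Proof. by move=> e e0; exists 0%N => n _; rewrite subrr rn0. Qed.

Lemma scvg_unique u l m : scvg u l -> scvg u m -> l = m.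
Proof.
move=> ul um; apply/eqP; rewrite -subr_eq0; apply/eqP/rn_le0_eq0/ler_addgt0Pr.
move=> e e0; rewrite add0r.
have [N1 N1P] := ul (e / 2) ltac:(lra); have [N2 N2P] := um (e / 2) ltac:(lra).
have := N1P (maxn N1 N2) (leq_maxl _ _); have := N2P (maxn N1 N2) (leq_maxr _ _).
have := rn_triangle (u (maxn N1 N2)) l m; rewrite (rnBC l (u _)); lra.
Qed.

Lemma scvgD u v l m : scvg u l -> scvg v m -> scvg (fun n => u n + v n) (l + m).
Proof.
move=> ul vm e e0.
have [N1 N1P] := ul (e / 2) ltac:(lra); have [N2 N2P] := vm (e / 2) ltac:(lra).
exists (maxn N1 N2) => n; rewrite geq_max => /andP[/N1P h1 /N2P h2].
have -> : u n + v n - (l + m) = (u n - l) + (v n - m) by rewrite opprD addrACA.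
have := rnD (u n - l) (v n - m); lra.
Qed.

Lemma scvg_shift k u l : scvg u l -> scvg (fun n => u (n + k)%N) l.
Proof.
move=> ul e /ul[N NP]; exists N => n Nn; apply: NP.
by rewrite (leq_trans Nn) ?leq_addr.
Qed.

Lemma scvg_cauchy u l : scvg u l -> scauchy u.
Proof.
move=> ul e e0; have [N NP] := ul (e / 2) ltac:(lra).
exists N => n m /NP h1 /NP h2; have := rn_triangle l (u n) (u m).
rewrite (rnBC l); lra.
Qed.

Lemma scvg_le u l (M : R) : (forall n, rn (u n) <= M) -> scvg u l -> rn l <= M.
Proof.
move=> uM ul; apply/ler_addgt0Pr => e e0; have [N NP] := ul e e0.
have := rn_subl l (u N); rewrite rnBC => h.
have := NP N (leqnn N); have := uM N; lra.
Qed.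

Lemma scauchy_bounded u : scauchy u -> exists M, forall n, rn (u n) <= M.
Proof.
move=> cu; have [N NP] := cu 1 ltr01.
exists (1 + \sum_(i < N.+1) rn (u i)) => n.
have [nN|Nn] := leqP n N.
  rewrite (bigD1 (Ordinal (nN : (n < N.+1)%N))) //=.
  suff : 0 <= \sum_(i < N.+1 | i != Ordinal (nN : (n < N.+1)%N)) rn (u i) by lra.
  by apply: sumr_ge0 => i _; exact: rn_ge0.
have := NP n N (ltnW Nn) (leqnn N); have := rn_subl (u n) (u N).
rewrite (bigD1 ord_max) //=.
suff : 0 <= \sum_(i < N.+1 | i != ord_max) rn (u i) by lra.
by apply: sumr_ge0 => i _; exact: rn_ge0.
Qed.

End RealNorm.

Lemma scvg_lip (R : realType) (V W : normedModType R[i]) (f : V -> W) (M : R)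
    (u : nat -> V) (l : V) :
  (forall x y, rn (f x - f y) <= M * rn (x - y)) -> scvg u l ->
  scvg (f \o u) (f l).
Proof.
move=> fM ul e e0; have [|N NP] := ul (e / (1 + `|M|)).
  by rewrite divr_gt0 // ltr_pwDl.
exists N => n /NP; rewrite ltr_pdivlMr ?ltr_pwDl // => h.
apply: le_lt_trans (fM _ _) _; apply: le_lt_trans h; rewrite mulrC.
by apply: ler_wpM2l; [exact: rn_ge0|have := ler_norm M; lra].
Qed.

Section CompleteNorm.
Variables (R : realType) (V : completeNormedModType R[i]).

Lemma scauchy_cvg (u : nat -> V) : scauchy u -> exists l, scvg u l.
Proof.
move=> cu.
suff /cauchy_cvg : cauchy (u @ \oo).
  by move/cvg_ex => [l ul]; exists l; apply/scvgP.
apply/cauchy_ballP => e e0.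
have er : e = (complex.Re e)%:C by rewrite RRe_real // gtr0_real.
have [|N NP] := cu (complex.Re e); first by rewrite -ltcR -er.
exists (u @` [set n | (N <= n)%N], u @` [set n | (N <= n)%N]) => /=.
  by split; exists N => //= n Nn; exists n.
case=> x y /= [[n Nn <-] [m Nm <-]].
by rewrite -ball_normE /= er rnE ltcR; apply: NP.
Qed.

(** The majorant [r] is increasing and bounded by [M], so it cannot grow by [e / 2] infinitely
    often. From the index after which it no longer does, any two terms of [u] are within [e]. *)
Lemma scauchy_major (u : nat -> V) (r : nat -> R) (M : R) :
  (forall n, rn (u n.+1 - u n) <= r n.+1 - r n) -> (forall n, r n <= M) ->
  scauchy u.
Proof.
move=> ur rM.
have rS n : r n <= r n.+1 by have := ur n; have := rn_ge0 (u n.+1 - u n); lra.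
have rle n m : (n <= m)%N -> r n <= r m.
  by move/subnK <-; elim: (m - n)%N => // k IH; rewrite addSn (le_trans IH).
have step n k : rn (u (k + n)%N - u n) <= r (k + n)%N - r n.
  elim: k => [|k IH]; first by rewrite subrr rn0 subrr.
  rewrite addSn; have := rn_triangle (u (k + n)%N) (u (k + n).+1) (u n).
  have := ur (k + n)%N; lra.
move=> e e0; apply: contrapT => nc.
have jump N : exists m, (N <= m)%N /\ r N + e / 2 <= r m.
  apply: contrapT => nj; apply: nc; exists N => n m Nn Nm.
  have h k : (N <= k)%N -> rn (u k - u N) < e / 2.
    move=> Nk; apply: contrapT => /negP; rewrite -leNgt => ge; apply: nj.
    exists k; split=> //; have := step N (k - N)%N; rewrite subnK //; lra.
  have := rn_triangle (u N) (u n) (u m); have := h _ Nn; have := h _ Nm.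
  rewrite (rnBC (u N)); lra.
have [j jP] := boolp.choice jump.
have big k : r 0%N + k%:R * (e / 2) <= r (iter k j 0%N).
  elim: k => [|k IH] /=; first by rewrite mul0r addr0.
  by have := (jP (iter k j 0%N)).2; rewrite -[k.+1]addn1 natrD; lra.
have := big (Num.truncn ((M - r 0%N) / (e / 2))).+1.
have := truncnS_gt ((M - r 0%N) / (e / 2)).
rewrite ltr_pdivrMr; last by lra.
by have := rM (iter (Num.truncn ((M - r 0%N) / (e / 2))).+1 j 0%N); lra.
Qed.

End CompleteNorm.

(** * Square roots and representations *)

Lemma rn_smul (R : realType) (A : cstarAlgType R) (a b : A) :
  rn (a ** b) <= rn a * rn b.
Proof. by rewrite -lecR rmorphM /= -!rnE norm_smul. Qed.

Lemma rn_starM (R : realType) (A : cstarAlgType R) (a : A) :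
  rn (star a ** a) = rn a ^+ 2.
Proof. by apply: complexI; rewrite rmorphXn /= -!rnE norm_starM. Qed.

Lemma rn_star (R : realType) (A : cstarAlgType R) (a : A) : rn (star a) = rn a.
Proof. by rewrite /rn norm_star. Qed.

Section StarAlgebraTheory.
Variables (R : realType) (A : starAlgType R).
Implicit Types a b c : A.

Lemma smulDl a b c : (a + b) ** c = a ** c + b ** c.
Proof. by have := smul_linearl c 1 a b; rewrite !scale1r. Qed.

Lemma smulDr a b c : c ** (a + b) = c ** a + c ** b.
Proof. by have := smul_linearr c 1 a b; rewrite !scale1r. Qed.

Lemma smulZl (k : R[i]) a c : (k *: a) ** c = k *: (a ** c).
Proof.
have z : 0 ** c = 0 by exact: (linear_at0 (smul_linearl c)).
by have := smul_linearl c k a 0; rewrite z !addr0.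
Qed.

Lemma smulZr (k : R[i]) a c : c ** (k *: a) = k *: (c ** a).
Proof.
have z : c ** 0 = 0 by exact: (linear_at0 (smul_linearr c)).
by have := smul_linearr c k a 0; rewrite z !addr0.
Qed.

Lemma smulNl a c : (- a) ** c = - (a ** c).
Proof. by rewrite -scaleN1r smulZl scaleN1r. Qed.

Lemma smulNr a c : c ** (- a) = - (c ** a).
Proof. by rewrite -scaleN1r smulZr scaleN1r. Qed.

Lemma smulBl a b c : (a - b) ** c = a ** c - b ** c.
Proof. by rewrite smulDl smulNl. Qed.

Lemma smulBr a b c : c ** (a - b) = c ** a - c ** b.
Proof. by rewrite smulDr smulNr. Qed.

Lemma starN a : star (- a) = - star a.
Proof. by rewrite -scaleN1r starZ rmorphN rmorph1 scaleN1r. Qed.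

Lemma starB a b : star (a - b) = star a - star b.
Proof. by rewrite starD starN. Qed.

Lemma star0 : star (0 : A) = 0.
Proof. by rewrite -(subrr 0) starB !subrr. Qed.

Lemma starZr (t : R) a : star (t%:C *: a) = t%:C *: star a.
Proof. by rewrite starZ; congr (_ *: _); exact: conjc_real. Qed.

End StarAlgebraTheory.

Section HalfRoot.
Variables (R : realType) (A : cstarAlgType R).
Implicit Types a b w g : A.

Lemma rn_sqrB a b : rn (a ** a - b ** b) <= (rn a + rn b) * rn (a - b).
Proof.
have -> : a ** a - b ** b = a ** (a - b) + (a - b) ** b.
  by rewrite smulBr smulBl addrA subrK.
have := rnD (a ** (a - b)) ((a - b) ** b).
by have := rn_smul a (a - b); have := rn_smul (a - b) b; lra.
Qed.

Lemma rn_half a : rn (2^-1%:C *: a) = 2^-1 * rn a.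
Proof. by rewrite rnZr ger0_norm // invr_ge0 ler0n. Qed.

(* [1 - g] is the square root of [1 - w]; stated without a unit.  The iterates
   of [g |-> (w + g^2) / 2] are dominated by those of [r |-> (1 + r^2) / 2],
   which increase to a limit at most 1. *)
Lemma half_root w : rn w <= 1 ->
  exists g, [/\ g + g = w + g ** g, rn g <= 1 &
    forall S : set A, closed S -> S 0 ->
      (forall a, S a -> S (2^-1%:C *: (w + a ** a))) -> S g].
Proof.
move=> w1.
pose f a : A := 2^-1%:C *: (w + a ** a); pose x n := iter n f 0.
pose r n := iter n (fun t : R => 2^-1 * (1 + t ^+ 2)) 0.
have r01 n : 0 <= r n <= 1.
  by elim: n => [|n /andP[IH0 IH1]] /=; [lra|nra].
have xr n : rn (x n) <= r n.
  elim: n => [|n IH] /=; first by rewrite rn0.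
  rewrite rn_half; have := rnD w (x n ** x n); have := rn_smul (x n) (x n).
  have := rn_ge0 (x n); have /andP[] := r01 n; nra.
have fB a b : rn (f a - f b) <= 2^-1 * ((rn a + rn b) * rn (a - b)).
  rewrite -scalerBr rn_half ler_pM2l ?invr_gt0 //.
  by rewrite opprD addrACA subrr add0r rn_sqrB.
have xS n : rn (x n.+1 - x n) <= r n.+1 - r n.
  elim: n => [|n IH].
    rewrite subr0 /= /f (linear_at0 (smul_linearr _)) addr0 rn_half expr0n /=.
    by lra.
  have := fB (x n.+1) (x n); rewrite -/(x n.+2).
  have := xr n.+1; have := xr n; have := rn_ge0 (x n.+1); have := rn_ge0 (x n).
  have := rn_ge0 (x n.+1 - x n); move: IH.
  (* The increments of [r] satisfy with equality the recursion that [fB] gives for those of [x] as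
     an inequality. *)
  have -> : r n.+2 - r n.+1 = 2^-1 * ((r n.+1 + r n) * (r n.+1 - r n)).
    by rewrite /r /=; ring.
  move: (rn (x n)) (rn (x n.+1)) (rn (x n.+1 - x n)) (r n) (r n.+1) => p q d s t.
  move=> dst d0 p0 q0 ps qt h; apply: le_trans h _.
  by rewrite ler_pM2l ?invr_gt0 //; apply: ler_pM => //; lra.
have [g xg] : exists g, scvg x g.
  apply: scauchy_cvg; apply: (scauchy_major xS (M := 1)) => n.
  by have /andP[] := r01 n.
have g1 : rn g <= 1.
  by apply: scvg_le xg => n; have := xr n; have /andP[] := r01 n; lra.
exists g; split=> //.
- have fg : scvg (fun n => x n.+1) (f g).
    move=> e e0; have [N NP] := xg e e0; exists N => n /NP h.
    apply: le_lt_trans h; apply: le_trans (fB _ _) _.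
    have := xr n; have /andP[_] := r01 n; have := rn_ge0 (x n - g).
    by move: (rn (x n - g)) (rn (x n)) (rn g) g1 => *; nra.
  have xg1 : scvg (fun n => x n.+1) g.
    by have := scvg_shift 1 xg; rewrite (_ : (fun n => x (n + 1)%N) = (fun n => x n.+1)) //;
       apply/funext => n; rewrite addn1.
  have {1 2}-> := scvg_unique xg1 fg.
  rewrite -scalerDl -rmorphD /=.
  by rewrite (_ : 2^-1 + 2^-1 = 1 :> R) ?scale1r //; lra.
- move=> S cS S0 Sf; apply: (closed_scvg cS _ xg).
  by elim=> [|n IH] //; exact: Sf.
Qed.

End HalfRoot.

Lemma closed_eq_lip (R : realType) (V W : normedModType R[i]) (f : V -> W)
    (M : R) (c : W) :
  (forall x y, rn (f x - f y) <= M * rn (x - y)) -> closed [set x | f x = c].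
Proof.
move=> fM; apply: scvg_closed => u l uc /(scvg_lip fM) h.
apply: scvg_unique h _ => e e0; exists 0%N => n _ /=.
by rewrite uc subrr rn0.
Qed.

Lemma Re_mulr (R : realType) (t : R) (z : R[i]) :
  complex.Re (t%:C * z) = t * complex.Re z.
Proof. by case: z => p q /=; ring. Qed.

Lemma Re_mulNi (R : realType) (z : R[i]) :
  complex.Re (- 'i * z) = complex.Im z.
Proof. by case: z => p q /=; ring. Qed.

(** * Hilbert spaces and representations through the real part of the inner product *)

Section HilbertForm.
Variables (R : realType) (H : completeNormedModType R[i]).
Variables (dot : {dot H for Num.conj}).
Hypothesis dotxx : forall x, dot x x = `|x| ^+ 2.
Implicit Types x y z : H.

Definition redot x y : R := complex.Re (dot x y).

Lemma dotC x y : dot x y = Num.conj (dot y x).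
Proof. by have := @hermitian_subproof _ _ _ _ dot x y; rewrite expr0 mul1r. Qed.

Lemma redotC x y : redot x y = redot y x.
Proof. by rewrite /redot dotC; case: (dot y x). Qed.

Lemma redotDl x y z : redot (x + y) z = redot x z + redot y z.
Proof. by rewrite /redot linearDl raddfD. Qed.

Lemma redotDr x y z : redot z (x + y) = redot z x + redot z y.
Proof. by rewrite /redot linearDr raddfD. Qed.

Lemma redotNl x z : redot (- x) z = - redot x z.
Proof. by rewrite /redot linearNl raddfN. Qed.

Lemma redotNr x z : redot z (- x) = - redot z x.
Proof. by rewrite redotC redotNl redotC. Qed.

Lemma redotZl (t : R) x z : redot (t%:C *: x) z = t * redot x z.
Proof. by rewrite /redot linearZl_LR Re_mulr. Qed.

Lemma redotZr (t : R) x z : redot z (t%:C *: x) = t * redot z x.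
Proof. by rewrite redotC redotZl redotC. Qed.

Lemma redotxx x : redot x x = rn x ^+ 2.
Proof. by apply: complexI; rewrite /redot dotxx rnE -!rmorphXn. Qed.

Lemma redot0l x : redot 0 x = 0.
Proof. by rewrite -(subrr 0) redotDl redotNl subrr. Qed.

Lemma rn_sqrD x y : rn (x + y) ^+ 2 = rn x ^+ 2 + 2 * redot x y + rn y ^+ 2.
Proof.
by rewrite -!redotxx redotDl !redotDr (redotC y x); ring.
Qed.

Lemma rn_sqrBH x y : rn (x - y) ^+ 2 = rn x ^+ 2 - 2 * redot x y + rn y ^+ 2.
Proof. by rewrite rn_sqrD rnN redotNr; ring. Qed.

Lemma redot_cauchy x y : `|redot x y| <= rn x * rn y.
Proof.
have [->|y0] := eqVneq y 0.
  by rewrite redotC redot0l normr0 rn0 mulr0.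
have y1 := rn_gt0 y0.
rewrite -ler_sqr ?nnegrE ?mulr_ge0 ?rn_ge0 // real_normK ?num_real //.
have := mulr_ge0 (sqr_ge0 (rn y))
  (sqr_ge0 (rn (x - (redot x y / rn y ^+ 2)%:C *: y))).
rewrite rn_sqrBH redotZr rnZr [(`|_| * _) ^+ 2]exprMn real_normK ?num_real //.
rewrite exprMn; set d := redot x y; set p := rn x.
move: (rn y) y1 => q q0.
rewrite (_ : q ^+ 2 * _ = p ^+ 2 * q ^+ 2 - d ^+ 2); first by lra.
by field; lra.
Qed.

Lemma redot_le x y : redot x y <= rn x * rn y.
Proof. exact: le_trans (ler_norm _) (redot_cauchy x y). Qed.

Lemma dot_ext x y : (forall z, redot x z = redot y z) -> x = y.
Proof.
move=> h; apply/eqP; rewrite -subr_eq0; apply/eqP/rn0_eq0.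
apply/eqP; rewrite -sqrf_eq0 -redotxx redotDl redotNl h addrN //.
Qed.

End HilbertForm.

Section Representation.
Variables (R : realType) (A : starAlgType R) (H : completeNormedModType R[i]).
Variables (dot : {dot H for Num.conj}) (pi : A -> H -> H).
Hypothesis dotxx : forall x, dot x x = `|x| ^+ 2.
Hypothesis rep : star_representation dot pi.
Implicit Types (a b : A) (x y : H).

Lemma repDr a x y : pi a (x + y) = pi a x + pi a y.
Proof. by have [/(_ a)[l _] _ _ _] := rep; have := l 1 x y; rewrite !scale1r. Qed.

Lemma repZr a (k : R[i]) x : pi a (k *: x) = k *: pi a x.
Proof.
have [/(_ a)[l _] _ _ _] := rep; have := l k x 0.
by rewrite (linear_at0 l) !addr0.
Qed.

Lemma repD a b x : pi (a + b) x = pi a x + pi b x.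
Proof. by have [_ /(_ x) l _ _] := rep; have := l 1 a b; rewrite !scale1r. Qed.

Lemma repZ (k : R[i]) a x : pi (k *: a) x = k *: pi a x.
Proof.
have [_ /(_ x) l _ _] := rep; have := l k a 0.
by rewrite (linear_at0 l) !addr0.
Qed.

Lemma repNr a x : pi a (- x) = - pi a x.
Proof. by rewrite -scaleN1r repZr scaleN1r. Qed.

Lemma repN a x : pi (- a) x = - pi a x.
Proof. by rewrite -scaleN1r repZ scaleN1r. Qed.

Lemma repBr a x y : pi a (x - y) = pi a x - pi a y.
Proof. by rewrite repDr repNr. Qed.

Lemma repB a b x : pi (a - b) x = pi a x - pi b x.
Proof. by rewrite repD repN. Qed.

Lemma rep0 x : pi 0 x = 0.
Proof. by rewrite -(subrr (0 : A)) repB subrr. Qed.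

Lemma rep0r a : pi a 0 = 0.
Proof. by rewrite -(subrr (0 : H)) repBr !subrr. Qed.

Lemma repM a b x : pi (a ** b) x = pi a (pi b x).
Proof. by have [_ _ -> _] := rep. Qed.

Lemma rep_adj a x y : redot dot (pi a x) y = redot dot x (pi (star a) y).
Proof. by have [_ _ _ h] := rep; rewrite /redot h. Qed.

End Representation.

Section Contractive.
Variables (R : realType) (A : cstarAlgType R) (H : completeNormedModType R[i]).
Variables (dot : {dot H for Num.conj}) (pi : A -> H -> H).
Hypothesis dotxx : forall x, dot x x = `|x| ^+ 2.
Hypothesis rep : star_representation dot pi.

Lemma closed_selfadj : closed [set a : A | star a = a].
Proof.
apply: scvg_closed => u l us ul.
have /scvg_unique : scvg (star \o u) (star l).
  by apply: (@scvg_lip _ _ _ _ 1) ul => x y; rewrite -starB rn_star mul1r.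
by apply; rewrite (_ : star \o u = u) //; apply/funext.
Qed.

(** The last clause of [half_root] is an induction principle: a closed property that holds at 0 and
    is preserved by the iteration holds at the root. Here it is applied to self-adjointness, later
    to commutation. *)
Lemma half_root_selfadj (w g : A) : star w = w ->
  (forall S : set A, closed S -> S 0 ->
      (forall a, S a -> S (2^-1%:C *: (w + a ** a))) -> S g) -> star g = g.
Proof.
move=> ws /(_ _ closed_selfadj); apply; first exact: star0.
by move=> a /= as_; rewrite starZr starD starM as_ ws.
Qed.

(** After scaling to [rn b <= 1], let 1 - g be the root of 1 - b^* b. Then |x|^2 - |pi(b) x|^2 = |x
    - pi(g) x|^2, which is nonnegative. The identity is expanded so that only g, and not 1, is
    represented. *)
Lemma rep_contractive a x : rn (pi a x) <= rn a * rn x.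
Proof.
have [->|a0] := eqVneq a 0.
  by rewrite (rep0 rep) rn0 mulr_ge0 ?rn_ge0.
have ra := rn_gt0 a0.
suff unit b : rn b <= 1 -> rn (pi b x) <= rn x.
  have := unit ((rn a)^-1%:C *: a); rewrite rnZr (repZ rep) rnZr.
  rewrite ger0_norm ?invr_ge0 ?rn_ge0 // mulVf ?gt_eqF //.
  by move=> /(_ (lexx _)); rewrite -(ler_pM2l ra) mulrA divff ?gt_eqF // mul1r.
move=> b1.
have [|g [gE _ gS]] := @half_root _ A (star b ** b).
  by rewrite rn_starM expr_le1 ?rn_ge0.
have gs : star g = g by apply: half_root_selfadj gS; rewrite starM starK.
have sq : rn (pi b x) ^+ 2 = 2 * redot dot x (pi g x) - rn (pi g x) ^+ 2.
  have e : redot dot x (pi (g + g) x) =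
      redot dot x (pi (star b ** b) x) + redot dot x (pi (g ** g) x).
    by rewrite gE (repD rep) redotDr.
  move: e; rewrite (repD rep) redotDr !(repM rep) -{3}gs -!(rep_adj rep).
  by rewrite !(redotxx dotxx); lra.
rewrite -ler_sqr ?nnegrE ?rn_ge0 //.
by have := sqr_ge0 (rn (x - pi g x)); rewrite (rn_sqrBH dotxx) sq; lra.
Qed.

End Contractive.

(** * Positive elements of unital C*-algebras *)

HB.mixin Record CStarAlgebra_isUnital (R : realType) B & CStarAlgebra R B := {
  sone : B;
  smul1l : forall a : B, sone ** a = a;
  smul1r : forall a : B, a ** sone = a
}.

#[short(type="unitalCStarAlgType")]
HB.structure Definition UnitalCStarAlgebra (R : realType) :=
  {B of CStarAlgebra R B & CStarAlgebra_isUnital R B}.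

Section NoncommutativeRing.
Variables (R : realType) (B : unitalCStarAlgType R).

(** These instances feed the normaliser behind [ncring]. Scalar multiples [t%:C *: x] are atoms for
    it. *)
#[local] Instance unital_ops : @Ncring.Ring_ops B 0 sone (@GRing.add B)
  (@smul R B) (fun x y => GRing.add x (GRing.opp y)) (@GRing.opp B) (@eq B)
  := {}.

#[local] Instance unital_ring : Ncring.Ring (Ro := unital_ops).
Proof.
constructor; try exact: RelationClasses.eq_equivalence.
1-4: repeat intro; match goal with H : Algebra_syntax.equality ?x ?y |- _ =>
  change (x = y) in H; rewrite H end.
all: try match goal with H : Algebra_syntax.equality ?x ?y |- _ =>
  change (x = y) in H; rewrite H end.
all: try (intros; reflexivity).
- by intro x; change (0 + x = x); exact: add0r.
- by intros x y; change (x + y = y + x); exact: addrC.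
- by intros x y z; change (x + (y + z) = x + y + z); exact: addrA.
- by intros x; change (sone ** x = x); exact: smul1l.
- by intros x; change (x ** sone = x); exact: smul1r.
- by intros x y z; change (x ** (y ** z) = x ** y ** z); exact: smulA.
- by intros x y z; change ((x + y) ** z = x ** z + y ** z); exact: smulDl.
- by intros x y z; change (z ** (x + y) = z ** x + z ** y); exact: smulDr.
- by intro x; change (x - x = 0); exact: subrr.
Qed.

End NoncommutativeRing.

#[global] Existing Instance unital_ops.
#[global] Existing Instance unital_ring.

Ltac ncring := intros; Ncring_tac.non_commutative_ring.

Section UnitalTheory.
Variables (R : realType) (B : unitalCStarAlgType R).
Implicit Types (x y h k : B) (s t : R).

Definition sc t : B := t%:C *: sone.

Lemma star1 : star (sone : B) = sone.
Proof. by rewrite -[star sone]smul1r -{2}(starK sone) -starM smul1r starK. Qed.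

Lemma rn_sqr x : star x = x -> rn (x ** x) = rn x ^+ 2.
Proof. by move=> xs; rewrite -rn_starM xs. Qed.

Lemma rn1 : rn (sone : B) <= 1.
Proof.
have := rn_sqr star1; rewrite smul1r => /eqP; rewrite -subr_eq0.
rewrite (_ : _ - _ = rn (sone : B) * (1 - rn (sone : B))); last by ring.
by rewrite mulf_eq0 subr_eq0 => /orP[] /eqP; lra.
Qed.

Lemma rn_sc t : 0 <= t -> rn (sc t) <= t.
Proof. by move=> t0; rewrite rnZr ger0_norm // ler_piMr // rn1. Qed.

Lemma sc1 : sc 1 = sone. Proof. by rewrite /sc scale1r. Qed.
Lemma sc0 : sc 0 = 0. Proof. by rewrite /sc scale0r. Qed.
Lemma scD s t : sc (s + t) = sc s + sc t.
Proof. by rewrite /sc rmorphD scalerDl. Qed.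
Lemma scN t : sc (- t) = - sc t.
Proof. by rewrite /sc rmorphN scaleNr. Qed.
Lemma scB s t : sc (s - t) = sc s - sc t.
Proof. by rewrite scD scN. Qed.
Lemma scZ s t : s%:C *: sc t = sc (s * t).
Proof. by rewrite /sc scalerA -rmorphM. Qed.
Lemma scM s t : sc s ** sc t = sc (s * t).
Proof. by rewrite smulZl smul1l scZ. Qed.
Lemma scl t x : sc t ** x = t%:C *: x.
Proof. by rewrite smulZl smul1l. Qed.
Lemma scr t x : x ** sc t = t%:C *: x.
Proof. by rewrite smulZr smul1r. Qed.
Lemma scC t x : sc t ** x = x ** sc t.
Proof. by rewrite scl scr. Qed.
Lemma star_sc t : star (sc t) = sc t.
Proof. by rewrite starZr star1. Qed.

(** The norm form of having spectrum in [0, oo). A witness [t] may be enlarged ([pos_witness_le]),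
    and witnesses add up, so sums of positive elements are positive at once. *)
Definition pos h := star h = h /\ exists t, rn (sc t - h) <= t.

Lemma pos_selfadj h : pos h -> star h = h. Proof. by case. Qed.

Lemma pos_witness_le h s t : rn (sc s - h) <= s -> s <= t -> rn (sc t - h) <= t.
Proof.
move=> hs st; have -> : sc t - h = sc (t - s) + (sc s - h).
  by rewrite scB addrA subrK.
by have := rnD (sc (t - s)) (sc s - h); have := rn_sc (t := t - s); lra.
Qed.

Lemma posD h k : pos h -> pos k -> pos (h + k).
Proof.
move=> [hs [s sh]] [ks [t tk]]; split; first by rewrite starD hs ks.
exists (s + t); rewrite scD opprD addrACA.
by have := rnD (sc s - h) (sc t - k); lra.
Qed.

Lemma posZ s h : 0 <= s -> pos h -> pos (s%:C *: h).
Proof.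
move=> s0 [hs [t th]]; split; first by rewrite starZr hs.
by exists (s * t); rewrite -scZ -scalerBr rnZr ger0_norm // ler_wpM2l.
Qed.

Lemma pos_sc t : 0 <= t -> pos (sc t).
Proof. by move=> t0; split; [exact: star_sc|exists t; rewrite subrr rn0]. Qed.

Lemma pos0 : pos 0. Proof. by rewrite -sc0; exact: pos_sc. Qed.
Lemma pos1 : pos sone. Proof. by rewrite -sc1; exact: pos_sc. Qed.

Lemma posMn n h : pos h -> pos (h *+ n).
Proof. by move=> ph; elim: n => [|n IH]; [exact: pos0|rewrite mulrS; exact: posD]. Qed.

Lemma pos_sub_norm h t : star h = h -> rn h <= t -> pos (sc t - h).
Proof.
move=> hs ht; split; first by rewrite starB star_sc hs.
by exists t; rewrite opprB addrC subrK.
Qed.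

Lemma half_root_comm (w g x : B) :
  (forall S : set B, closed S -> S 0 ->
      (forall a, S a -> S (2^-1%:C *: (w + a ** a))) -> S g) ->
  x ** w = w ** x -> x ** g = g ** x.
Proof.
move=> gS xw; suff /eqP : x ** g - g ** x = 0 by rewrite subr_eq0 => /eqP.
have cC : closed [set a : B | x ** a - a ** x = 0].
  apply: (@closed_eq_lip _ _ _ _ (2 * rn x)) => a b.
  have -> : x ** a - a ** x - (x ** b - b ** x) = x ** (a - b) - (a - b) ** x.
    by ncring.
  have := rnB (x ** (a - b)) ((a - b) ** x).
  by have := rn_smul x (a - b); have := rn_smul (a - b) x; lra.
apply: (gS _ cC) => /=; first by rewrite smul0r smul0l subrr.
move=> a /eqP; rewrite subr_eq0 => /eqP xa.
rewrite smulZl smulZr -scalerBr smulDr smulDl xw smulA xa -smulA xa smulA.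
by rewrite subrr scaler0.
Qed.

(** For a positive witness [t], the element w = 1 - h/t has norm at most 1, and [half_root] gives (1
    - g)^2 = 1 - w = h/t. The root 1 - g is positive with witness 1, because its distance from 1 is
    the norm of g. *)
Lemma pos_sqrt h : pos h -> exists r, [/\ pos r, r ** r = h &
  forall x, x ** h = h ** x -> x ** r = r ** x].
Proof.
move=> [hs [t0 t0h]]; set t := t0 + 1.
have t00 : 0 <= t0 by apply: le_trans t0h; exact: rn_ge0.
have tpos : 0 < t by rewrite /t; lra.
have th : rn (sc t - h) <= t by apply: pos_witness_le t0h _; rewrite /t; lra.
pose w := sone - t^-1%:C *: h.
have wE : w = t^-1%:C *: (sc t - h).
  by rewrite scalerBr scZ mulVf ?gt_eqF // sc1.
have ws : star w = w by rewrite starB star1 starZr hs.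
have [|g [gE g1 gS]] := @half_root _ B w.
  by rewrite wE rnZr (ger0_norm (ltW _)) ?invr_gt0 // ler_pdivrMl // mulr1.
have gs := half_root_selfadj ws gS.
have sqE : (sone - g) ** (sone - g) = sone - w.
  have -> : (sone - g) ** (sone - g) = sone - (g + g) + g ** g by ncring.
  by rewrite gE opprD addrA subrK.
exists ((Num.sqrt t)%:C *: (sone - g)); split.
- apply: posZ; first exact: sqrtr_ge0.
  split; first by rewrite starB star1 gs.
  by exists 1; rewrite sc1 opprB addrC subrK.
- rewrite smulZl smulZr scalerA -rmorphM -expr2 sqr_sqrtr ?ltW // sqE /w.
  by rewrite opprB addrC subrK scalerA -rmorphM mulfV ?gt_eqF // scale1r.
- move=> x xh; rewrite smulZl smulZr; congr (_ *: _).
  suff xg : x ** g = g ** x by rewrite smulBr smulBl smul1r smul1l xg.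
  by apply: (half_root_comm (w := w)) => //; rewrite smulBr smulBl smul1r smul1l smulZl smulZr xh.
Qed.

Lemma imaginary_sqr : 'i * 'i = - 1 :> R[i].
Proof. by rewrite -expr2 sqr_i. Qed.

(* [h + i k] is [sqrt c] times a unitary. *)
Lemma rn_le_sum_sqr h k (c : R) : star h = h -> star k = k -> h ** k = k ** h ->
  0 <= c -> h ** h + k ** k = sc c -> rn h ^+ 2 <= c.
Proof.
move=> hs ks hk c0 hkc; pose v := h + 'i *: k.
have sv : star v = h - 'i *: k.
  rewrite starD starZ hs ks; congr (_ + _); rewrite -scaleNr; congr (_ *: _).
  by apply/eqP; rewrite eq_complex /= oppr0 !eqxx.
have svv : star v ** v = sc c.
  rewrite sv /v smulBl !smulDr !smulZl !smulZr scalerA imaginary_sqr -hkc.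
  by rewrite scaleN1r hk opprD opprK addrA addrK.
have rv : rn v ^+ 2 <= c by rewrite -rn_starM svv rn_sc.
have e : 2%:C *: h = v + star v.
  rewrite sv /v addrACA subrr addr0 (_ : 2%:C = 1 + 1 :> R[i]).
    by rewrite scalerDl scale1r.
  by apply/eqP; rewrite eq_complex /= addr0 !eqxx.
have : rn (2%:C *: h) <= 2 * rn v.
  by rewrite e; have := rnD v (star v); rewrite rn_star; lra.
rewrite rnZr ger0_norm // ler_pM2l // => hv.
apply: le_trans rv; rewrite ler_sqr ?nnegrE ?rn_ge0 //.
Qed.

(** Scale h to k of norm at most 1 and let 1 - g be the root of 1 - k^2. The commuting squares (1 -
    g)^2 and k^2 add up to 1, so [rn_le_sum_sqr] bounds 1 - g by 1 in norm. Hence |1 - k^2| = |1 -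
    g|^2 is at most 1, which is positivity of k^2 with witness 1. *)
Lemma pos_sqr h : star h = h -> pos (h ** h).
Proof.
move=> hs; set t := rn h + 1.
have t0 : 0 < t by have := rn_ge0 h; rewrite /t; lra.
pose k := t^-1%:C *: h.
have ks : star k = k by rewrite starZr hs.
have k1 : rn k <= 1.
  rewrite rnZr (ger0_norm (ltW _)) ?invr_gt0 // ler_pdivrMl // mulr1 /t; lra.
have [|g [gE g1 gS]] := @half_root _ B (k ** k).
  by rewrite rn_sqr // expr_le1 ?rn_ge0.
have gs : star g = g by apply: half_root_selfadj gS; rewrite starM ks.
have kg : k ** g = g ** k by apply: (half_root_comm (w := k ** k)) => //; rewrite smulA.
have sqE : (sone - g) ** (sone - g) + k ** k = sc 1.
  have -> : (sone - g) ** (sone - g) + k ** k = sone + (k ** k + g ** g) - (g + g) by ncring.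
  by rewrite gE addrK sc1.
have s1 : rn (sone - g) ^+ 2 <= 1.
  apply: rn_le_sum_sqr sqE => //; first by rewrite starB star1 gs.
  by rewrite smulBl smulBr smul1r smul1l kg.
have pk : pos (k ** k).
  split; first by rewrite starM ks.
  exists 1; have -> : sc 1 - k ** k = (sone - g) ** (sone - g) by rewrite -sqE addrK.
  by rewrite rn_sqr // starB star1 gs.
have hk : h = t%:C *: k.
  by rewrite scalerA -rmorphM mulfV ?gt_eqF // scale1r.
clearbody k; rewrite hk smulZl smulZr scalerA -rmorphM; apply: posZ pk.
exact: sqr_ge0.
Qed.

(** The roots of h and of s - h commute and their squares add up to s, which is the situation of
    [rn_le_sum_sqr]. *)
Lemma pos_le_norm h s : 0 <= s -> pos h -> pos (sc s - h) -> rn h <= s.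
Proof.
move=> s0 ph pk.
have [l [pl lE lC]] := pos_sqrt ph; have [m [pm mE mC]] := pos_sqrt pk.
have hm : h ** m = m ** h.
  by apply: mC; rewrite smulBr smulBl scC.
rewrite -lE rn_sqr; last exact: pos_selfadj.
apply: (@rn_le_sum_sqr l m) => //; [exact: pos_selfadj|exact: pos_selfadj| |].
  by apply/esym/lC.
by rewrite lE mE addrC subrK.
Qed.

Lemma pos_anti h : pos h -> pos (- h) -> h = 0.
Proof.
move=> ph nh; apply: rn_le0_eq0; apply/ler_addgt0Pr => e e0; rewrite add0r.
by apply: pos_le_norm => //; [exact: ltW|apply: posD => //; apply/pos_sc/ltW].
Qed.

Lemma pos_mono h k : pos h -> pos (k - h) -> rn h <= rn k.
Proof.
move=> ph pkh; apply: pos_le_norm => //; first exact: rn_ge0.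
have ks : star k = k by rewrite -(subrK h k) starD !pos_selfadj.
have -> : sc (rn k) - h = (sc (rn k) - k) + (k - h) by rewrite addrA subrK.
by apply: posD => //; apply: pos_sub_norm.
Qed.

Lemma pos_sub_le h t : pos h -> rn h <= t -> rn (sc t - h) <= t.
Proof.
move=> ph ht; have t0 := le_trans (rn_ge0 h) ht.
apply: pos_le_norm => //; first by apply: pos_sub_norm => //; exact: pos_selfadj.
by rewrite opprB addrC subrK.
Qed.

Lemma pos_scvg (u : nat -> B) (l : B) :
  (forall n, pos (u n)) -> scvg u l -> pos l.
Proof.
move=> pu ul; split.
  by apply: (closed_scvg (@closed_selfadj R B) _ ul) => n; exact: pos_selfadj.
have [M uM] := scauchy_bounded (scvg_cauchy ul); exists M.
apply: (@scvg_le _ _ (fun n => sc M - u n)) => [n|]; first exact: pos_sub_le.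
move=> e /ul[N NP]; exists N => n /NP.
by rewrite rnBC (_ : l - u n = sc M - u n - (sc M - l)) //; ncring.
Qed.

Lemma pos_mul h k : pos h -> pos k -> h ** k = k ** h -> pos (h ** k).
Proof.
move=> ph pk hk; have [l [pl lE lC]] := pos_sqrt ph.
have [m [pm mE mC]] := pos_sqrt pk.
have lm : l ** m = m ** l by apply: mC; apply/esym/lC.
have -> : h ** k = (l ** m) ** (l ** m).
  rewrite -lE -mE (_ : l ** l ** (m ** m) = l ** (l ** m) ** m); last by ncring.
  by rewrite {1}lm; ncring.
by apply: pos_sqr; rewrite starM !pos_selfadj.
Qed.

End UnitalTheory.

(** * Absolute values, positive parts, and positivity of [star x ** x] *)

Section PositiveParts.
Variables (R : realType) (B : unitalCStarAlgType R).
Implicit Types (x y h k c d m : B) (s t : R).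

Lemma selfadj_sqr_eq0 x : star x = x -> x ** x = 0 -> x = 0.
Proof.
move=> xs x0; apply: rn0_eq0; apply/eqP; rewrite -sqrf_eq0 -rn_sqr //.
by rewrite x0 rn0.
Qed.

Lemma sqr_sub_eq k h : k ** k = h ** h -> k ** h = h ** k ->
  (k - h) ** (k - h) = k ** (k - h) + k ** (k - h).
Proof.
move=> kk kh; have -> : (k - h) ** (k - h) = k ** k - k ** h - h ** k + h ** h.
  by ncring.
by rewrite -kh -kk; ncring.
Qed.

(** Here k is |h|. Put e = k - h, so e^2 = 2ke, and let m = |e| and d = m - e. Then ed = -md, and
    computing e(ed) in two ways gives m d^2 = -2k d^2. Both m d^2 and k d^2 are positive, so m d^2 =
    0; since d^3 = 2m d^2, also d = 0. Hence e = m is positive. *)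
Lemma pos_sub_abs k h : pos k -> star h = h -> k ** k = h ** h ->
  k ** h = h ** k -> pos (k - h).
Proof.
move=> pk hs kk kh; set e := k - h.
have es : star e = e by rewrite starB hs pos_selfadj.
have ke : k ** e = e ** k by rewrite smulBr smulBl kh.
have ee : e ** e = k ** e + k ** e by exact: sqr_sub_eq.
clearbody e.
have [m [pm mm mC]] := pos_sqrt (pos_sqr es).
have em : e ** m = m ** e by apply: mC; rewrite smulA.
have km : k ** m = m ** k by apply: mC; rewrite smulA ke -smulA ke smulA.
set d := m - e.
have ds : star d = d by rewrite starB es pos_selfadj.
have dd : d ** d = m ** d + m ** d by apply: sqr_sub_eq.
have ed : e ** d = - (m ** d).
  by rewrite /d !smulBr em -mm opprB.
have md : m ** d = d ** m by rewrite /d smulBr smulBl em.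
have kd : k ** d = d ** k by rewrite /d smulBr smulBl km ke.
have em0 : d = 0 -> e = m.
  by move=> d0; apply/eqP; rewrite eq_sym -subr_eq0 -/d d0.
clearbody d.
have mdd : m ** (d ** d) = - (k ** (d ** d) + k ** (d ** d)).
  have e1 : e ** (e ** d) = m ** (m ** d).
    by rewrite ed smulNr smulA em -smulA ed smulNr opprK.
  have e2 : e ** (e ** d) = - (k ** (m ** d) + k ** (m ** d)).
    by rewrite smulA ee smulDl -smulA ed smulNr opprD.
  by rewrite dd !smulDr -e1 e2; ncring.
have pdd := pos_sqr ds.
have m0 : m ** (d ** d) = 0.
  apply: pos_anti.
    by apply: pos_mul => //; rewrite smulA md -smulA md smulA.
  rewrite mdd opprK; apply: posD; apply: pos_mul => //;
  by rewrite smulA kd -smulA kd smulA.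
have d0 : d = 0.
  apply: selfadj_sqr_eq0 => //; apply: selfadj_sqr_eq0; first exact: pos_selfadj.
  have d3 : d ** d ** d = 0 by rewrite dd smulDl -smulA m0 addr0.
  by rewrite smulA d3 smul0l.
by rewrite em0.
Qed.

Lemma half_addxx x : 2^-1%:C *: x + 2^-1%:C *: x = x.
Proof.
rewrite -scalerDl -rmorphD /= (_ : 2^-1 + 2^-1 = 1 :> R) ?scale1r //; lra.
Qed.

(** The root [k] of the square of h is a parameter and not the one of [pos_sqrt], so that
    [truncated_double] can take one of the form 1 - g with g in A. *)
Lemma abs_parts k h (c := 2^-1%:C *: (k + h)) (d := 2^-1%:C *: (k - h)) :
  pos k -> star h = h -> k ** k = h ** h -> k ** h = h ** k ->
  [/\ pos c, pos d, h = c - d, c ** d = 0 & d ** c = 0].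
Proof.
move=> pk hs kk kh; have i0 : 0 <= 2^-1 :> R by rewrite invr_ge0.
split.
- apply: posZ => //; rewrite -[h]opprK; apply: pos_sub_abs => //.
  + by rewrite starN hs.
  + by rewrite smulNl smulNr opprK.
  + by rewrite smulNl smulNr kh.
- by apply: posZ => //; apply: pos_sub_abs.
- rewrite -scalerBr (_ : k + h - (k - h) = h + h); last by ncring.
  by rewrite scalerDr half_addxx.
- rewrite smulZl smulZr (_ : (k + h) ** (k - h) = 0) ?scaler0 //.
  by rewrite smulDl !smulBr kk kh; ncring.
- rewrite smulZl smulZr (_ : (k - h) ** (k + h) = 0) ?scaler0 //.
  by rewrite smulBl !smulDr kk kh; ncring.
Qed.

Lemma pos_part h : star h = h -> exists c d,
  [/\ pos c, pos d, h = c - d, c ** d = 0 & d ** c = 0].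
Proof.
move=> hs; have [k [pk kk kC]] := pos_sqrt (pos_sqr hs).
have hk : h ** k = k ** h by apply: kC; rewrite smulA.
exists (2^-1%:C *: (k + h)), (2^-1%:C *: (k - h)).
by apply: abs_parts => //; exact/esym.
Qed.

Fixpoint spow x n := if n is n'.+1 then x ** spow x n' else sone.

Lemma spowSr x n : spow x n.+1 = spow x n ** x.
Proof.
elim: n => [|n IH]; first by rewrite /= smul1r smul1l.
by rewrite [LHS]/= -/(spow x n.+1) {1}IH smulA.
Qed.

Lemma spow_comm x y n : x ** y = y ** x -> x ** spow y n = spow y n ** x.
Proof.
move=> xy; elim: n => [|n IH] /=; first by rewrite smul1l smul1r.
by rewrite smulA xy -smulA IH smulA.
Qed.

Lemma star_spow x n : star x = x -> star (spow x n) = spow x n.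
Proof.
move=> xs; elim: n => [|n IH]; first exact: star1.
by rewrite [in LHS]spowSr starM xs IH.
Qed.

Lemma spowD x (m n : nat) : spow x (m + n)%N = spow x m ** spow x n.
Proof.
by elim: m => [|m IH] /=; rewrite ?smul1l // IH smulA.
Qed.

Lemma rn_spow_exp2 x n : star x = x -> rn (spow x (2 ^ n)) = rn x ^+ (2 ^ n).
Proof.
move=> xs; elim: n => [|n IH]; first by rewrite expn0 /= smul1r expr1.
rewrite expnS mul2n -addnn spowD rn_sqr; last exact: star_spow.
by rewrite IH exprD expr2.
Qed.

(** If q > 1, Bernoulli's inequality gives q^n >= n (q - 1), and squaring makes q^(2n) grow
    quadratically in n. Along powers of two this beats any linear bound. *)
Lemma le1_of_linear_growth (q M : R) : 0 <= q ->
  (forall n, q ^+ (2 ^ n) <= 1 + (2 ^ n)%:R * M) -> q <= 1.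
Proof.
move=> q0 qM; apply: contrapT => /negP; rewrite -ltNge => q1.
have bern n : 1 + n%:R * (q - 1) <= q ^+ n.
  elim: n => [|n IH]; first by rewrite mul0r addr0 expr0.
  rewrite exprS -[n.+1]addn1 natrD.
  have n0 : 0 <= n%:R * (q - 1) :> R by apply: mulr_ge0; [exact: ler0n|lra].
  have : q * (1 + n%:R * (q - 1)) <= q * q ^+ n by rewrite ler_wpM2l.
  by nra.
have M0 : 0 < M by have := qM 0%N; rewrite expn0 expr1 mul1r; lra.
pose N := Num.truncn ((1 + M + M) / (q - 1) ^+ 2).
have q2 : 0 < (q - 1) ^+ 2 by apply: exprn_gt0; lra.
have := truncnS_gt ((1 + M + M) / (q - 1) ^+ 2); rewrite -/N ltr_pdivrMr //.
have := qM N.+1; rewrite expnS mul2n -addnn exprD natrD.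
have := bern (2 ^ N)%N.
have : N.+1%:R <= (2 ^ N)%:R :> R by rewrite ler_nat ltn_expl.
have : 1 <= N.+1%:R :> R by rewrite ler1n.
move: (q ^+ _) ((2 ^ N)%:R) (N.+1%:R) => Q n N1 h1 h2 h3 h4 h5.
have : n * (q - 1) <= Q by lra.
have n0 : 0 <= n * (q - 1) by apply: mulr_ge0; lra.
move=> h6; have : n * (q - 1) * (n * (q - 1)) <= Q * Q by apply: ler_pM.
have : n * (1 + M + M) <= n * (n * (q - 1) ^+ 2).
  apply: ler_wpM2l; first lra; apply: ltW; apply: lt_le_trans h5 _.
  by apply: ler_wpM2r => //; exact: ltW.
by rewrite expr2; nra.
Qed.

(* [(t + y y^* )^n y = y (t + y^* y)^n], so the norms of the powers of
   [t + y y^*] grow like [t^n], up to a linear factor. *)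
Lemma pos_swap y : pos (- (star y ** y)) -> pos (- (y ** star y)).
Proof.
move=> [_ [t0 t0y]]; set t := t0 + 1.
have tp : 0 < t by have := le_trans (rn_ge0 _) t0y; rewrite /t; lra.
have ty : rn (sc B t + star y ** y) <= t.
  by rewrite -[star y ** y]opprK; apply: pos_witness_le t0y _; rewrite /t; lra.
split; first by rewrite starN starM starK.
exists t; rewrite opprK; set a := sc B t + y ** star y.
set b := sc B t + star y ** y in ty *.
have as_ : star a = a by rewrite starD star_sc starM starK.
have ab n : spow a n ** y = y ** spow b n.
  elim: n => [|n IH] /=; first by rewrite smul1l smul1r.
  by rewrite -smulA IH smulA /a smulDl scC -(smulA y) -smulDr smulA.
have bn n : rn (spow b n) <= t ^+ n.
  elim: n => [|n IH] /=; first exact: rn1.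
  rewrite exprS; apply: le_trans (rn_smul _ _) _.
  by apply: ler_pM => //; exact: rn_ge0.
have an n : rn (spow a n) <= t ^+ n * (1 + n%:R * (rn y ^+ 2 / t)).
  elim: n => [|n IH]; first by rewrite expr0 mul0r addr0 mul1r rn1.
  have -> : spow a n.+1 = t%:C *: spow a n + (y ** spow b n) ** star y.
    by rewrite spowSr {2}/a smulDr scr smulA ab.
  apply: le_trans (rnD _ _) _; rewrite rnZr gtr0_norm //.
  have h1 : t * rn (spow a n) <= t * (t ^+ n * (1 + n%:R * (rn y ^+ 2 / t))).
    by rewrite ler_pM2l.
  have h2 : rn (y ** spow b n ** star y) <= rn y ^+ 2 * t ^+ n.
    apply: le_trans (rn_smul _ _) _; rewrite rn_star expr2 mulrAC.
    rewrite ler_wpM2r ?rn_ge0 //; apply: le_trans (rn_smul _ _) _.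
    by rewrite ler_wpM2l ?rn_ge0 ?bn.
  apply: le_trans (lerD h1 h2) _.
  rewrite (exprS t) -[n.+1%:R]natr1 le_eqVlt; apply/orP; left; apply/eqP.
  by field; lra.
have q0 : 0 <= rn a / t by apply: divr_ge0; [exact: rn_ge0|exact: ltW].
have := @le1_of_linear_growth (rn a / t) (rn y ^+ 2 / t) q0.
rewrite ler_pdivrMr // mul1r; apply=> n.
rewrite expr_div_n -rn_spow_exp2 // ler_pdivrMr ?exprn_gt0 // mulrC.
exact: an.
Qed.

(** Write x^* x = c - d in positive and negative parts and put y = xd. Then y^* y = -d^3 is
    negative, hence so is y y^* by [pos_swap]. But y y^* + y^* y is positive, which makes y y^*
    positive too. So y = 0, d^3 = 0 and d = 0. *)
Lemma pos_starM x : pos (star x ** x).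
Proof.
have hs : star (star x ** x) = star x ** x by rewrite starM starK.
have [c [d [pc pd hE cd dc]]] := pos_part hs.
suff d0 : d = 0 by rewrite hE d0 subr0.
pose y := x ** d; have ds := pos_selfadj pd.
have yy : star y ** y = - (d ** (d ** d)).
  by rewrite /y starM ds -smulA (smulA (star x)) hE smulBl cd sub0r smulNr.
have pd3 : pos (d ** (d ** d)).
  by apply: pos_mul => //; [exact: pos_sqr|rewrite smulA].
have pyy : pos (- (star y ** y)) by rewrite yy opprK.
have yy0 : y ** star y = 0.
  apply: (@pos_anti _ _ _ _ (pos_swap pyy)).
  (* Up to sign, twice the real and imaginary parts of y: p^2 + q^2 = 2 (y y^* + y^* y). *)
  pose p := y + star y; pose q := 'i *: (y - star y).
  have ps : star p = p by rewrite starD starK addrC.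
  have qs : star q = q.
    rewrite starZ starB starK -opprB scalerN -scaleNr; congr (_ *: _).
    by apply/eqP; rewrite eq_complex /= !opprK oppr0 !eqxx.
  have e : p ** p + q ** q = 2%:C *: (y ** star y) + 2%:C *: (star y ** y).
    rewrite /q smulZl smulZr scalerA imaginary_sqr scaleN1r.
    rewrite (_ : 2%:C = 1 + 1 :> R[i]).
      by rewrite !scalerDl !scale1r /p; ncring.
    by apply/eqP; rewrite eq_complex /= addr0 !eqxx.
  rewrite -(half_addxx (y ** star y)) -scalerDl.
  have -> : y ** star y = 2^-1%:C *: (p ** p + q ** q + 2%:C *: - (star y ** y)).
    rewrite e scalerN addrK scalerA -rmorphM /= mulVf ?scale1r //.
  rewrite -rmorphD scalerA -rmorphM; apply: posZ => //.
  apply: posD; last exact: posZ.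
  by apply: posD; exact: pos_sqr.
have y0 : star y ** y = 0.
  apply: rn0_eq0; rewrite rn_starM -rn_star -rn_starM starK yy0 rn0 //.
apply: selfadj_sqr_eq0 => //; apply: selfadj_sqr_eq0; first by rewrite starM ds.
rewrite smulA -(smulA d); move/eqP: yy; rewrite y0 eq_sym oppr_eq0 => /eqP ->.
by rewrite smul0l.
Qed.

Lemma pos_conj x h : pos h -> pos (star x ** h ** x).
Proof.
move=> ph; have [r [pr rE _]] := pos_sqrt ph.
have -> : star x ** h ** x = star (r ** x) ** (r ** x).
  by rewrite starM (pos_selfadj pr) -rE !smulA.
exact: pos_starM.
Qed.

Lemma pos_sub_sqr d : pos d -> pos (sone - d) -> pos (d - d ** d).
Proof.
move=> pd p1d; have -> : d - d ** d = d ** (sone - d) by ncring.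
by apply: pos_mul => //; ncring.
Qed.

Lemma pos_spow m n : pos m -> pos (spow m n).
Proof.
move=> pm; elim: n => [|n IH] /=; first exact: pos1.
by apply: pos_mul => //; apply: spow_comm.
Qed.

(** For 0 <= m <= 1 the sum of (1 - m) m^i over i <= n telescopes to 1 - m^(n+1), and each summand
    is at least the last one. Hence (n + 1)(1 - m) m^n <= 1. This estimate stands in for functional
    calculus wherever powers of m are used. *)
Lemma rn_one_sub_spow m n : pos m -> pos (sone - m) ->
  rn ((sone - m) ** spow m n) <= n.+1%:R^-1.
Proof.
move=> pm p1m; set x := _ ** _.
have cm (k : nat) : (sone - m) ** spow m k = spow m k ** (sone - m).
  by apply: spow_comm; ncring.
have px : pos x by apply: pos_mul => //; exact: pos_spow.
have key : pos (sone - spow m n.+1 - x *+ n.+1).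
  rewrite /x; elim: n {x px} => [|n IH].
    rewrite /= !smul1r mulr1n subrr; exact: pos0.
  have -> : sone - spow m n.+2 - ((sone - m) ** spow m n.+1) *+ n.+2 =
     (sone - spow m n.+1 - ((sone - m) ** spow m n) *+ n.+1) +
     ((sone - m) ** ((sone - m) ** spow m n)) *+ n.+1.
    rewrite [_ *+ n.+2]mulrS [spow m n.+2]/= [spow m n.+1]/=.
    set p := spow m n; set z := (sone - m) ** (m ** p).
    have -> : (sone - m) ** ((sone - m) ** p) = (sone - m) ** p - z.
      by rewrite /z; ncring.
    rewrite mulrnBl; move: (_ *+ n.+1) (_ *+ n.+1) => u v; rewrite /z; ncring.
  apply: posD => //; apply: posMn; apply: pos_mul => //; last first.
    by rewrite {1}cm smulA.
  by apply: pos_mul => //; exact: pos_spow.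
have : rn (x *+ n.+1) <= 1.
  apply: pos_le_norm => //; first exact: posMn.
  rewrite sc1 -[sone](subrK (spow m n.+1)) addrAC.
  by apply: posD => //; exact: pos_spow.
rewrite (_ : x *+ n.+1 = n.+1%:R%:C *: x).
  rewrite rnZr ger0_norm // => h.
  by rewrite -[leRHS]mulr1 ler_pdivlMl ?ltr0n.
by rewrite -scaler_nat; congr (_ *: _); rewrite rmorph_nat.
Qed.

End PositiveParts.

(** * Extreme functionals *)

Section ExtremeFunctional.
Variables (R : realType) (V : lmodType R[i]).
Implicit Types (q f g : V -> R) (x y h : V).

Definition sublinear q :=
  (forall x y, q (x + y) <= q x + q y) /\
  (forall t : R, 0 <= t -> forall x, q (t%:C *: x) <= t * q x).

Definition real_linear f :=
  (forall x y, f (x + y) = f x + f y) /\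
  (forall (t : R) x, f (t%:C *: x) = t * f x).

Lemma real_linearN f x : real_linear f -> f (- x) = - f x.
Proof.
move=> [_ fZ]; have := fZ (-1) x.
by rewrite rmorphN1 scaleN1r mulN1r.
Qed.

Lemma inf_greatest (E : set R) (m : R) : E !=set0 -> lbound E m -> m <= inf E.
Proof.
move=> E0 mE; apply/ler_addgt0Pr => e e0.
have [|x Ex] := @inf_adherent _ E _ e0; first by split=> //; exists m.
by have := mE x Ex; lra.
Qed.

Lemma sublinear0 q : sublinear q -> q 0 = 0.
Proof.
move=> [qD qZ]; apply/le_anti; have := qZ 0 (lexx _) 0; rewrite scaler0 mul0r.
by move=> ->; have := qD 0 0; rewrite addr0; lra.
Qed.

Lemma sublinearN q x : sublinear q -> - q (- x) <= q x.
Proof.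
move=> qs; have [qD _] := qs; have := qD x (- x).
by rewrite subrr sublinear0 //; lra.
Qed.

Lemma sublinearZ q t x : sublinear q -> 0 <= t -> q (t%:C *: x) = t * q x.
Proof.
move=> qs t0; have [qD qZ] := qs.
have [->|tn] := eqVneq t 0; first by rewrite scale0r mul0r sublinear0.
have tp : 0 < t by rewrite lt_neqAle eq_sym tn.
apply/le_anti; rewrite qZ //= -ler_pdivlMl //.
have := qZ t^-1 _ (t%:C *: x); rewrite scalerA -rmorphM mulVf //= scale1r.
by apply; rewrite invr_ge0.
Qed.

(* The directional derivative of [q] in the direction [h]: the linear
   functionals below it are those below [q] that agree with [q] at [h]. *)
Definition dir_set q h x := [set q (x + t%:C *: h) - t * q h | t in [set t | 0 <= t]].

Definition dir q h x : R := inf (dir_set q h x).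

Lemma dir_lb q h x : sublinear q -> lbound (dir_set q h x) (- q (- x)).
Proof.
move=> qs _ [t /= t0 <-]; have [qD _] := qs.
have := qD (x + t%:C *: h) (- x); rewrite addrAC subrr add0r sublinearZ //; lra.
Qed.

Lemma dir_le q h x t : sublinear q -> 0 <= t ->
  dir q h x <= q (x + t%:C *: h) - t * q h.
Proof.
move=> qs t0; apply: ge_inf; last by exists t.
by exists (- q (- x)); exact: dir_lb.
Qed.

Lemma le_dir q h x m : (forall t, 0 <= t -> m <= q (x + t%:C *: h) - t * q h) ->
  m <= dir q h x.
Proof.
move=> mq; apply: inf_greatest.
  by exists (q (x + 0%:C *: h) - 0 * q h), 0 => //=.
by move=> _ [t /= t0 <-]; exact: mq.
Qed.

Lemma dir_le_self q h x : sublinear q -> dir q h x <= q x.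
Proof.
move=> qs; have := dir_le h x qs (lexx 0).
by rewrite scale0r addr0 mul0r subr0.
Qed.

Lemma dirN q h : sublinear q -> dir q h (- h) <= - q h.
Proof.
move=> qs; have := dir_le h (- h) qs ler01.
by rewrite scale1r addNr mul1r sublinear0 // sub0r.
Qed.

Lemma dir_sublinear q h : sublinear q -> sublinear (dir q h).
Proof.
move=> qs; have [qD qZ] := qs; split.
  move=> x y; rewrite -lerBlDr; apply: le_dir => s s0.
  rewrite lerBlDr -lerBlDl; apply: le_dir => t t0.
  rewrite lerBlDl; have := dir_le h (x + y) qs (addr_ge0 s0 t0).
  have := qD (x + s%:C *: h) (y + t%:C *: h).
  rewrite addrACA -scalerDl -rmorphD; lra.
move=> t t0 x; have [->|tn] := eqVneq t 0.
  by rewrite scale0r mul0r; have := dir_le_self h 0 qs; rewrite (sublinear0 qs).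
have tp : 0 < t by rewrite lt_neqAle eq_sym tn.
rewrite -ler_pdivrMl //; apply: le_dir => s s0.
rewrite ler_pdivrMl //; have := dir_le h (t%:C *: x) qs (mulr_ge0 t0 s0).
rewrite rmorphM -scalerA -scalerDr (sublinearZ _ qs t0).
by rewrite mulrBr mulrA.
Qed.

Section Minimal.
Variables (q0 : V -> R) (h0 : V).
Hypothesis q0s : sublinear q0.

(** A sublinear [q] stands for the convex set of real-linear functionals below it; the condition
    says that this set is a face of the set attached to [q0]. *)
Definition face q := forall g1 g2 (c : R), real_linear g1 -> real_linear g2 ->
  (forall x, g1 x <= q0 x) -> (forall x, g2 x <= q0 x) -> 0 < c < 1 ->
  (forall x, c * g1 x + (1 - c) * g2 x <= q x) ->
  (forall x, g1 x <= q x) /\ (forall x, g2 x <= q x).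

(** Passing to [dir q k] selects the functionals that attain [q k] at [k]. A proper convex
    combination attains this maximum only if both of its terms do. *)
Lemma face_dir q k : sublinear q -> face q -> face (dir q k).
Proof.
move=> qs qf g1 g2 c g1l g2l g10 g20 c01 gq.
have [|g1q g2q] := qf g1 g2 c g1l g2l g10 g20 c01.
  by move=> x; apply: le_trans (gq x) (dir_le_self _ _ _).
have gk : q k <= c * g1 k + (1 - c) * g2 k.
  have := gq (- k); have := dirN k qs.
  by rewrite (real_linearN _ g1l) (real_linearN _ g2l); lra.
have [g1k g2k] : q k <= g1 k /\ q k <= g2 k.
  by have := g1q k; have := g2q k; move/andP: c01 => [c0 c1]; split; nra.
split=> x; apply: le_dir => t t0.
  have := g1q (x + t%:C *: k); have [-> ->] := g1l.
  have : t * q k <= t * g1 k by rewrite ler_wpM2l.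
  lra.
have := g2q (x + t%:C *: k); have [-> ->] := g2l.
have : t * q k <= t * g2 k by rewrite ler_wpM2l.
lra.
Qed.

Definition below q :=
  [/\ sublinear q, forall x, q x <= dir q0 h0 x & face q].

Lemma below_dir : below (dir q0 h0).
Proof.
split=> //; first exact: dir_sublinear.
by apply: face_dir => //; move=> g1 g2 c _ _ g10 g20 _ _; split.
Qed.

(** The bound is the pointwise infimum. It is finite because each member is at least - q0 (- x), and
    subadditive because of two members one is below the other. *)
Lemma below_chain (I : Type) (i0 : I) (q : I -> V -> R) :
  (forall i, below (q i)) ->
  (forall i j, (forall x, q i x <= q j x) \/ (forall x, q j x <= q i x)) ->
  exists p, below p /\ forall i x, p x <= q i x.
Proof.
move=> qb qc; pose E x := [set q i x | i in [set: I]]; pose p x := inf (E x).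
have lb x : lbound (E x) (- q0 (- x)).
  move=> _ [i _ <-]; have [qs qd _] := qb i.
  have := sublinearN x qs; have := qd (- x).
  have := dir_le_self h0 (- x) q0s; lra.
have pq i x : p x <= q i x.
  by apply: ge_inf; [exists (- q0 (- x)); exact: lb|exists i].
have lep m x : (forall i, m <= q i x) -> m <= p x.
  move=> mq; apply: inf_greatest; first by exists (q i0 x), i0.
  by move=> _ [i _ <-].
exists p; split=> //; split.
- split=> [x y|t t0 x].
    rewrite -lerBlDr; apply: (lep) => i; rewrite lerBlDr -lerBlDl.
    apply: (lep) => j; rewrite lerBlDl.
    have [[qDi _] _ _] := qb i; have [[qDj _] _ _] := qb j.
    have := pq i (x + y); have := pq j (x + y).
    have := qDi x y; have := qDj x y.
    by case: (qc i j) => [/[dup] /(_ x) + /(_ y)|/[dup] /(_ x) + /(_ y)]; lra.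
  have [->|tn] := eqVneq t 0.
    rewrite scale0r mul0r; have [qs _ _] := qb i0.
    by have := pq i0 0; rewrite (sublinear0 qs).
  have tp : 0 < t by rewrite lt_neqAle eq_sym tn.
  rewrite -ler_pdivrMl //; apply: (lep) => i; rewrite ler_pdivrMl //.
  have [qs _ _] := qb i.
  by have := pq i (t%:C *: x); rewrite (sublinearZ _ qs).
- by move=> x; have [_ qd _] := qb i0; apply: le_trans (pq i0 x) (qd x).
- move=> g1 g2 c g1l g2l g10 g20 c01 gp.
  have gi i : (forall x, g1 x <= q i x) /\ (forall x, g2 x <= q i x).
    have [_ _ qf] := qb i; apply: (qf g1 g2 c) => // x.
    exact: le_trans (gp x) (pq i x).
  by split=> x; apply: (lep) => i; case: (gi i).
Qed.

Lemma below_minimal : exists p, below p /\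
  forall q, below q -> (forall x, q x <= p x) -> q = p.
Proof.
pose T := {q | below q}.
pose le (s t : T) := `[< forall x, sval t x <= sval s x >].
have [|||A Atot|[p pb] pm] := @Zorn T le.
- by move=> s; apply/asboolP.
- move=> r s t /asboolP rs /asboolP st; apply/asboolP => x.
  exact: le_trans (st x) (rs x).
- move=> s t /asboolP st /asboolP ts.
  have e : sval s = sval t.
    by apply/funext => x; apply/le_anti; rewrite ts st.
  by case: s t e {st ts} => [s sb] [t tb] /= e; subst t; congr exist; exact: Prop_irrelevance.
- have [[i0 Ai0]|nA] := pselect (exists i, A i); last first.
    exists (exist _ _ below_dir) => s As; exfalso; apply: nA; by exists s.
  have [||p [pb pq]] := @below_chain {s : T | A s} (exist _ i0 Ai0)
      (fun s => sval (sval s)).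
  + by move=> s; exact: (svalP (sval s)).
  + move=> [s As] [t At] /=.
    by case: (Atot s t As At) => /asboolP h; [right|left].
  + exists (exist _ p pb) => s As; apply/asboolP => x /=.
    exact: (pq (exist _ s As)).
- exists p; split=> // q qb qp.
  have := pm (exist _ q qb); rewrite /le /=.
  by move=> /(_ (introT (asboolP _) qp)) [].
Qed.

(** Hahn-Banach and Krein-Milman in one application of Zorn's lemma. A minimal sublinear [f] that
    defines a face equals its own directional derivatives, so f (- x) = - f x and [f] is linear. Its
    face is then the single point [f], and starting from [dir q0 h0] keeps the value at [h0]
    maximal. *)
Lemma extreme_functional : exists f,
  [/\ real_linear f, forall x, f x <= q0 x, f h0 = q0 h0 &
   forall g1 g2 (c : R), real_linear g1 -> real_linear g2 ->
  (forall x, g1 x <= q0 x) -> (forall x, g2 x <= q0 x) -> 0 < c < 1 ->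
  (forall x, f x = c * g1 x + (1 - c) * g2 x) -> forall x, g1 x = f x].
Proof.
have [f [[fs fd ff] fm]] := below_minimal; exists f.
have fN x : f (- x) = - f x.
  have e : dir f x = f.
    apply: fm; last by move=> y; exact: dir_le_self.
    split; [exact: dir_sublinear| |exact: face_dir].
    by move=> y; apply: le_trans (dir_le_self _ _ fs) (fd y).
  have := dirN x fs; rewrite e; have := sublinearN x fs; lra.
have fl : real_linear f.
  have [fD _] := fs; split=> [x y|t x].
    apply/le_anti; rewrite fD /=; have := fD (- x) (- y).
    by rewrite -opprD !fN; lra.
  have [t0|t0] := leP 0 t; first exact: sublinearZ.
  have := @sublinearZ f (- t) x fs; rewrite rmorphN scaleNr fN mulNr.
  by move=> h; apply: oppr_inj; apply: h; lra.
have f0 x : f x <= q0 x by apply: le_trans (fd x) (dir_le_self _ _ q0s).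
split=> //.
  by apply/le_anti; rewrite f0 /=; have := fd (- h0); have := dirN h0 q0s; rewrite fN; lra.
move=> g1 g2 c g1l g2l g10 g20 c01 fg x.
have [|g1f _] := ff g1 g2 c g1l g2l g10 g20 c01.
  by move=> y; rewrite fg.
apply/le_anti; rewrite g1f /=; have := g1f (- x).
by rewrite (real_linearN _ g1l) (real_linearN _ fl); lra.
Qed.

End Minimal.
End ExtremeFunctional.

(** * Pure states *)

Section States.
Variables (R : realType) (B : unitalCStarAlgType R).
Implicit Types (x y h j : B).

Definition star_ideal (J : set B) :=
  [/\ J 0, forall (k : R[i]) x y, J x -> J y -> J (k *: x + y),
      forall x j, J j -> J (x ** j) /\ J (j ** x) & forall j, J j -> J (star j)].

(** The real part of a state. Working with it keeps the extremality argument real; [cstate] recovers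
    the complex functional. *)
Record state := State {
  state_fun :> B -> R;
  state_linear : real_linear state_fun;
  state_pos : forall h, pos h -> 0 <= state_fun h;
  state1 : state_fun sone = 1;
  state_star : forall x, state_fun (star x) = state_fun x
}.

Variables (J : set B) (a : B) (eps : R).
Hypothesis idealJ : star_ideal J.
Hypothesis eps_gt0 : 0 < eps.
Hypothesis dist_a : forall j, J j -> eps <= rn (a - j).

Lemma idealD x y : J x -> J y -> J (x + y).
Proof.
by move=> Jx Jy; have [_ JD _ _] := idealJ; have := JD 1 _ _ Jx Jy; rewrite scale1r.
Qed.

Lemma idealZ (k : R[i]) x : J x -> J (k *: x).
Proof.
by move=> Jx; have [J0 JD _ _] := idealJ; have := JD k _ _ Jx J0; rewrite addr0.
Qed.

Lemma idealN x : J x -> J (- x).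
Proof. by move=> Jx; rewrite -scaleN1r; exact: idealZ. Qed.

(* [j <= k + e / 2] with [k = j^2 / (2 e)] in [J], and conjugating by the
   elements [(1 - k / T)^n] of [1 + J] makes [k] small. *)
Lemma dist_ideal_le t j : 0 <= t -> J j -> star j = j ->
  pos (sc B t - star a ** a - j) -> eps ^+ 2 <= t.
Proof.
move=> t0 Jj js p; apply/ler_addgt0Pr => e e0.
have [_ _ JM _] := idealJ.
pose k := (2 * e)^-1%:C *: (j ** j).
have Jk : J k by apply: idealZ; case: (JM j j Jj).
have pk : pos k by apply: posZ; [rewrite invr_ge0; lra|exact: pos_sqr].
have pjk : pos (j + k + sc B (e / 2)).
  have := @posZ _ _ (2 * e)^-1 _ _ (@pos_sqr _ _ (j + sc B e) _).
  have -> : (j + sc B e) ** (j + sc B e) = j ** j + (2 * e)%:C *: j + sc B (e * e).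
    have -> : (2 * e)%:C *: j = e%:C *: j + e%:C *: j.
      by rewrite -scalerDl -rmorphD; congr (_%:C *: _); ring.
    by rewrite smulDl !smulDr scM !scl scr; ncring.
  rewrite !scalerDr scalerA -rmorphM mulVf; last by lra.
  rewrite scale1r scZ (_ : (2 * e)^-1 * (e * e) = e / 2); last by field; lra.
  rewrite (addrC (_ *: _)); apply; first by rewrite invr_ge0; lra.
  by rewrite starD js star_sc.
have {p pjk} pq : pos (sc B (t + e / 2) + k - star a ** a).
  have -> : sc B (t + e / 2) + k - star a ** a =
    (sc B t - star a ** a - j) + (j + k + sc B (e / 2)).
    by rewrite scD; ncring.
  exact: posD.
pose T := rn k + 1; have T0 : 0 < T by have := rn_ge0 k; rewrite /T; lra.
pose m := sone - T^-1%:C *: k.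
have p1m : pos (sone - m).
  rewrite /m opprB addrC subrK; apply: posZ => //.
  by rewrite invr_ge0 ltW.
have pm : pos m.
  rewrite /m -sc1; apply: pos_sub_norm; first by rewrite starZr (pos_selfadj pk).
  by rewrite rnZr (ger0_norm (ltW _)) ?invr_gt0 // ler_pdivrMl // mulr1 /T; lra.
have Jw n : J (sone - spow m n).
  elim: n => [|n IH] /=; first by rewrite subrr; have [] := idealJ.
  have kE : T^-1%:C *: k = sone - m by rewrite /m opprB addrC subrK.
  rewrite (_ : _ - _ = T^-1%:C *: k + m ** (sone - spow m n)); last first.
    by rewrite kE; ncring.
  by apply: idealD; [exact: idealZ|case: (JM m _ IH)].
have [n nP] := @exists_invS_lt _ (e / 2 / T) ltac:(by rewrite !divr_gt0).
have {nP} := nP (n + n)%N (leq_addr _ _); set w := spow m n.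
rewrite ltr_pdivlMr // => nT.
have ws : star w = w by apply: star_spow; exact: pos_selfadj.
have rw : rn w <= 1.
  rewrite /w; elim: (n) => [|i IH] /=; first exact: rn1.
  apply: le_trans (rn_smul _ _) _; apply: mulr_ile1 => //; try exact: rn_ge0.
  by apply: pos_le_norm => //; rewrite sc1.
have kE : k = T%:C *: (sone - m).
  by rewrite /m opprB addrC subrK scalerA -rmorphM mulfV ?gt_eqF // scale1r.
have wkw : rn (w ** k ** w) <= e / 2.
  have -> : w ** k ** w = T%:C *: ((sone - m) ** spow m (n + n)).
    rewrite kE smulZr smulZl spowD smulA; congr (_ *: (_ ** _)).
    by apply/esym/spow_comm; ncring.
  rewrite rnZr gtr0_norm //; apply: ltW; apply: le_lt_trans nT.
  by rewrite mulrC ler_wpM2r ?(ltW T0) //; exact: rn_one_sub_spow.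
have aw : rn (a ** w) ^+ 2 <= t + e.
  rewrite -rn_starM.
  have -> : star (a ** w) ** (a ** w) = star w ** (star a ** a) ** w.
    by rewrite starM !smulA.
  have p0 : pos (star w ** (star a ** a) ** w) by exact/pos_conj/pos_starM.
  have := pos_conj w pq.
  rewrite smulBr smulBl => /(pos_mono p0) h; apply: le_trans h _.
  rewrite smulDr smulDl ws; apply: le_trans (rnD _ _) _.
  have : rn (w ** sc B (t + e / 2) ** w) <= t + e / 2.
    rewrite scr smulZl rnZr ger0_norm; last by lra.
    apply: ler_piMr; first by lra.
    apply: le_trans (rn_smul _ _) _; apply: mulr_ile1 => //; exact: rn_ge0.
  by lra.
have : eps <= rn (a ** w).
  have -> : a ** w = a - a ** (sone - w) by ncring.
  by apply: dist_a; case: (JM a _ (Jw n)).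
by have := eps_gt0; have := rn_ge0 (a ** w); move: aw; nra.
Qed.

Definition half_re x : B := 2^-1%:C *: (x + star x).

Lemma half_re_selfadj x : star (half_re x) = half_re x.
Proof. by rewrite starZr starD starK addrC. Qed.

Lemma half_re_id h : star h = h -> half_re h = h.
Proof. by move=> hs; rewrite /half_re hs scalerDr half_addxx. Qed.

Lemma half_reD x y : half_re (x + y) = half_re x + half_re y.
Proof. by rewrite /half_re starD addrACA scalerDr. Qed.

Lemma half_reZ (t : R) x : half_re (t%:C *: x) = t%:C *: half_re x.
Proof. by rewrite /half_re starZr -scalerDr !scalerA mulrC. Qed.

Lemma half_reN x : half_re (- x) = - half_re x.
Proof. by rewrite /half_re starN -opprD scalerN. Qed.

Lemma ideal_half_re j : J j -> J (half_re j).
Proof. by move=> Jj; have [_ _ _ JS] := idealJ; apply/idealZ/idealD => //; exact: JS. Qed.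

Definition upper x := [set t | exists j, [/\ J j, star j = j &
  pos (sc B t - half_re x - j)]].

(** The least t such that the real part of x is at most t modulo J. It takes the place of the upper
    end of the spectrum in the quotient by J. *)
Definition gauge x : R := inf (upper x).

Lemma upper_intro x t : pos (sc B t - half_re x) -> upper x t.
Proof.
by move=> p; have [J0 _ _ _] := idealJ; exists 0; rewrite star0 subr0.
Qed.

Lemma upper_half_re x : upper x (rn (half_re x)).
Proof. by apply/upper_intro/pos_sub_norm => //; exact: half_re_selfadj. Qed.

(** The hypothesis says that 0 <= T modulo J with T negative. A large multiple then gives
    [star a ** a] <= 0 modulo J, against the distance of [a] from J. *)
Lemma upper_neg_absurd (T : R) j : T < 0 -> J j -> star j = j ->
  pos (sc B T - j) -> False.
Proof.
(* The factor is chosen such that l T = - [rn (star a ** a)]. *)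
move=> T0 Jj js p; pose l := rn (star a ** a) / (- T).
have l0 : 0 <= l by apply: divr_ge0; [exact: rn_ge0|lra].
suff : eps ^+ 2 <= 0 by have := exprn_gt0 2 eps_gt0; lra.
apply: (@dist_ideal_le 0 (l%:C *: j)) => //.
- exact: idealZ.
- by rewrite starZr js.
have := posD (posZ l0 p)
  (@pos_sub_norm _ _ (star a ** a) _ (pos_selfadj (pos_starM a)) (lexx _)).
rewrite scalerBr scZ; congr pos.
have -> : sc B (rn (star a ** a)) = - sc B (l * T).
  by rewrite -scN; congr sc; rewrite /l; field; lra.
by rewrite sc0; ncring.
Qed.

Lemma upper_lb x : lbound (upper x) (- rn (half_re x)).
Proof.
move=> t [j [Jj js p]]; apply: contrapT => /negP; rewrite -ltNge => lt.
apply: (@upper_neg_absurd (t + rn (half_re x)) j) => //; first by lra.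
have := posD p (@pos_sub_norm _ _ (- half_re x) _ _ (lexx _)).
rewrite starN half_re_selfadj rnN => /(_ erefl); congr pos.
by rewrite scD; ncring.
Qed.

Lemma gauge_le x t : upper x t -> gauge x <= t.
Proof. by apply: ge_inf; exists (- rn (half_re x)); exact: upper_lb. Qed.

Lemma le_gauge x m : (forall t, upper x t -> m <= t) -> m <= gauge x.
Proof.
by move=> h; apply: inf_greatest => //; exists (rn (half_re x)); exact: upper_half_re.
Qed.

Lemma gauge_sublinear : sublinear gauge.
Proof.
split=> [x y|t t0 x].
  rewrite -lerBlDr; apply: le_gauge => s [i [Ji is_ ps]].
  rewrite lerBlDr -lerBlDl; apply: le_gauge => t [j [Jj js pt]].
  rewrite lerBlDl; apply: gauge_le; exists (i + j); split.
  - exact: idealD.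
  - by rewrite starD is_ js.
  - by have := posD ps pt; congr pos; rewrite half_reD scD; ncring.
have [->|tn] := eqVneq t 0.
  rewrite scale0r mul0r; apply/gauge_le/upper_intro.
  by rewrite half_re_id ?star0 // subr0 sc0; exact: pos0.
have tp : 0 < t by rewrite lt_neqAle eq_sym tn.
rewrite -ler_pdivrMl //; apply: le_gauge => s [j [Jj js ps]].
rewrite ler_pdivrMl //; apply: gauge_le; exists (t%:C *: j); split.
- exact: idealZ.
- by rewrite starZr js.
- by have := posZ t0 ps; congr pos; rewrite !scalerBr scZ half_reZ.
Qed.

Lemma gauge_a : eps ^+ 2 <= gauge (star a ** a).
Proof.
apply: le_gauge => t [j [Jj js]]; rewrite half_re_id; last by rewrite starM starK.
have [t0 p|t0 p] := leP 0 t; first exact: (dist_ideal_le t0 Jj).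
have : eps ^+ 2 <= 0; last by have := exprn_gt0 2 eps_gt0; lra.
apply: (@dist_ideal_le 0 j) => //.
have := posD p (@pos_sc _ B (- t) _); rewrite oppr_ge0 (ltW t0) => /(_ isT).
by congr pos; rewrite sc0 scN; ncring.
Qed.

(** Turns extremality among the functionals below [gauge] into extremality among the states that
    vanish on J. *)
Lemma state_le_gauge (f : state) : (forall j, J j -> f j = 0) ->
  forall x, f x <= gauge x.
Proof.
move=> fJ x; apply: le_gauge => t [j [Jj _ p]].
have [fD fZ] := state_linear f; have := state_pos f p.
rewrite !fD !(real_linearN _ (state_linear f)) (fJ j Jj) oppr0 addr0.
by rewrite /sc /half_re !fZ fD state1 state_star; lra.
Qed.

(** The functional is extreme below [gauge] with maximal value at [star a ** a]. All properties of a
    state follow from f <= [gauge] by testing suitable elements: -h for positive h, the unit and its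
    negative, j and -j in J, and the skew-adjoint elements x - x^* and x^* - x. *)
Lemma exists_pure_state : exists f : state,
  [/\ forall j, J j -> f j = 0, eps ^+ 2 <= f (star a ** a) &
   forall (g1 g2 : state) (c : R),
     (forall j, J j -> g1 j = 0) -> (forall j, J j -> g2 j = 0) ->
     0 < c < 1 -> (forall x, f x = c * g1 x + (1 - c) * g2 x) ->
     forall x, g1 x = f x].
Proof.
have [f [fl fg fa fe]] := extreme_functional (star a ** a) gauge_sublinear.
have f_le0 x : upper x 0 -> f x <= 0.
  by move=> u; apply: le_trans (fg x) (gauge_le u).
have fpos h : pos h -> 0 <= f h.
  move=> ph; have : upper (- h) 0; last first.
    by move/f_le0; rewrite (real_linearN _ fl); lra.
  apply: upper_intro; rewrite half_reN half_re_id; last exact: pos_selfadj.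
  by rewrite sc0 sub0r opprK.
have f1 : f sone = 1.
  apply/le_anti/andP; split.
    apply: le_trans (fg _) _; apply/gauge_le/upper_intro.
    by rewrite half_re_id ?star1 // sc1 subrr; exact: pos0.
  suff : f (- sone) <= - 1 by rewrite (real_linearN _ fl); lra.
  apply: le_trans (fg _) _; apply/gauge_le/upper_intro.
  by rewrite half_reN half_re_id ?star1 // scN sc1 opprK addNr; exact: pos0.
have fJ j : J j -> f j = 0.
  have le0 i : J i -> f i <= 0.
    move=> Ji; apply: f_le0; exists (- half_re i); split.
    - exact/idealN/ideal_half_re.
    - by rewrite starN half_re_selfadj.
    - by rewrite opprK sc0 sub0r addNr; exact: pos0.
  move=> Jj; have := le0 _ Jj; have := le0 _ (idealN Jj).
  by rewrite (real_linearN _ fl); lra.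
have fstar x : f (star x) = f x.
  have le0 y : star y = - y -> f y <= 0.
    move=> ys; apply/f_le0/upper_intro.
    by rewrite /half_re ys subrr scaler0 subr0 sc0; exact: pos0.
  have := le0 (x - star x); have := le0 (star x - x).
  have [fD _] := fl.
  rewrite !starB !starK !opprB !fD !(real_linearN _ fl).
  by move=> /(_ erefl) h1 /(_ erefl) h2; lra.
exists (State fl fpos f1 fstar); split=> //=.
  by rewrite fa; exact: gauge_a.
move=> g1 g2 c g1J g2J c01 fc x.
by apply: (fe g1 g2 c) => //; try exact: state_linear; exact: state_le_gauge.
Qed.

End States.

(** * The GNS representation *)

Section SequentialCompleteness.
Variables (R : realType) (V : normedModType R[i]).

(** Balls of radius 1/(n+1) suffice to describe the uniformity, so a Cauchy filter is followed by a
    sequence picked in decreasing members of it. *)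
Lemma seq_complete (F : set_system V) :
  (forall u : nat -> V, scauchy u -> exists l, scvg u l) ->
  ProperFilter F -> cauchy F -> cvg F.
Proof.
move=> Vc FF /cauchy_ballP Fc.
have near (n : nat) : exists A : set V, F A /\
    forall x y, A x -> A y -> rn (x - y) < n.+1%:R^-1.
  have e0 : 0 < n.+1%:R^-1 :> R by rewrite invr_gt0.
  have [|[A1 A2] /= [FA1 FA2] A12] := Fc (n.+1%:R^-1)%:C; first by rewrite ltcR.
  exists (A1 `&` A2); split=> [|x y [A1x _] [_ A2y]]; first exact: filterI.
  have := A12 (x, y) (conj A1x A2y).
  by rewrite /= -ball_normE /= rnE ltcR.
have [A AP] := boolp.choice near.
pose D n := [set x | forall k, (k <= n)%N -> A k x].
have FD n : F (D n).
  elim: n => [|n IH].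
    by apply: filterS (AP 0%N).1 => x Ax k; rewrite leqn0 => /eqP ->.
  apply: filterS (filterI IH (AP n.+1).1) => x [Dx Ax] k.
  by rewrite leq_eqVlt ltnS => /orP[/eqP ->|/Dx].
have [u uD] : {u : nat -> V & forall n, D n (u n)}.
  exists (fun n => projT1 (cid (filter_ex (FD n)))) => n.
  exact: (projT2 (cid (filter_ex (FD n)))).
have uA n k : (k <= n)%N -> A k (u n) by move=> kn; exact: (uD n k kn).
have [|l ul] := Vc u.
  move=> e /exists_invS_lt[N NP]; exists N => n m Nn Nm.
  by apply: lt_trans (NP N (leqnn N)); apply: (AP N).2; [exact: (uA n N Nn)|exact: (uA m N Nm)].
apply/cvg_ex; exists l; apply/cvgrPdist_lt => e e0.
have er : e = (complex.Re e)%:C by rewrite RRe_real // gtr0_real.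
have er0 : 0 < complex.Re e by rewrite -ltcR -er.
have [N1 N1P] := ul (complex.Re e / 2) ltac:(lra).
have [N2 N2P] := @exists_invS_lt _ (complex.Re e / 2) ltac:(lra).
pose N := maxn N1 N2.
apply: filterS (AP N).1 => x Ax; rewrite er rnE ltcR.
have := (AP N).2 x (u N) Ax (uA N N (leqnn N)).
have := N2P N (leq_maxr _ _); have := N1P N (leq_maxl _ _).
have := rn_triangle (u N) l x; rewrite (rnBC l (u N)) (rnBC (u N) x).
by move: (N.+1%:R^-1) => v; lra.
Qed.

End SequentialCompleteness.

Lemma rlim_exists (R : realType) (u : nat -> R) :
  (forall e : R, 0 < e ->
    exists N, forall n m, (N <= n)%N -> (N <= m)%N -> `|u n - u m| < e) ->
  exists l, forall e : R, 0 < e ->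
    exists N, forall n, (N <= n)%N -> `|u n - l| < e.
Proof.
move=> cu; suff /cauchy_cvg : cauchy (u @ \oo).
  move/cvg_ex => [l /cvgrPdist_lt ul]; exists l => e /ul [N _ NP].
  by exists N => n Nn; rewrite distrC; apply: NP.
apply/cauchy_ballP => e e0; have [N NP] := cu e e0.
exists (u @` [set n | (N <= n)%N], u @` [set n | (N <= n)%N]) => /=.
  by split; exists N => //= n Nn; exists n.
by case=> x y /= [[n Nn <-] [m Nm <-]]; apply: NP.
Qed.

Section ComplexModulus.
Variable R : realType.
Implicit Types (z w : R[i]) (t : R).

Definition cm z : R := complex.Re `|z|.

Lemma cmE z : `|z| = (cm z)%:C.
Proof. by rewrite /cm RRe_real // normr_real. Qed.

Lemma cm_ge0 z : 0 <= cm z.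
Proof. by rewrite -ler0c -cmE. Qed.

Lemma cmD z w : cm (z + w) <= cm z + cm w.
Proof. by rewrite -lecR rmorphD /= -!cmE ler_normD. Qed.

Lemma cmM z w : cm (z * w) = cm z * cm w.
Proof. by apply: complexI; rewrite rmorphM /= -!cmE normrM. Qed.

Lemma cmN z : cm (- z) = cm z.
Proof. by rewrite /cm normrN. Qed.

Lemma cmBC z w : cm (z - w) = cm (w - z).
Proof. by rewrite -cmN opprB. Qed.

Lemma cm0 : cm 0 = 0.
Proof. by rewrite /cm normr0. Qed.

Lemma cm1 : cm 1 = 1.
Proof. by rewrite /cm normr1. Qed.

Lemma cm_eq0 z : cm z <= 0 -> z = 0.
Proof.
move=> z0; apply/eqP; rewrite -normr_eq0 cmE (_ : cm z = 0) //.
by apply/le_anti; rewrite z0 cm_ge0.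
Qed.

Lemma cm_triangle y z w : cm (z - w) <= cm (z - y) + cm (y - w).
Proof. by rewrite (le_trans _ (cmD _ _)) // addrA subrK. Qed.

Lemma cm_real t : cm t%:C = `|t|.
Proof. by rewrite /cm normc_def /= expr0n addr0 sqrtr_sqr. Qed.

Lemma cm_conj z : cm (Num.conj z) = cm z.
Proof. by rewrite /cm norm_conjC. Qed.

Lemma Re_le_cm z : `|complex.Re z| <= cm z.
Proof. by rewrite -lecR -cmE normc_ge_Re. Qed.

Lemma Im_le_cm z : `|complex.Im z| <= cm z.
Proof.
have := Re_le_cm (- 'i * z); rewrite Re_mulNi cmM /cm normrN normc_def /=.
by rewrite expr0n expr1n add0r sqrtr1 mul1r.
Qed.

Lemma cm_le_ReIm z : cm z <= `|complex.Re z| + `|complex.Im z|.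
Proof.
rewrite {1}[z]complexE; apply: le_trans (cmD _ _) _.
rewrite cm_real cmM cm_real /cm normc_def /= expr0n expr1n add0r sqrtr1 mul1r.
by [].
Qed.

Lemma rn_cmZ (V : normedModType R[i]) z (x : V) : rn (z *: x) = cm z * rn x.
Proof. by rewrite rnZ. Qed.

Lemma clim_exists (u : nat -> R[i]) :
  (forall e : R, 0 < e ->
    exists N, forall n m, (N <= n)%N -> (N <= m)%N -> cm (u n - u m) < e) ->
  exists l, forall e : R, 0 < e ->
    exists N, forall n, (N <= n)%N -> cm (u n - l) < e.
Proof.
move=> cu.
have [|p pP] := @rlim_exists _ (fun n => complex.Re (u n)).
  move=> e /cu[N NP]; exists N => n m Nn Nm.
  by apply: le_lt_trans (NP n m Nn Nm); rewrite -raddfB Re_le_cm.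
have [|q qP] := @rlim_exists _ (fun n => complex.Im (u n)).
  move=> e /cu[N NP]; exists N => n m Nn Nm.
  by apply: le_lt_trans (NP n m Nn Nm); rewrite -raddfB Im_le_cm.
exists (p +i* q) => e e0.
have [N1 N1P] := pP (e / 2) ltac:(lra); have [N2 N2P] := qP (e / 2) ltac:(lra).
exists (maxn N1 N2) => n; rewrite geq_max => /andP[/N1P h1 /N2P h2].
apply: le_lt_trans (cm_le_ReIm _) _; move: h1 h2.
by case: (u n) => s t /=; lra.
Qed.

End ComplexModulus.

Section StateForm.
Variables (R : realType) (B : unitalCStarAlgType R) (f : state B).
Implicit Types (x y z b : B).

Definition cstate x : R[i] := f x +i* (- f ('i *: x)).

Lemma stateD x y : f (x + y) = f x + f y.
Proof. by case: (state_linear f). Qed.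

Lemma stateZ (t : R) x : f (t%:C *: x) = t * f x.
Proof. by case: (state_linear f). Qed.

Lemma stateN x : f (- x) = - f x.
Proof. exact: (real_linearN _ (state_linear f)). Qed.

Lemma cstateD x y : cstate (x + y) = cstate x + cstate y.
Proof.
by apply/eqP; rewrite eq_complex /= scalerDr !stateD opprD !eqxx.
Qed.

Lemma cstateZ (k : R[i]) x : cstate (k *: x) = k * cstate x.
Proof.
case: k => p q; have -> : p +i* q = p%:C + 'i * q%:C :> R[i].
  by apply/eqP; rewrite eq_complex /=; apply/andP; split; apply/eqP; ring.
have e : (p%:C + 'i * q%:C) *: x = p%:C *: x + q%:C *: ('i *: x).
  by rewrite scalerDl scalerA mulrC.
apply/eqP; rewrite e eq_complex /= scalerDr !stateD.
rewrite !(scalerA 'i) !(mulrC 'i) -!scalerA !stateZ.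
rewrite (scalerA 'i 'i) imaginary_sqr scaleN1r stateN.
by apply/andP; split; apply/eqP; ring.
Qed.

Lemma cstate_star x : cstate (star x) = Num.conj (cstate x).
Proof.
rewrite (_ : Num.conj (cstate x) = f x +i* f ('i *: x)); last first.
  by apply/eqP; rewrite eq_complex /= opprK !eqxx.
congr (_ +i* _); first exact: state_star.
rewrite -state_star starZ starK -stateN -scaleNr; congr (f (_ *: x)).
by apply/eqP; rewrite eq_complex /= opprK oppr0 !eqxx.
Qed.

Lemma cstate_pos b : pos b -> cstate b = (f b)%:C.
Proof.
move=> pb; apply/eqP; rewrite eq_complex /= eqxx oppr_eq0 /=.
have := state_star f ('i *: b); rewrite starZ (pos_selfadj pb).
rewrite (_ : Num.conj 'i = - 'i :> R[i]); last first.
  by apply/eqP; rewrite eq_complex /= oppr0 !eqxx.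
by rewrite scaleNr stateN => h; apply/eqP; lra.
Qed.

Definition sn x : R := Num.sqrt (f (star x ** x)).

Lemma sn_ge0 x : 0 <= sn x. Proof. exact: sqrtr_ge0. Qed.

Lemma sn_sqr x : sn x ^+ 2 = f (star x ** x).
Proof. by rewrite sqr_sqrtr // state_pos //; exact: pos_starM. Qed.

Lemma snZ (k : R[i]) x : sn (k *: x) = cm k * sn x.
Proof.
apply/eqP; rewrite -(eqrXn2 (_ : 0 < 2)%N) ?mulr_ge0 ?sn_ge0 ?cm_ge0 //.
rewrite exprMn !sn_sqr starZ smulZl smulZr scalerA.
have -> : Num.conj k * k = (cm k ^+ 2)%:C.
  by rewrite rmorphXn /= -cmE normCK mulrC.
by rewrite stateZ.
Qed.

Lemma state_cauchy_real x y : f (star y ** x) <= sn x * sn y.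
Proof.
have key (t : R) : 0 <= sn x ^+ 2 - 2 * t * f (star y ** x) + t ^+ 2 * sn y ^+ 2.
  have := state_pos f (pos_starM (x - t%:C *: y)).
  rewrite starB starZr smulBl !smulBr !smulZl !smulZr !stateD !stateN.
  rewrite !stateD !stateN !stateZ !sn_sqr -(state_star f (star x ** y)) starM starK.
  by congr (_ <= _); ring.
(* If [sn y] vanishes, the quadratic polynomial in t is affine, and a positive slope coefficient f
   (y^* x) would allow a t at which it equals -1. *)
have [y0|y0] := eqVneq (sn y) 0.
  rewrite y0 mulr0; apply: contrapT => /negP; rewrite -ltNge => d0.
  have := key ((sn x ^+ 2 + 1) / (2 * f (star y ** x))).
  rewrite y0 expr0n /= mulr0 addr0.
  rewrite (_ : _ - _ = - 1); first by lra.
  by field; lra.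
have y1 : 0 < sn y by rewrite lt_neqAle eq_sym y0 sn_ge0.
have := key (f (star y ** x) / sn y ^+ 2).
set d := f _; rewrite (_ : _ + _ = (sn x ^+ 2 * sn y ^+ 2 - d ^+ 2) / sn y ^+ 2).
  rewrite pmulr_lge0 ?invr_gt0 ?exprn_gt0 // subr_ge0 -exprMn => h.
  have [d0|d0] := leP 0 d; last first.
    by apply: le_trans (ltW d0) _; apply: mulr_ge0; exact: sn_ge0.
  by rewrite -ler_sqr ?nnegrE ?mulr_ge0 ?sn_ge0.
by field; lra.
Qed.

(** Multiplying x by a number k of modulus 1 makes the value real and equal to its modulus, and the
    real inequality applies. *)
Lemma cstate_cauchy x y : cm (cstate (star y ** x)) <= sn x * sn y.
Proof.
set z := cstate _; have [z0|z0] := leP (cm z) 0.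
  by apply: le_trans z0 _; apply: mulr_ge0; exact: sn_ge0.
pose k := (cm z)^-1%:C * Num.conj z.
have kz : k * z = (cm z)%:C.
  rewrite /k -mulrA (mulrC (Num.conj z)) -normCK cmE -rmorphXn -rmorphM.
  by congr (_%:C); field; lra.
have ck : cm k = 1.
  rewrite /k cmM cm_real cm_conj ger0_norm ?invr_ge0 ?ltW // mulVf //; lra.
have := state_cauchy_real (k *: x) y; rewrite snZ ck mul1r smulZr.
have -> : f (k *: (star y ** x)) = complex.Re (cstate (k *: (star y ** x))) by [].
by rewrite cstateZ -/z kz.
Qed.

Lemma sn_mul b x : sn (b ** x) <= rn b * sn x.
Proof.
rewrite -ler_sqr ?nnegrE ?mulr_ge0 ?sn_ge0 ?rn_ge0 // exprMn !sn_sqr starM.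
have := state_pos f (@pos_conj _ _ x _ (@pos_sub_norm _ _ (star b ** b) _
  (pos_selfadj (pos_starM b)) (lexx _))).
rewrite smulBr smulBl stateD stateN rn_starM scr smulZl stateZ !smulA; lra.
Qed.

Lemma sn1 : sn sone = 1.
Proof. by rewrite /sn smul1r star1 state1 sqrtr1. Qed.

End StateForm.

(* The Hilbert space of the GNS construction, realised inside the antidual of
   [B]: the functions [x |-> phi x] that are uniform limits, with respect to the
   seminorm [sn f], of the functions [x |-> f (x^* y)]. *)
Section GNSSpace.
Variables (R : realType) (B : unitalCStarAlgType R) (f : state B).
Implicit Types (x y z b : B) (e c : R).
Local Notation F := (cstate f).
Local Notation N := (sn f).

Definition gns_approx (phi : B -> R[i]) y e :=
  forall x, cm (phi x - F (star x ** y)) <= e * N x.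

Definition gns_pred : {pred B -> R[i]} :=
  fun phi => `[< forall e, 0 < e -> exists y, gns_approx phi y e >].

Lemma gns_approx_lin (k : R[i]) phi psi y z e c :
  gns_approx phi y e -> gns_approx psi z c ->
  gns_approx (k *: phi + psi) (k *: y + z) (cm k * e + c).
Proof.
move=> hy hz x; rewrite !fctE smulDr smulZr cstateD cstateZ.
have -> : k *: phi x + psi x - (k * F (star x ** y) + F (star x ** z)) =
  k * (phi x - F (star x ** y)) + (psi x - F (star x ** z)).
  by rewrite /GRing.scale /=; ring.
apply: le_trans (cmD _ _) _; rewrite cmM mulrDl -mulrA.
by apply: lerD => //; rewrite ler_wpM2l ?cm_ge0.
Qed.

Lemma gns_submod : submod_closed gns_pred.
Proof.
split=> [|k phi psi /asboolP hphi /asboolP hpsi]; apply/asboolP => e e0.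
  exists 0 => x; rewrite smul0r -(scale0r (0 : B)) cstateZ mul0r subr0 cm0.
  by apply: mulr_ge0; [exact: ltW|exact: sn_ge0].
have k1 : 0 < cm k + 1 by have := cm_ge0 k; lra.
have [y hy] := hphi (e / (cm k + 1)) ltac:(by rewrite divr_gt0).
have [z hz] := hpsi (e / (cm k + 1)) ltac:(by rewrite divr_gt0).
exists (k *: y + z) => x; have := gns_approx_lin k hy hz x.
by rewrite (_ : cm k * _ + _ = e) //; field; lra.
Qed.

HB.instance Definition _ :=
  GRing.isSubmodClosed.Build R[i] (B -> R[i]) gns_pred gns_submod.

Record gns := GNS { gns_fun : B -> R[i]; _ : gns_fun \in gns_pred }.

HB.instance Definition _ := [isSub for gns_fun].
HB.instance Definition _ := [Choice of gns by <:].
HB.instance Definition _ := [SubChoice_isSubLmodule of gns by <:].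

Implicit Types phi psi chi : gns.

Lemma gns_ext phi psi : (forall x, gns_fun phi x = gns_fun psi x) -> phi = psi.
Proof. by move=> h; apply: val_inj; apply/funext. Qed.

Lemma gnsP phi e : 0 < e -> exists y, gns_approx (gns_fun phi) y e.
Proof. by move: (valP phi) => /asboolP; apply. Qed.

Lemma gns_funD phi psi x : gns_fun (phi + psi) x = gns_fun phi x + gns_fun psi x.
Proof. by []. Qed.

Lemma gns_funZ (k : R[i]) phi x : gns_fun (k *: phi) x = k * gns_fun phi x.
Proof. by []. Qed.

Lemma gns_funN phi x : gns_fun (- phi) x = - gns_fun phi x.
Proof. by []. Qed.

Lemma gns_vec_subproof y : (fun x => F (star x ** y)) \in gns_pred.
Proof.
apply/asboolP => e e0; exists y => x; rewrite subrr cm0.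
by apply: mulr_ge0; [exact: ltW|exact: sn_ge0].
Qed.

Definition vec y := GNS (gns_vec_subproof y).

Definition gns_bounds phi := [set c | 0 <= c /\ forall x, cm (gns_fun phi x) <= c * N x].

Definition gnorm phi : R := inf (gns_bounds phi).

Lemma gns_bounds_ne phi : gns_bounds phi !=set0.
Proof.
have [y hy] := gnsP phi ltr01; exists (1 + N y); split.
  by have := sn_ge0 f y; lra.
move=> x; have := cm_triangle (F (star x ** y)) (gns_fun phi x) 0.
rewrite !subr0; have := hy x; have := cstate_cauchy f y x; lra.
Qed.

Lemma gnorm_le phi c : 0 <= c -> (forall x, cm (gns_fun phi x) <= c * N x) ->
  gnorm phi <= c.
Proof. by move=> c0 h; apply: ge_inf; [exists 0 => d []|split]. Qed.

Lemma gnorm_ge0 phi : 0 <= gnorm phi.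
Proof. by apply: inf_greatest; [exact: gns_bounds_ne|move=> d []]. Qed.

Lemma gnormP phi x : cm (gns_fun phi x) <= gnorm phi * N x.
Proof.
apply/ler_addgt0Pr => e e0; set d := e / (N x + 1).
have n1 : 0 < N x + 1 by have := sn_ge0 f x; lra.
have d0 : 0 < d by rewrite divr_gt0.
have [|c [c0 cP] cd] := @inf_adherent _ (gns_bounds phi) d d0.
  by split; [exact: gns_bounds_ne|exists 0 => ? []].
apply: le_trans (cP x) _.
have : c * N x <= (gnorm phi + d) * N x.
  by rewrite ler_wpM2r ?sn_ge0 //; exact: ltW.
have : d * N x <= e.
  by rewrite /d mulrAC ler_pdivrMr // ler_wpM2l ?ltW //; lra.
by rewrite mulrDl; lra.
Qed.

Lemma gnormD phi psi : gnorm (phi + psi) <= gnorm phi + gnorm psi.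
Proof.
apply: gnorm_le => [|x]; first by rewrite addr_ge0 ?gnorm_ge0.
rewrite gns_funD mulrDl; apply: le_trans (cmD _ _) _.
by apply: lerD; exact: gnormP.
Qed.

Lemma gnormZ_le (k : R[i]) phi : gnorm (k *: phi) <= cm k * gnorm phi.
Proof.
apply: gnorm_le => [|x]; first by rewrite mulr_ge0 ?gnorm_ge0 ?cm_ge0.
by rewrite gns_funZ cmM -mulrA ler_wpM2l ?cm_ge0 ?gnormP.
Qed.

Lemma gnormZ (k : R[i]) phi : gnorm (k *: phi) = cm k * gnorm phi.
Proof.
have [->|k0] := eqVneq k 0.
  rewrite cm0 mul0r; apply/le_anti; rewrite gnorm_ge0 andbT.
  by have := gnormZ_le 0 phi; rewrite cm0 mul0r.
apply/le_anti; rewrite gnormZ_le /=.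
have := gnormZ_le k^-1 (k *: phi); rewrite scalerA mulVf // scale1r.
have ck : 0 < cm k by rewrite -ltcR -cmE normr_gt0.
have -> : cm k^-1 = (cm k)^-1.
  apply: (mulfI (lt0r_neq0 ck)).
  by rewrite -cmM mulfV // cm1 mulfV // lt0r_neq0.
by rewrite ler_pdivlMl.
Qed.

Definition gns_norm phi : R[i] := (gnorm phi)%:C.

Fact gns_normD phi psi : gns_norm (phi + psi) <= gns_norm phi + gns_norm psi.
Proof. by rewrite -rmorphD lecR; exact: gnormD. Qed.

Fact gns_normZ (k : R[i]) phi : gns_norm (k *: phi) = `|k| * gns_norm phi.
Proof. by rewrite cmE -rmorphM /gns_norm gnormZ. Qed.

Fact gns_norm0_eq0 phi : gns_norm phi = 0 -> phi = 0.
Proof.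
move=> /complexI n0; apply: gns_ext => x; apply: cm_eq0.
by have := gnormP phi x; rewrite n0 mul0r.
Qed.

HB.instance Definition _ :=
  Lmodule_isNormed.Build R[i] gns gns_normD gns_normZ gns_norm0_eq0.

Lemma gns_funP phi x : cm (gns_fun phi x) <= rn phi * N x.
Proof. exact: gnormP. Qed.

Lemma gns_close phi y e : 0 <= e -> gns_approx (gns_fun phi) y e ->
  rn (phi - vec y) <= e.
Proof. by move=> e0 h; apply: gnorm_le. Qed.

Lemma gns_dense phi e : 0 < e -> exists y, rn (phi - vec y) <= e.
Proof.
move=> e0; have [y hy] := gnsP phi e0; exists y.
by apply: gns_close => //; exact: ltW.
Qed.

Lemma vecD y z : vec (y + z) = vec y + vec z.
Proof. by apply: gns_ext => x /=; rewrite smulDr cstateD. Qed.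

Lemma vecZ (k : R[i]) y : vec (k *: y) = k *: vec y.
Proof. by apply: gns_ext => x /=; rewrite smulZr cstateZ. Qed.

Lemma vecN y : vec (- y) = - vec y.
Proof. by rewrite -scaleN1r vecZ scaleN1r. Qed.

Lemma rn_vec y : rn (vec y) = N y.
Proof.
apply/le_anti/andP; split.
  apply: gnorm_le => [|x]; first exact: sn_ge0.
  exact: cstate_cauchy.
have := gns_funP (vec y) y; rewrite /= cstate_pos; last exact: pos_starM.
rewrite -sn_sqr cm_real ger0_norm ?sqr_ge0 // expr2.
have [->|n0] := eqVneq (N y) 0; first by rewrite rn_ge0.
by rewrite ler_pM2r // lt_neqAle eq_sym n0 sn_ge0.
Qed.

Lemma gns_fun_antilinear phi (k : R[i]) x y :
  gns_fun phi (k *: x + y) = Num.conj k * gns_fun phi x + gns_fun phi y.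
Proof.
apply/eqP; rewrite -subr_eq0; apply/eqP/cm_eq0/ler_addgt0Pr => e e0.
pose M := N (k *: x + y) + cm k * N x + N y + 1.
have M0 : 0 < M.
  have := sn_ge0 f (k *: x + y); have := sn_ge0 f x; have := sn_ge0 f y.
  by have := mulr_ge0 (cm_ge0 k) (sn_ge0 f x); rewrite /M; lra.
have d0 := divr_gt0 e0 M0; have dM : e / M * M = e by field; lra.
move: (e / M) d0 dM => d d0 dM.
have [z hz] := gnsP phi d0.
have -> : gns_fun phi (k *: x + y) - (Num.conj k * gns_fun phi x + gns_fun phi y) =
  (gns_fun phi (k *: x + y) - F (star (k *: x + y) ** z)) -
  (Num.conj k * (gns_fun phi x - F (star x ** z)) +
   (gns_fun phi y - F (star y ** z))).
  by rewrite starD starZ smulDl smulZl cstateD cstateZ; ring.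
apply: le_trans (cmD _ _) _; rewrite cmN add0r.
have := cmD (Num.conj k * (gns_fun phi x - F (star x ** z)))
  (gns_fun phi y - F (star y ** z)); rewrite cmM cm_conj.
have := hz (k *: x + y); have := hz y.
have := ler_wpM2l (cm_ge0 k) (hz x).
by move: dM; rewrite /M; lra.
Qed.

Lemma gns_seq_complete (u : nat -> gns) : scauchy u -> exists l, scvg u l.
Proof.
move=> cu.
have ptw x : exists l : R[i], forall e : R, 0 < e ->
    exists n0, forall n, (n0 <= n)%N -> cm (gns_fun (u n) x - l) < e.
  apply: clim_exists => e e0; set d := e / (N x + 1).
  have n1 : 0 < N x + 1 by have := sn_ge0 f x; lra.
  have [n0 n0P] := cu d (divr_gt0 e0 n1); exists n0 => n m nn nm.
  have := gns_funP (u n - u m) x; rewrite gns_funD gns_funN => h.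
  apply: le_lt_trans h _; have := n0P n m nn nm.
  rewrite /d ltr_pdivlMr // => h; have := rn_ge0 (u n - u m).
  by have := sn_ge0 f x; nra.
have [l lP] := boolp.choice ptw.
have near e : 0 < e -> exists n0, forall n, (n0 <= n)%N ->
    forall x, cm (gns_fun (u n) x - l x) <= e * N x.
  move=> e0; have [n0 n0P] := cu e e0; exists n0 => n nn x.
  apply/ler_addgt0Pr => d d0; have [n1 n1P] := lP x d d0.
  pose m := maxn n0 n1.
  have := cm_triangle (gns_fun (u m) x) (gns_fun (u n) x) (l x).
  have := n1P m (leq_maxr _ _).
  have := gns_funP (u n - u m) x; rewrite gns_funD gns_funN.
  have := n0P n m nn (leq_maxl _ _); have := sn_ge0 f x.
  move=> h1 h2 h3 h4 h5.
  have : rn (u n - u m) * N x <= e * N x by rewrite ler_wpM2r // ltW.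
  lra.
have lg : l \in gns_pred.
  apply/asboolP => e e0; have e2 : 0 < e / 2 by lra.
  have [n0 n0P] := near _ e2.
  have [y hy] := gnsP (u n0) e2; exists y => x.
  have := cm_triangle (gns_fun (u n0) x) (l x) (F (star x ** y)).
  have := n0P n0 (leqnn _) x; have := hy x; rewrite (cmBC (l x) (gns_fun (u n0) x)); lra.
exists (GNS lg) => e e0; have e2 : 0 < e / 2 by lra.
have [n0 n0P] := near _ e2; exists n0 => n nn.
have : rn (u n - GNS lg) <= e / 2.
  by apply: gnorm_le; [exact: ltW|move=> x; exact: n0P].
lra.
Qed.

HB.instance Definition _ := Uniform_isComplete.Build gns
  (fun G GF => @seq_complete R gns G gns_seq_complete GF).

(** A vector phi is the function z |-> <phi, vec z>, so <phi, chi> has to be the limit of phi (u n)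
    along vec (u n) --> chi. The estimate for all z determines the number ([gdot_unique]), so later
    arguments need no sequence. *)
Lemma gns_inner_exists phi chi : exists c : R[i],
  forall z, cm (c - gns_fun phi z) <= rn phi * rn (chi - vec z).
Proof.
have apx (n : nat) : exists y, rn (chi - vec y) <= n.+1%:R^-1.
  by apply: gns_dense; rewrite invr_gt0.
have [u uP] := boolp.choice apx.
have funB x y : gns_fun phi x - gns_fun phi y = gns_fun phi (x - y).
  rewrite (_ : x - y = -1 *: y + x); last by rewrite scaleN1r addrC.
  by rewrite gns_fun_antilinear rmorphN1 mulN1r addrC.
have B1 x y : cm (gns_fun phi x - gns_fun phi y) <=
    rn phi * (rn (chi - vec x) + rn (chi - vec y)).
  rewrite funB; apply: le_trans (gns_funP _ _) _.
  rewrite ler_wpM2l ?rn_ge0 // -rn_vec vecD vecN.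
  by have := rn_triangle chi (vec x) (vec y); rewrite (rnBC (vec x) chi).
have [|c cP] := @clim_exists _ (fun n => gns_fun phi (u n)).
  move=> e e0; pose d := e / 2 / (rn phi + 1).
  have p1 : 0 < rn phi + 1 by have := rn_ge0 phi; lra.
  have d0 : 0 < d by rewrite !divr_gt0.
  have [n0 n0P] := exists_invS_lt d0; exists n0 => n m nn nm.
  apply: le_lt_trans (B1 _ _) _.
  have := n0P n nn; have := n0P m nm; have := uP n; have := uP m.
  move: (n.+1%:R^-1) (m.+1%:R^-1) => s t h1 h2 h3 h4.
  have h5 : rn (chi - vec (u n)) + rn (chi - vec (u m)) < d + d by lra.
  have := rn_ge0 (chi - vec (u n)); have := rn_ge0 (chi - vec (u m)).
  have : (d + d) * (rn phi + 1) = e by rewrite /d; field; lra.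
  have := rn_ge0 phi; nra.
exists c => z; apply/ler_addgt0Pr => e e0.
pose d := e / 2 / (rn phi + 1).
have p1 : 0 < rn phi + 1 by have := rn_ge0 phi; lra.
have d0 : 0 < d by rewrite !divr_gt0.
have [n0 n0P] := exists_invS_lt d0.
have [n1 n1P] := cP (e / 2) ltac:(lra).
pose n := maxn n0 n1.
have h1 := n0P n (leq_maxl _ _); have h2 := n1P n (leq_maxr _ _).
have h3 := B1 (u n) z; have h4 := uP n.
have := cm_triangle (gns_fun phi (u n)) c (gns_fun phi z); rewrite (cmBC c (gns_fun phi (u n))).
have : d * (rn phi + 1) = e / 2 by rewrite /d; field; lra.
have : rn phi * rn (chi - vec (u n)) <= d * (rn phi + 1).
  rewrite mulrC; apply: ler_pM; rewrite ?rn_ge0 //; last by lra.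
  by apply: le_trans h4 _; exact: ltW.
move: h3; rewrite mulrDr; lra.
Qed.

Definition gdot phi chi : R[i] := projT1 (cid (gns_inner_exists phi chi)).

Lemma gdotP phi chi z : cm (gdot phi chi - gns_fun phi z) <= rn phi * rn (chi - vec z).
Proof. by rewrite /gdot; case: cid. Qed.

Lemma gdot_unique phi chi (c : R[i]) (M : R) : 0 <= M ->
  (forall z, cm (c - gns_fun phi z) <= M * rn (chi - vec z)) -> gdot phi chi = c.
Proof.
move=> M0 h; apply/eqP; rewrite -subr_eq0; apply/eqP/cm_eq0/ler_addgt0Pr.
move=> e e0; rewrite add0r.
have p1 : 0 < rn phi + M + 1 by have := rn_ge0 phi; lra.
have [z hz] := gns_dense chi (divr_gt0 e0 p1).
have := cm_triangle (gns_fun phi z) (gdot phi chi) c.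
rewrite (cmBC (gns_fun phi z) c); have := gdotP phi chi z; have := h z.
have : (rn phi + M + 1) * rn (chi - vec z) <= (rn phi + M + 1) * (e / (rn phi + M + 1)).
  by rewrite ler_pM2l.
rewrite (_ : _ * (e / _) = e); last by field; lra.
have := rn_ge0 (chi - vec z); rewrite !mulrDl; lra.
Qed.

Lemma gdot_linear chi (k : R[i]) phi psi :
  gdot (k *: phi + psi) chi = k * gdot phi chi + gdot psi chi.
Proof.
apply: (@gdot_unique _ _ _ (cm k * rn phi + rn psi)).
  by rewrite addr_ge0 ?mulr_ge0 ?rn_ge0 ?cm_ge0.
move=> z; rewrite gns_funD gns_funZ.
have -> : k * gdot phi chi + gdot psi chi - (k * gns_fun phi z + gns_fun psi z) =
  k * (gdot phi chi - gns_fun phi z) + (gdot psi chi - gns_fun psi z) by ring.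
apply: le_trans (cmD _ _) _; rewrite cmM mulrDl -mulrA.
by apply: lerD; [rewrite ler_wpM2l ?cm_ge0 ?gdotP|exact: gdotP].
Qed.

Lemma vec_conj y z : gns_fun (vec y) z = Num.conj (gns_fun (vec z) y).
Proof. by rewrite /= -cstate_star starM starK. Qed.

Lemma gdot_herm phi chi : gdot phi chi = Num.conj (gdot chi phi).
Proof.
apply: (@gdot_unique _ _ _ (rn phi)); first exact: rn_ge0.
move=> z; apply/ler_addgt0Pr => e e0.
pose K := rn chi + rn (chi - vec z) + N z + 1.
have K0 : 0 < K.
  by have := rn_ge0 chi; have := rn_ge0 (chi - vec z); have := sn_ge0 f z; rewrite /K; lra.
have [y hy] := gns_dense phi (divr_gt0 e0 K0).
set d := e / K in hy; have d0 : 0 < d by rewrite divr_gt0.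
have h1 := gdotP chi phi y.
have h2 := gns_funP (chi - vec z) y.
have h3 := gns_funP (vec y - phi) z.
have h4 : N y <= rn phi + d.
  by rewrite -rn_vec; have := rn_subl (vec y) phi; rewrite (rnBC (vec y)); lra.
have := cm_triangle (Num.conj (gns_fun chi y)) (Num.conj (gdot chi phi)) (gns_fun phi z).
have := cm_triangle (gns_fun (vec y) z) (Num.conj (gns_fun chi y)) (gns_fun phi z).
rewrite (vec_conj y z) -!rmorphB !cm_conj -vec_conj.
move: h2 h3; rewrite !gns_funD !gns_funN => h2 h3.
rewrite (rnBC (vec y)) in h3.
have h5 : rn chi * rn (phi - vec y) <= rn chi * d by rewrite ler_wpM2l ?rn_ge0.
have h6 : rn (phi - vec y) * N z <= d * N z by rewrite ler_wpM2r ?sn_ge0.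
have h7 : rn (chi - vec z) * N y <= rn (chi - vec z) * (rn phi + d).
  by rewrite ler_wpM2l ?rn_ge0.
have : d * K = e by rewrite /d; field; lra.
by rewrite /K; lra.
Qed.

Lemma gdot_self phi : gdot phi phi = `|phi| ^+ 2.
Proof.
rewrite rnE -rmorphXn /=; apply/eqP; rewrite -subr_eq0; apply/eqP/cm_eq0.
apply/ler_addgt0Pr => e e0; rewrite add0r.
pose K := 4 * rn phi + 2.
have K0 : 0 < K by have := rn_ge0 phi; rewrite /K; lra.
(* The bound 1 keeps [N y] at most [rn phi + 1], so the error in the squared norm is linear in d. *)
have m0 : 0 < Num.min 1 (e / K) by rewrite lt_min ltr01 divr_gt0.
have [y hy] := gns_dense phi m0; set d := Num.min 1 (e / K) in m0 hy.
have d1 : d <= 1 by rewrite ge_min lexx.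
have dK : d * K <= e by rewrite -ler_pdivlMr // ge_min lexx orbT.
have h1 := gdotP phi phi y.
have h2 := gns_funP (phi - vec y) y.
rewrite gns_funD gns_funN /= cstate_pos in h2; last exact: pos_starM.
rewrite -sn_sqr in h2.
have h3 : `|N y - rn phi| <= d.
  rewrite -rn_vec ler_norml; apply/andP; split.
    by have := rn_subl phi (vec y); lra.
  by have := rn_subl (vec y) phi; rewrite (rnBC (vec y)); lra.
have := cm_triangle (gns_fun phi y) (gdot phi phi) (rn phi ^+ 2)%:C.
have := cm_triangle (N y ^+ 2)%:C (gns_fun phi y) (rn phi ^+ 2)%:C.
rewrite -rmorphB cm_real.
have h4 : `|N y ^+ 2 - rn phi ^+ 2| <= d * (2 * rn phi + 1).
  rewrite subr_sqr normrM; apply: ler_pM => //.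
  have := sn_ge0 f y; have := rn_ge0 phi => p0 n0.
  rewrite ger0_norm; last by lra.
  by move: h3; rewrite ler_norml => /andP[]; lra.
have h5 : rn (phi - vec y) * N y <= d * (rn phi + 1).
  apply: ler_pM; rewrite ?rn_ge0 ?sn_ge0 //.
  by move: h3; rewrite ler_norml => /andP[]; lra.
have h6 : rn phi * rn (phi - vec y) <= rn phi * d by rewrite ler_wpM2l ?rn_ge0.
have : d * (2 * rn phi + 1) + d * (rn phi + 1) + rn phi * d <= e.
  by move: dK; rewrite /K; lra.
by lra.
Qed.

End GNSSpace.

Lemma lip_continuous (R : realType) (V W : normedModType R[i]) (g : V -> W)
    (M : R) : 0 <= M ->
  (forall x y, rn (g x - g y) <= M * rn (x - y)) -> continuous g.
Proof.
move=> M0 gM x; apply/cvgrPdist_lt => e e0.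
have er : e = (complex.Re e)%:C by rewrite RRe_real // gtr0_real.
have er0 : 0 < complex.Re e by rewrite -ltcR -er.
have M1 : 0 < M + 1 by lra.
apply/nbhs_ballP; exists (complex.Re e / (M + 1))%:C => /=.
  by rewrite ltcR divr_gt0.
move=> y; rewrite -ball_normE /= rnE ltcR ltr_pdivlMr // => h.
rewrite er rnE ltcR; apply: le_lt_trans (gM _ _) _; apply: le_lt_trans h.
by rewrite mulrC ler_wpM2l ?rn_ge0 //; lra.
Qed.

(** * Orthogonal projection onto a closed subspace *)

Section Projection.
Variables (R : realType) (H : completeNormedModType R[i]).
Variables (dot : {dot H for Num.conj}).
Hypothesis dotxx : forall x, dot x x = `|x| ^+ 2.
Variable L : set H.
Hypothesis subL : closed_subspace L.
Implicit Types x y l p : H.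

Lemma subspaceD x y : L x -> L y -> L (x + y).
Proof. by move=> Lx Ly; have [_ LD _] := subL; have := LD 1 x y Lx Ly; rewrite scale1r. Qed.

Lemma subspaceZ (k : R[i]) x : L x -> L (k *: x).
Proof. by move=> Lx; have [L0 LD _] := subL; have := LD k x 0 Lx L0; rewrite addr0. Qed.

(** A minimising sequence is Cauchy by the parallelogram identity, and its limit p satisfies the
    variational inequality [key]. Only the real part of the inner product is shown to vanish; on a
    complex subspace that is orthogonality. *)
Lemma projection_exists x : exists p, L p /\ forall l, L l -> redot dot (x - p) l = 0.
Proof.
have [L0 _ cL] := subL.
pose E := [set rn (x - l) | l in L]; pose d := inf E.
have lbE : lbound E 0 by move=> _ [l _ <-]; exact: rn_ge0.
have neE : E !=set0 by exists (rn (x - 0)), 0.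
have dE l : L l -> d <= rn (x - l).
  by move=> Ll; apply: ge_inf; [exists 0|exists l].
have d0 : 0 <= d by apply: inf_greatest.
have near (n : nat) : exists l, L l /\ rn (x - l) < d + n.+1%:R^-1.
  have e0 : 0 < n.+1%:R^-1 :> R by rewrite invr_gt0.
  have [|_ [l Ll <-] h] := @inf_adherent _ E _ e0; first by split=> //; exists 0.
  by exists l.
have [u uP] := boolp.choice near.
have par n m : rn (u n - u m) ^+ 2 <=
    2 * rn (x - u n) ^+ 2 + 2 * rn (x - u m) ^+ 2 - 4 * d ^+ 2.
  have -> : u n - u m = (x - u m) - (x - u n) by rewrite opprB [RHS]addrC addrA subrK.
  rewrite (rn_sqrBH dotxx).
  have Lm : L (2^-1%:C *: (u n + u m)).
    by apply/subspaceZ/subspaceD; [case: (uP n)|case: (uP m)].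
  have := dE _ Lm.
  have e : (x - u m) + (x - u n) = 2%:C *: (x - 2^-1%:C *: (u n + u m)).
    rewrite scalerBr scalerA -rmorphM /= mulfV // scale1r.
    rewrite (_ : 2%:C = 1 + 1 :> R[i]) ?scalerDl ?scale1r; last first.
      by apply/eqP; rewrite eq_complex /= addr0 !eqxx.
    by rewrite addrACA -opprD [u m + _]addrC.
  have := rn_sqrD dotxx (x - u m) (x - u n).
  rewrite e rnZr ger0_norm // => h1 h2; have : d ^+ 2 <= rn (x - 2^-1%:C *: (u n + u m)) ^+ 2.
    by rewrite ler_sqr ?nnegrE ?rn_ge0.
  move: h1; rewrite exprMn; lra.
have [|p up] := @scauchy_cvg _ H u.
  (* With both distances below d + r and r <= 1, [par] gives at most 8dr + 4r, which is less than r
     (8d + 5) <= e^2. *)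
  move=> e e0; pose r := Num.min 1 (e ^+ 2 / (8 * d + 5)).
  have K0 : 0 < 8 * d + 5 by lra.
  have r0 : 0 < r by rewrite lt_min ltr01 divr_gt0 // exprn_gt0.
  have [N NP] := exists_invS_lt r0; exists N => n m Nn Nm.
  have := NP n Nn; have := NP m Nm; have := (uP n).2; have := (uP m).2.
  move: (n.+1%:R^-1) (m.+1%:R^-1) => s t h1 h2 h3 h4.
  rewrite -ltr_sqr ?nnegrE ?rn_ge0 ?(ltW e0) //.
  apply: le_lt_trans (par n m) _.
  have r1 : r <= 1 by rewrite ge_min lexx.
  have rK : r * (8 * d + 5) <= e ^+ 2 by rewrite -ler_pdivlMr // ge_min lexx orbT.
  have sq v : L v -> rn (x - v) < d + r -> rn (x - v) ^+ 2 <= d ^+ 2 + 2 * d * r + r.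
    move=> Lv h; apply: (@le_trans _ _ ((d + r) ^+ 2)).
      by rewrite ler_sqr ?nnegrE ?rn_ge0 //; lra.
    have : r * r <= r * 1 by rewrite ler_pM2l.
    by rewrite sqrrD expr2; lra.
  have := sq (u n) (uP n).1 ltac:(lra); have := sq (u m) (uP m).1 ltac:(lra).
  by lra.
have Lp : L p by apply: (closed_scvg cL _ up) => n; case: (uP n).
exists p; split=> // l Ll.
have xp : rn (x - p) <= d.
  apply/ler_addgt0Pr => e e0.
  have [N1 N1P] := up (e / 2) ltac:(lra).
  have [N2 N2P] := @exists_invS_lt _ (e / 2) ltac:(lra).
  have := N1P (maxn N1 N2) (leq_maxl _ _); have := N2P (maxn N1 N2) (leq_maxr _ _).
  have := (uP (maxn N1 N2)).2; have := rn_triangle (u (maxn N1 N2)) x p.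
  by move: ((maxn N1 N2).+1%:R^-1) => s; lra.
have key (t : R) : 0 <= - 2 * t * redot dot (x - p) l + t ^+ 2 * rn l ^+ 2.
  have Lq : L (p + t%:C *: l) by apply: subspaceD => //; exact: subspaceZ.
  have := dE _ Lq; rewrite opprD addrA => h.
  have : rn (x - p) ^+ 2 <= rn (x - p - t%:C *: l) ^+ 2.
    by rewrite ler_sqr ?nnegrE ?rn_ge0 //; exact: le_trans xp h.
  by rewrite (rn_sqrBH dotxx (x - p)) redotZr rnZr exprMn real_normK ?num_real //; lra.
move: (redot dot (x - p) l) key => c key.
have s0 := sqr_ge0 (rn l); move: (rn l ^+ 2) s0 key => s s0 key.
have s1 : 0 < s + 1 by lra.
(* The minimiser would be c/s; the denominator s + 1 also covers l = 0. *)
have := key (c / (s + 1)).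
rewrite (_ : _ + _ = - (c ^+ 2 * (s + 2)) / (s + 1) ^+ 2); last by field; lra.
rewrite pmulr_lge0 ?invr_gt0 ?exprn_gt0 // => h.
have : c ^+ 2 * (s + 2) <= 0 by lra.
rewrite pmulr_lle0; last by lra.
by move=> c2; apply/eqP; rewrite -sqrf_eq0; apply/eqP/le_anti; rewrite c2 sqr_ge0.
Qed.

End Projection.

(** * The GNS representation and its irreducibility *)

Section GNSRepresentation.
Variables (R : realType) (B : unitalCStarAlgType R) (f : state B).
Implicit Types (x y z b : B) (phi psi chi : gns f).

Fact gdot_bilinear : bilinear_for *%R (Num.conj \; *%R) (@gdot R B f).
Proof.
split=> [chi|phi] k psi chi'; first exact: gdot_linear.
by rewrite gdot_herm gdot_linear rmorphD rmorphM /= -!gdot_herm.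
Qed.

HB.instance Definition _ := @bilinear_isBilinear.Build R[i] (gns f) (gns f) R[i]
  *%R (Num.conj \; *%R) (@gdot R B f) gdot_bilinear.

Fact gdot_hermitian phi chi : gdot phi chi = (-1) ^+ false * Num.conj (gdot chi phi).
Proof. by rewrite expr0 mul1r -gdot_herm. Qed.

HB.instance Definition _ := @isHermitianSesquilinear.Build R[i] (gns f) false
  Num.conj (@gdot R B f) gdot_hermitian.

Fact gdot_gt0 phi : phi != 0 -> 0 < gdot phi phi.
Proof. by move=> p0; rewrite gdot_self exprn_gt0 // normr_gt0. Qed.

HB.instance Definition _ := @isDotProduct.Build R[i] (gns f) (@gdot R B f) gdot_gt0.

Definition gns_dot : {dot gns f for Num.conj} := @gdot R B f.

Lemma gns_dotxx phi : gns_dot phi phi = `|phi| ^+ 2.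
Proof. exact: gdot_self. Qed.

Fact gns_pi_subproof b phi :
  (fun x => gns_fun phi (star b ** x)) \in @gns_pred R B f.
Proof.
apply/asboolP => e e0; have b1 : 0 < rn b + 1 by have := rn_ge0 b; lra.
have [y hy] := gnsP phi (divr_gt0 e0 b1); exists (b ** y) => x.
have := hy (star b ** x); rewrite starM starK -smulA => h.
apply: le_trans h _; rewrite mulrAC ler_pdivrMr // -mulrA ler_pM2l //.
apply: le_trans (sn_mul _ _ _) _; rewrite rn_star mulrC ler_wpM2l ?sn_ge0 //.
lra.
Qed.

Definition gns_pi b phi : gns f := GNS (gns_pi_subproof b phi).

Lemma rn_gns_pi b phi : rn (gns_pi b phi) <= rn b * rn phi.
Proof.
apply: gnorm_le => [|x]; first by rewrite mulr_ge0 ?rn_ge0.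
apply: le_trans (gns_funP phi (star b ** x)) _.
rewrite [rn b * _]mulrC -mulrA ler_wpM2l ?rn_ge0 //.
by apply: le_trans (sn_mul _ _ _) _; rewrite rn_star.
Qed.

Lemma gns_pi_linear b : linear (gns_pi b).
Proof. by move=> k phi psi; exact: gns_ext. Qed.

Lemma gns_piB b phi psi : gns_pi b phi - gns_pi b psi = gns_pi b (phi - psi).
Proof. exact: gns_ext. Qed.

Lemma gns_pi_vec b y : gns_pi b (vec f y) = vec f (b ** y).
Proof. by apply: gns_ext => x /=; rewrite starM starK smulA. Qed.

Lemma gns_rep : star_representation gns_dot gns_pi.
Proof.
split.
- move=> b; split; first exact: gns_pi_linear.
  apply: (lip_continuous (rn_ge0 b)) => phi psi.
  by rewrite gns_piB; exact: rn_gns_pi.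
- move=> phi k x y; apply: gns_ext => z /=.
  by rewrite starD starZ smulDl smulZl gns_fun_antilinear conjCK.
- by move=> x y phi; apply: gns_ext => z /=; rewrite starM smulA.
- move=> b phi chi; apply: (@gdot_unique _ _ _ _ _ _ (rn phi * rn b)).
    by rewrite mulr_ge0 ?rn_ge0.
  move=> z; rewrite /gns_dot.
  have := gdotP phi (gns_pi (star b) chi) (star b ** z).
  rewrite -gns_pi_vec gns_piB => h; apply: le_trans h _.
  by rewrite -mulrA ler_wpM2l ?rn_ge0 // -(rn_star b) rn_gns_pi.
Qed.

Definition cyc : gns f := vec f sone.

Lemma gns_pi_cyc b : gns_pi b cyc = vec f b.
Proof. by rewrite gns_pi_vec smul1r. Qed.

Lemma gns_pi1 phi : gns_pi sone phi = phi.
Proof. by apply: gns_ext => x /=; rewrite star1 smul1l. Qed.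

Lemma rn_cyc : rn cyc = 1.
Proof. by rewrite rn_vec sn1. Qed.

Lemma gdot_vec x y : gdot (vec f x) (vec f y) = cstate f (star y ** x).
Proof.
have := gdotP (vec f x) (vec f y) y; rewrite subrr rn0 mulr0.
by move/cm_eq0/eqP; rewrite subr_eq0 => /eqP.
Qed.

Lemma redot_cyc x : redot gns_dot (gns_pi x cyc) cyc = f x.
Proof.
rewrite gns_pi_cyc (_ : redot _ _ _ = complex.Re (gdot (vec f x) cyc)) //.
by rewrite gdot_vec star1 smul1l.
Qed.

Lemma redot_vec_eq0 phi : (forall y, redot gns_dot phi (vec f y) = 0) -> phi = 0.
Proof.
move=> h; apply/rn_le0_eq0; apply/ler_addgt0Pr => e e0; rewrite add0r.
have [->|p0] := eqVneq phi 0; first by rewrite rn0 ltW.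
have [y hy] := gns_dense phi e0.
have := redot_le gns_dotxx phi (phi - vec f y).
rewrite redotDr redotNr h subr0 (redotxx gns_dotxx) expr2 ler_pM2l ?rn_gt0 //.
by move=> h1; apply: le_trans h1 hy.
Qed.

Lemma closed_dense_vec (L : set (gns f)) : closed L ->
  (forall y, L (vec f y)) -> L = setT.
Proof.
move=> cL Lv; apply/seteqP; split=> // phi _.
have apx (n : nat) : exists y, rn (phi - vec f y) <= n.+1%:R^-1.
  by apply: gns_dense; rewrite invr_gt0.
have [u uP] := boolp.choice apx.
apply: (@closed_scvg _ _ L (fun n => vec f (u n))) => // e e0.
have [N NP] := exists_invS_lt e0; exists N => n Nn.
by rewrite rnBC; apply: le_lt_trans (uP n) (NP n Nn).
Qed.

Section VectorState.
Variable p : gns f.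
Hypothesis p0 : rn p != 0.

Let vf x := (rn p ^+ 2)^-1 * redot gns_dot (gns_pi x p) p.

Let vf_linear : real_linear vf.
Proof.
split=> [x y|t x]; rewrite /vf.
  by rewrite (repD gns_rep) redotDl mulrDr.
by rewrite (repZ gns_rep) redotZl; ring.
Qed.

Let vf_pos h : pos h -> 0 <= vf h.
Proof.
move=> /pos_sqrt[r [pr rE _]]; rewrite /vf -rE (repM gns_rep) (rep_adj gns_rep).
rewrite (pos_selfadj pr) (redotxx gns_dotxx).
by rewrite mulr_ge0 ?invr_ge0 ?sqr_ge0.
Qed.

Let vf1 : vf sone = 1.
Proof. by rewrite /vf gns_pi1 (redotxx gns_dotxx) mulVf // expf_eq0. Qed.

Let vf_star x : vf (star x) = vf x.
Proof. by rewrite /vf (rep_adj gns_rep) starK redotC. Qed.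

Definition vector_state : state B := State vf_linear vf_pos vf1 vf_star.

Lemma vector_stateE x :
  rn p ^+ 2 * vector_state x = redot gns_dot (gns_pi x p) p.
Proof. by rewrite /= /vf mulrA mulfV ?mul1r // expf_eq0. Qed.

End VectorState.

Variable J : set B.
Hypothesis idealJ : star_ideal J.
Hypothesis fJ : forall j, J j -> f j = 0.

Lemma gns_pi_ideal j phi : J j -> gns_pi j phi = 0.
Proof.
move=> Jj; have : [set phi | gns_pi j phi = 0] = setT.
  apply: closed_dense_vec => [|y].
    apply: (@closed_eq_lip _ _ _ _ (rn j)) => x y.
    by rewrite gns_piB; exact: rn_gns_pi.
  rewrite /= gns_pi_vec; apply: gns_ext => x /=.
  have [_ _ JM _] := idealJ.
  have Jx : J (star x ** (j ** y)) by apply: (JM _ _ _).1; apply: (JM _ _ _).2.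
  rewrite /cstate !fJ ?oppr0 //; exact: idealZ.
by move/seteqP => [_ /(_ phi I)].
Qed.

Hypothesis f_extreme : forall (g1 g2 : state B) (c : R),
     (forall j, J j -> g1 j = 0) -> (forall j, J j -> g2 j = 0) ->
     0 < c < 1 -> (forall x, f x = c * g1 x + (1 - c) * g2 x) ->
     forall x, g1 x = f x.

Lemma vector_state_ideal p (p0 : rn p != 0) j : J j -> vector_state p0 j = 0.
Proof. by move=> Jj /=; rewrite gns_pi_ideal // redot0l mulr0. Qed.

(** Let p be the projection of the cyclic vector to an invariant subspace L. Unless p or its
    complement vanishes, f is the convex combination of the vector states of p and of [cyc - p] with
    weights given by their squared norms. Extremality makes the first one equal to f, which forces p
    to be a nonzero multiple of [cyc], so [cyc] lies in L. *)
Lemma gns_irreducible : irreducible gns_pi.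
Proof.
split.
  exists sone, cyc; rewrite gns_pi1; apply/eqP => c0.
  by have := rn_cyc; rewrite c0 rn0; lra.
move=> L subL inv; have [p [Lp orth]] := projection_exists gns_dotxx subL cyc.
have [_ _ cL] := subL.
have full : L cyc -> L = setT.
  move=> Lc; apply: closed_dense_vec => // y; rewrite -gns_pi_cyc; exact: inv.
have op : redot gns_dot (cyc - p) p = 0 by exact: orth.
have pyth : rn (cyc - p) ^+ 2 + rn p ^+ 2 = 1.
  have := rn_sqrD gns_dotxx (cyc - p) p.
  by rewrite subrK rn_cyc op mulr0 addr0 expr1n.
have [p0|p0] := eqVneq (rn p) 0.
  left; apply/seteqP; split=> [l Ll|_ ->]; last by case: subL.
  have cl y : redot gns_dot l (vec f y) = 0.
    rewrite -gns_pi_cyc redotC (rep_adj gns_rep).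
    have := orth _ (inv (star y) l Ll).
    by rewrite (rn0_eq0 p0) subr0.
  exact: redot_vec_eq0.
have [q0|q0] := eqVneq (rn (cyc - p)) 0.
  right; apply: full; move/rn0_eq0/eqP: q0; rewrite subr_eq0 => /eqP ->.
  exact: Lp.
right; apply: full.
have pp : 0 < rn p ^+ 2 by rewrite exprn_gt0 // lt_neqAle eq_sym p0 rn_ge0.
have qp : 0 < rn (cyc - p) ^+ 2 by rewrite exprn_gt0 // lt_neqAle eq_sym q0 rn_ge0.
have orthL x l : L l -> redot gns_dot (gns_pi x (cyc - p)) l = 0.
  by move=> Ll; rewrite (rep_adj gns_rep); apply/orth/inv.
have g1f : forall x, vector_state p0 x = f x.
  apply: (@f_extreme _ (vector_state q0) (rn p ^+ 2)).
  - by move=> j; exact: vector_state_ideal.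
  - by move=> j; exact: vector_state_ideal.
  - by rewrite pp /=; lra.
  - move=> x; rewrite (_ : 1 - rn p ^+ 2 = rn (cyc - p) ^+ 2); last by lra.
    rewrite !vector_stateE -redot_cyc.
    have -> : gns_pi x cyc = gns_pi x p + gns_pi x (cyc - p).
      by rewrite -(repDr gns_rep) addrC subrK.
    have -> : redot gns_dot (gns_pi x p + gns_pi x (cyc - p)) cyc =
      redot gns_dot (gns_pi x p + gns_pi x (cyc - p)) (p + (cyc - p)).
      by rewrite [p + _]addrC subrK.
    have expand (u v p' q' : gns f) : redot gns_dot (u + v) (p' + q') =
        redot gns_dot u p' + redot gns_dot u q' +
        (redot gns_dot v p' + redot gns_dot v q').
      by rewrite redotDl !redotDr.
    rewrite expand (orthL x p Lp).
    rewrite (redotC _ (gns_pi x p) (cyc - p)) (orth _ (inv x p Lp)).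
    by rewrite addr0 add0r.
(* The states of p and of [cyc] agree, and by orthogonality <p, y cyc> = <p, y p>; so p and this
   multiple of [cyc] have the same inner products with the dense set of all [vec f y]. *)
have pE : p = (rn p ^+ 2)%:C *: cyc.
  apply/eqP; rewrite -subr_eq0; apply/eqP/redot_vec_eq0 => y.
  rewrite -gns_pi_cyc -(starK y) -(rep_adj gns_rep) (repBr gns_rep) (repZr gns_rep).
  rewrite redotDl redotNl redotZl redot_cyc -g1f vector_stateE.
  have := orth _ (inv (star y) p Lp).
  by rewrite redotDl redotNl (redotC _ cyc) (redotC _ p) => <-.
have -> : cyc = (rn p ^+ 2)^-1%:C *: p.
  by rewrite {2}pE scalerA -rmorphM mulVf ?scale1r // lt0r_neq0.
exact: subspaceZ.
Qed.

End GNSRepresentation.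

(** The cyclic vector is a unit vector on which a has norm at least [eps], since f (a^* a) >= eps^2.
    That the bound holds at a vector, without an error term, is what makes the sets of
    [attains_compact] compact. *)
Theorem exists_irreducible (R : realType) (B : unitalCStarAlgType R)
    (J : set B) (a : B) (eps : R) :
  star_ideal J -> 0 < eps -> (forall j, J j -> eps <= rn (a - j)) ->
  exists (H : completeNormedModType R[i]) (dot : {dot H for Num.conj})
         (pi : B -> H -> H),
    [/\ forall x, dot x x = `|x| ^+ 2, star_representation dot pi,
        irreducible pi, forall j x, J j -> pi j x = 0 &
        exists2 x, x != 0 & eps * rn x <= rn (pi a x)].
Proof.
move=> idJ e0 da; have [f [fJ fa fe]] := exists_pure_state idJ e0 da.
exists (gns f), (gns_dot f), (@gns_pi R B f); split.
- exact: gns_dotxx.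
- exact: gns_rep.
- exact: gns_irreducible idJ fJ fe.
- by move=> j x Jj; exact: (gns_pi_ideal idJ fJ).
- exists (cyc f).
    by apply/eqP => c0; have := rn_cyc f; rewrite c0 rn0; lra.
  rewrite rn_cyc mulr1 gns_pi_cyc rn_vec.
  by rewrite -ler_sqr ?nnegrE ?sn_ge0 ?(ltW e0) // sn_sqr.
Qed.

(** * The multiplier algebra *)

Lemma linear_bounded (R : realType) (V W : normedModType R[i]) (g : V -> W) :
  linear g -> continuous g -> exists M, 0 <= M /\ forall x, rn (g x) <= M * rn x.
Proof.
move=> lg cg; have g0 : g 0 = 0 by exact: linear_at0.
have /cvgrPdist_lt /(_ 1 ltr01) /nbhs_ballP[e /= e0 eP] := cg 0.
have er : e = (complex.Re e)%:C by rewrite RRe_real // gtr0_real.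
have r0 : 0 < complex.Re e by rewrite -ltcR -er.
set r := complex.Re e in er r0.
exists (2 / r); split; first by rewrite divr_ge0 // ltW.
move=> x; have [->|x0] := eqVneq x 0; first by rewrite g0 !rn0 mulr0.
have x1 := rn_gt0 x0.
pose s := r / 2 / rn x; have s0 : 0 < s by rewrite !divr_gt0.
have : ball (0 : V) e (s%:C *: x).
  rewrite -ball_normE /= sub0r normrN rnE er ltcR rnZr gtr0_norm //.
  by rewrite /s divfK ?lt0r_neq0 //; lra.
move/eP; rewrite g0 sub0r normrN rnE ltcR.
have -> : g (s%:C *: x) = s%:C *: g x by have := lg s%:C x 0; rewrite g0 !addr0.
rewrite rnZr gtr0_norm // mulrC -ltr_pdivlMr // => h.
apply: le_trans (ltW h) _; rewrite /s le_eqVlt; apply/orP; left; apply/eqP.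
by field; apply/andP; split; apply: lt0r_neq0.
Qed.

Section MultiplierNorm.
Variables (R : realType) (A : cstarAlgType R).
Implicit Types (a x y : A) (b c : multiplier A).

Lemma lmultM b a x : lmult b (a ** x) = lmult b a ** x.
Proof. by have [_ _ h _ _] := multP b; exact: h. Qed.

Lemma rmultM b a x : rmult (a ** x) b = a ** rmult x b.
Proof. by have [_ _ _ h _] := multP b; exact: h. Qed.

Lemma rlmult b a x : rmult a b ** x = a ** lmult b x.
Proof. by have [_ _ _ _ h] := multP b; exact: h. Qed.

Lemma lmult_lin b (k : R[i]) x y : lmult b (k *: x + y) = k *: lmult b x + lmult b y.
Proof. by have [[h _] _ _ _ _] := multP b; exact: h. Qed.

Lemma lmultDl b c a : lmult (b + c) a = lmult b a + lmult c a.
Proof. by []. Qed.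

Lemma lmultZl (k : R[i]) b a : lmult (k *: b) a = k *: lmult b a.
Proof. by []. Qed.

Lemma lmultBl b c a : lmult (b - c) a = lmult b a - lmult c a.
Proof. by []. Qed.

Lemma lmultMl b c a : lmult (b ** c) a = lmult b (lmult c a).
Proof. by []. Qed.

Lemma lmult0r b : lmult b 0 = 0.
Proof. by have [[h _] _ _ _ _] := multP b; exact: linear_at0. Qed.

Lemma lmultD b x y : lmult b (x + y) = lmult b x + lmult b y.
Proof. by have := lmult_lin b 1 x y; rewrite !scale1r. Qed.

Lemma lmultZ b (k : R[i]) x : lmult b (k *: x) = k *: lmult b x.
Proof. by have := lmult_lin b k x 0; rewrite lmult0r !addr0. Qed.

Lemma lmultB b x y : lmult b (x - y) = lmult b x - lmult b y.
Proof. by rewrite lmultD -scaleN1r lmultZ scaleN1r. Qed.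

Lemma lmult_star b a : lmult (star b) a = star (rmult (star a) b).
Proof. by []. Qed.

Lemma rmultE b a : rmult a b = star (lmult (star b) (star a)).
Proof. by rewrite lmult_star !starK. Qed.

Lemma star_lmult b a x : star (lmult b a) ** x = star a ** lmult (star b) x.
Proof. by rewrite lmult_star -starM rlmult starM starK. Qed.

Lemma smul_faithful a : (forall x, a ** x = 0) -> a = 0.
Proof.
move=> h; apply: rn0_eq0; apply/eqP; rewrite -sqrf_eq0 -rn_star -rn_starM starK h.
by rewrite rn0.
Qed.

Lemma mult_eq_l b c : (forall a, lmult b a = lmult c a) -> b = c.
Proof.
move=> h; apply: mult_ext => // a; apply/eqP; rewrite -subr_eq0; apply/eqP.
by apply: smul_faithful => x; rewrite smulBl !rlmult h subrr.
Qed.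

Definition mult_bounds b := [set M : R | 0 <= M /\ forall a, rn (lmult b a) <= M * rn a].

Definition mnorm b : R := inf (mult_bounds b).

Lemma mult_bounds_ne b : mult_bounds b !=set0.
Proof. by have [[l c] _ _ _ _] := multP b; have [M MP] := linear_bounded l c; exists M. Qed.

Lemma mnorm_ge0 b : 0 <= mnorm b.
Proof. by apply: inf_greatest; [exact: mult_bounds_ne|move=> M []]. Qed.

Lemma mnorm_le b (M : R) : 0 <= M -> (forall a, rn (lmult b a) <= M * rn a) ->
  mnorm b <= M.
Proof. by move=> M0 h; apply: ge_inf; [exists 0 => d []|split]. Qed.

Lemma mnormP b a : rn (lmult b a) <= mnorm b * rn a.
Proof.
apply/ler_addgt0Pr => e e0; set d := e / (rn a + 1).
have n1 : 0 < rn a + 1 by have := rn_ge0 a; lra.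
have d0 : 0 < d by rewrite divr_gt0.
have [|c [c0 cP] cd] := @inf_adherent _ (mult_bounds b) d d0.
  by split; [exact: mult_bounds_ne|exists 0 => ? []].
apply: le_trans (cP a) _.
have : c * rn a <= (mnorm b + d) * rn a.
  by rewrite ler_wpM2r ?rn_ge0 //; exact: ltW.
have : d * rn a <= e.
  by rewrite /d mulrAC ler_pdivrMr // ler_wpM2l ?ltW //; lra.
by rewrite mulrDl; lra.
Qed.

Fact mnormD b c : (mnorm (b + c))%:C <= (mnorm b)%:C + (mnorm c)%:C :> R[i].
Proof.
rewrite -rmorphD lecR; apply: mnorm_le => [|a].
  by rewrite addr_ge0 ?mnorm_ge0.
rewrite lmultDl mulrDl; apply: le_trans (rnD _ _) _.
by apply: lerD; exact: mnormP.
Qed.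

Lemma mnormZ_le (k : R[i]) b : mnorm (k *: b) <= cm k * mnorm b.
Proof.
apply: mnorm_le => [|a]; first by rewrite mulr_ge0 ?mnorm_ge0 ?cm_ge0.
by rewrite lmultZl rn_cmZ -mulrA ler_wpM2l ?cm_ge0 ?mnormP.
Qed.

Fact mnormZ (k : R[i]) b : (mnorm (k *: b))%:C = `|k| * (mnorm b)%:C :> R[i].
Proof.
rewrite cmE -rmorphM; congr (_%:C).
have [->|k0] := eqVneq k 0.
  rewrite cm0 mul0r; apply/le_anti; rewrite mnorm_ge0 andbT.
  by have := mnormZ_le 0 b; rewrite cm0 mul0r.
apply/le_anti; rewrite mnormZ_le /=.
have := mnormZ_le k^-1 (k *: b); rewrite scalerA mulVf // scale1r.
have ck : 0 < cm k by rewrite -ltcR -cmE normr_gt0.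
have -> : cm k^-1 = (cm k)^-1.
  apply: (mulfI (lt0r_neq0 ck)).
  by rewrite -cmM mulfV // cm1 mulfV // lt0r_neq0.
by rewrite ler_pdivlMl.
Qed.

Fact mnorm0_eq0 b : (mnorm b)%:C = 0 :> R[i] -> b = 0.
Proof.
move=> /complexI n0; apply: mult_eq_l => a; apply: rn_le0_eq0.
by have := mnormP b a; rewrite n0 mul0r.
Qed.

HB.instance Definition _ := Lmodule_isNormed.Build R[i] (multiplier A)
  mnormD mnormZ mnorm0_eq0.

Lemma rn_lmult b a : rn (lmult b a) <= rn b * rn a.
Proof. exact: mnormP. Qed.

Lemma rn_mult_le b (M : R) : 0 <= M -> (forall a, rn (lmult b a) <= M * rn a) ->
  rn b <= M.
Proof. exact: mnorm_le. Qed.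

Fact norm_mult_smul b c : `|b ** c| <= `|b| * `|c|.
Proof.
rewrite !rnE -rmorphM lecR; apply: rn_mult_le => [|a].
  by rewrite mulr_ge0 ?rn_ge0.
rewrite lmultMl; apply: le_trans (rn_lmult _ _) _.
by rewrite -mulrA ler_wpM2l ?rn_ge0 ?rn_lmult.
Qed.

Lemma rn_mult_sqr_le b : rn b ^+ 2 <= rn (star b ** b).
Proof.
suff : rn b <= Num.sqrt (rn (star b ** b)).
  by rewrite -ler_sqr ?nnegrE ?rn_ge0 ?sqrtr_ge0 // sqr_sqrtr ?rn_ge0.
apply: rn_mult_le => [|a]; first exact: sqrtr_ge0.
rewrite -ler_sqr ?nnegrE ?mulr_ge0 ?rn_ge0 ?sqrtr_ge0 // exprMn sqr_sqrtr ?rn_ge0 //.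
rewrite -rn_starM star_lmult -lmultMl; apply: le_trans (rn_smul _ _) _.
rewrite rn_star expr2 mulrA mulrC ler_wpM2r ?rn_ge0 //.
exact: rn_lmult.
Qed.

Lemma rn_mult_smul b c : rn (b ** c) <= rn b * rn c.
Proof. by rewrite -lecR rmorphM /= -!rnE norm_mult_smul. Qed.

Lemma rn_mult_star b : rn (star b) = rn b.
Proof.
have le c : rn c <= rn (star c).
  have [->|c0] := eqVneq c 0; first by rewrite rn0 rn_ge0.
  rewrite -(ler_pM2r (rn_gt0 c0)) -expr2.
  exact: le_trans (rn_mult_sqr_le c) (rn_mult_smul _ _).
by apply/le_anti; rewrite -{2}(starK b) !le.
Qed.

Fact norm_mult_starM b : `|star b ** b| = `|b| ^+ 2.
Proof.
rewrite !rnE -rmorphXn; congr (_%:C); apply/le_anti.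
rewrite rn_mult_sqr_le andbT; apply: le_trans (rn_mult_smul _ _) _.
by rewrite rn_mult_star expr2.
Qed.

Lemma rn_rmult a b : rn (rmult a b) <= rn b * rn a.
Proof.
rewrite rmultE rn_star; apply: le_trans (rn_lmult _ _) _.
by rewrite rn_mult_star rn_star.
Qed.

(** The uniform bound makes the pointwise limits of the two actions continuous. This serves both for
    the norm completeness of M(A) and for the infinite sum in [exists_multiplier]. *)
Lemma strict_limit (u : nat -> multiplier A) (M : R) :
  (forall n, rn (u n) <= M) ->
  (forall a, scauchy (fun n => lmult (u n) a)) ->
  (forall a, scauchy (fun n => rmult a (u n))) ->
  exists b, rn b <= M /\ forall a, scvg (fun n => lmult (u n) a) (lmult b a) /\
    scvg (fun n => rmult a (u n)) (rmult a b).
Proof.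
move=> uM cl cr; have M0 : 0 <= M by apply: le_trans (uM 0%N); exact: rn_ge0.
have [L LP] := boolp.choice (fun a => scauchy_cvg (cl a)).
have [T TP] := boolp.choice (fun a => scauchy_cvg (cr a)).
have LM a : rn (L a) <= M * rn a.
  apply: scvg_le (LP a) => n; apply: le_trans (rn_lmult _ _) _.
  by rewrite ler_wpM2r ?rn_ge0.
have TM a : rn (T a) <= M * rn a.
  apply: scvg_le (TP a) => n; apply: le_trans (rn_rmult _ _) _.
  by rewrite ler_wpM2r ?rn_ge0.
have lZ (k : R[i]) (v : nat -> A) l : scvg v l -> scvg (fun n => k *: v n) (k *: l).
  move=> h; apply: (@scvg_lip _ _ _ (fun x => k *: x) (cm k)) h => x y.
  by rewrite -scalerBr rn_cmZ.
have lin (G : nat -> A -> A) (g : A -> A) : (forall n, linear (G n)) ->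
    (forall a, scvg (fun n => G n a) (g a)) -> linear g.
  move=> Gl Gg k x y; apply: scvg_unique (Gg _) _.
  rewrite (_ : (fun n => G n _) = (fun n => k *: G n x + G n y)); last first.
    by apply/funext => n; rewrite Gl.
  by apply: scvgD; [exact: lZ|exact: Gg].
have Ll : linear L by apply: (lin (fun n => lmult (u n))) => // n; have [[]] := multP (u n).
have Tl : linear T.
  by apply: (lin (fun n a => rmult a (u n))) => // n; have [_ []] := multP (u n).
have lipc (g : A -> A) : linear g -> (forall a, rn (g a) <= M * rn a) -> continuous g.
  move=> gl gM; apply: (lip_continuous M0) => x y.
  suff -> : g x - g y = g (x - y) by exact: gM.
  by have := gl (-1) y x; rewrite !scaleN1r ![- _ + _]addrC.
have dc : (L, T) \in @double_centralizerb R A.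
  apply/asboolP; split=> /=.
  - by split=> //; exact: lipc.
  - by split=> //; exact: lipc.
  - move=> a x; apply: scvg_unique (LP _) _.
    rewrite (_ : (fun n => _) = (smul^~ x) \o (fun n => lmult (u n) a)); last first.
      by apply/funext => n /=; rewrite lmultM.
    apply: (@scvg_lip _ _ _ _ (rn x)) (LP a) => y z.
    by rewrite -smulBl mulrC; exact: rn_smul.
  - move=> a x; apply: scvg_unique (TP _) _.
    rewrite (_ : (fun n => _) = (smul a) \o (fun n => rmult x (u n))); last first.
      by apply/funext => n /=; rewrite rmultM.
    apply: (@scvg_lip _ _ _ _ (rn a)) (TP x) => y z.
    by rewrite -smulBr; exact: rn_smul.
  - move=> a x; apply: (@scvg_unique _ _ (fun n => rmult a (u n) ** x)).
      apply: (@scvg_lip _ _ _ (smul^~ x) (rn x)) (TP a) => y z.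
      by rewrite -smulBl mulrC; exact: rn_smul.
    rewrite (_ : (fun n => _) = (smul a) \o (fun n => lmult (u n) x)); last first.
      by apply/funext => n /=; rewrite rlmult.
    apply: (@scvg_lip _ _ _ _ (rn a)) (LP x) => y z.
    by rewrite -smulBr; exact: rn_smul.
exists (Multiplier dc); split; first exact: rn_mult_le.
by move=> a; split; [exact: LP|exact: TP].
Qed.

Lemma mult_seq_complete (u : nat -> multiplier A) : scauchy u -> exists l, scvg u l.
Proof.
move=> cu; have [M uM] := scauchy_bounded cu.
have cau (g : multiplier A -> A) (K : R) : 0 <= K ->
    (forall b c, rn (g b - g c) <= rn (b - c) * K) -> scauchy (fun n => g (u n)).
  move=> K0 gK e e0; have K1 : 0 < K + 1 by lra.
  have [N NP] := cu _ (divr_gt0 e0 K1); exists N => n m Nn Nm.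
  apply: le_lt_trans (gK _ _) _; have := NP n m Nn Nm.
  rewrite ltr_pdivlMr // => h; apply: le_lt_trans h.
  by rewrite ler_wpM2l ?rn_ge0 //; lra.
have [||b [_ bP]] := @strict_limit u M uM.
- move=> a; apply: (cau (fun b => lmult b a) (rn a)); first exact: rn_ge0.
  by move=> b c; exact: (rn_lmult (b - c)).
- move=> a; apply: (cau (fun b => rmult a b) (rn a)); first exact: rn_ge0.
  by move=> b c; exact: (rn_rmult a (b - c)).
exists b => e e0; have e2 : 0 < e / 2 by lra.
have [N NP] := cu _ e2; exists N => n Nn.
suff : rn (u n - b) <= e / 2 by lra.
apply: rn_mult_le => [|a]; first exact: ltW.
apply/ler_addgt0Pr => d d0; have [N1 N1P] := (bP a).1 d d0.
have := N1P (maxn N N1) (leq_maxr _ _).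
have h := rn_lmult (u n - u (maxn N N1)) a.
have := NP n (maxn N N1) Nn (leq_maxl _ _); have := rn_ge0 a.
have := rn_triangle (lmult (u (maxn N N1)) a) (lmult (u n) a) (lmult b a).
move: h; rewrite !lmultBl => h1 h2 h3 h4 h5.
have : rn (u n - u (maxn N N1)) * rn a <= e / 2 * rn a.
  by rewrite ler_wpM2r // ltW.
lra.
Qed.

HB.instance Definition _ := Uniform_isComplete.Build (multiplier A)
  (fun G GF => @seq_complete R (multiplier A) G mult_seq_complete GF).

HB.instance Definition _ :=
  isCStarNorm.Build R (multiplier A) norm_mult_smul norm_mult_starM.

Lemma mult_one_subproof : (idfun, idfun) \in @double_centralizerb R A.
Proof.
by apply/asboolP; split=> //=; split=> // x; exact: cvg_id.
Qed.

Definition mult_one : multiplier A := Multiplier mult_one_subproof.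

Fact mult_mul1l b : mult_one ** b = b. Proof. exact: mult_eq_l. Qed.
Fact mult_mul1r b : b ** mult_one = b. Proof. exact: mult_eq_l. Qed.

HB.instance Definition _ :=
  CStarAlgebra_isUnital.Build R (multiplier A) mult_mul1l mult_mul1r.

Lemma mulin_subproof a : ((fun x => a ** x), (fun x => x ** a)) \in @double_centralizerb R A.
Proof.
apply/asboolP; split=> /=.
- split; first exact: smul_linearr.
  apply: (lip_continuous (rn_ge0 a)) => x y.
  by rewrite -smulBr rn_smul.
- split; first exact: smul_linearl.
  apply: (lip_continuous (rn_ge0 a)) => x y.
  by rewrite -smulBl mulrC rn_smul.
- by move=> x y; rewrite smulA.
- by move=> x y; rewrite smulA.
- by move=> x y; rewrite smulA.
Qed.

Definition mulin a : multiplier A := Multiplier (mulin_subproof a).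

Lemma lmult_mulin a x : lmult (mulin a) x = a ** x. Proof. by []. Qed.
Lemma rmult_mulin a x : rmult x (mulin a) = x ** a. Proof. by []. Qed.

Lemma mulinD a x : mulin (a + x) = mulin a + mulin x.
Proof. by apply: mult_eq_l => y; rewrite lmultDl !lmult_mulin smulDl. Qed.

Lemma mulinZ (k : R[i]) a : mulin (k *: a) = k *: mulin a.
Proof. by apply: mult_eq_l => y; rewrite lmultZl !lmult_mulin smulZl. Qed.

Lemma mulinN a : mulin (- a) = - mulin a.
Proof. by rewrite -scaleN1r mulinZ scaleN1r. Qed.

Lemma mulinB a x : mulin (a - x) = mulin a - mulin x.
Proof. by rewrite mulinD mulinN. Qed.

Lemma mulin0 : mulin 0 = 0.
Proof. by rewrite -(scale0r (0 : A)) mulinZ scale0r. Qed.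

Lemma mulinM a x : mulin (a ** x) = mulin a ** mulin x.
Proof. by apply: mult_eq_l => y; rewrite lmultMl !lmult_mulin smulA. Qed.

Lemma mulin_star a : mulin (star a) = star (mulin a).
Proof. by apply: mult_eq_l => y; rewrite lmult_star rmult_mulin lmult_mulin starM starK. Qed.

Lemma smul_mulin b a : b ** mulin a = mulin (lmult b a).
Proof. by apply: mult_eq_l => y; rewrite lmultMl !lmult_mulin lmultM. Qed.

Lemma mulin_smul a b : mulin a ** b = mulin (rmult a b).
Proof. by apply: mult_eq_l => y; rewrite lmultMl !lmult_mulin rlmult. Qed.

Lemma rn_mulin a : rn (mulin a) = rn a.
Proof.
apply/le_anti/andP; split.
  by apply: rn_mult_le => [|x]; [exact: rn_ge0|exact: rn_smul].
have := rn_lmult (mulin a) (star a); rewrite lmult_mulin rn_star.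
have -> : rn (a ** star a) = rn a ^+ 2 by rewrite -{1}(starK a) rn_starM rn_star.
have [->|a0] := eqVneq a 0; first by rewrite rn0 rn_ge0.
by rewrite expr2 ler_pM2r ?rn_gt0.
Qed.

Lemma mulin_inj : injective mulin.
Proof.
move=> a x ax; apply/eqP; rewrite -subr_eq0; apply/eqP/rn0_eq0.
by rewrite -rn_mulin mulinB ax subrr rn0.
Qed.

End MultiplierNorm.

Section Convergence.
Variables (R : realType) (H : completeNormedModType R[i]).
Variables (dot : {dot H for Num.conj}).
Hypothesis dotxx : forall x, dot x x = `|x| ^+ 2.

Lemma redot_scvg_eq (x y x' y' : nat -> H) (a b a' b' : H) :
  scvg x a -> scvg y b -> scvg x' a' -> scvg y' b' ->
  (forall n, redot dot (x n) (y n) = redot dot (x' n) (y' n)) ->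
  redot dot a b = redot dot a' b'.
Proof.
move=> xa yb xa' yb' e.
have lim (u v : nat -> H) (p q : H) : scvg u p -> scvg v q ->
    forall d : R, 0 < d -> exists N, forall n, (N <= n)%N ->
      `|redot dot (u n) (v n) - redot dot p q| < d.
  move=> up vq d d0; have [M uM] := scauchy_bounded (scvg_cauchy up).
  pose K := `|M| + rn q + 1.
  have K0 : 0 < K by have := normr_ge0 M; have := rn_ge0 q; rewrite /K; lra.
  have e0 : 0 < d / K by rewrite divr_gt0.
  have dK : d / K * K = d by field; lra.
  move: (d / K) e0 dK => t e0 dK.
  have [N1 N1P] := up t e0; have [N2 N2P] := vq t e0.
  exists (maxn N1 N2) => n; rewrite geq_max => /andP[/N1P h1 /N2P h2].
  have -> : redot dot (u n) (v n) - redot dot p q =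
    redot dot (u n) (v n - q) + redot dot (u n - p) q.
    by rewrite redotDr redotNr redotDl redotNl; lra.
  apply: le_lt_trans (ler_normD _ _) _.
  have h3 := redot_cauchy dotxx (u n) (v n - q).
  have h4 := redot_cauchy dotxx (u n - p) q.
  have h5 : rn (u n) * rn (v n - q) <= `|M| * t.
    apply: ler_pM; rewrite ?rn_ge0 //; last exact: ltW.
    by apply: le_trans (uM n) (ler_norm _).
  have h6 : rn (u n - p) * rn q <= t * rn q by rewrite ler_wpM2r ?rn_ge0 // ltW.
  by move: dK; rewrite /K; lra.
apply/eqP; rewrite -subr_eq0 -normr_le0; apply/ler_addgt0Pr => d d0.
have [N1 N1P] := lim _ _ _ _ xa yb (d / 2) ltac:(lra).
have [N2 N2P] := lim _ _ _ _ xa' yb' (d / 2) ltac:(lra).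
have h1 := N1P (maxn N1 N2) (leq_maxl _ _).
have h2 := N2P (maxn N1 N2) (leq_maxr _ _).
rewrite e in h1; rewrite add0r.
have := ler_distD (redot dot (x' (maxn N1 N2)) (y' (maxn N1 N2)))
  (redot dot a b) (redot dot a' b').
rewrite (distrC (redot dot a b) (redot dot (x' _) _)); lra.
Qed.

End Convergence.

Lemma scvg_sub (R : realType) (V : normedModType R[i]) (u v : nat -> V) (a b : V) :
  scvg u a -> scvg v b -> scvg (fun n => u n - v n) (a - b).
Proof.
move=> ua vb; apply: (scvgD ua) => e /vb[N NP]; exists N => n /NP.
by rewrite -rnN opprB opprK addrC.
Qed.

Lemma scvg_scale (R : realType) (V : normedModType R[i]) (k : R[i]) (u : nat -> V)
  (a : V) : scvg u a -> scvg (fun n => k *: u n) (k *: a).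
Proof.
move=> ua; apply: (@scvg_lip _ _ _ (fun x => k *: x) (cm k)) ua => x y.
by rewrite -scalerBr rn_cmZ.
Qed.

Definition irreducible_rep (R : realType) (A : starAlgType R)
    (H : completeNormedModType R[i]) (dot : {dot H for Num.conj})
    (pi : A -> H -> H) :=
  [/\ forall x, dot x x = `|x| ^+ 2, star_representation dot pi & irreducible pi].

(** * Extending an irreducible representation of A to M(A) *)

Section Irreducible.
Variables (R : realType) (A : cstarAlgType R) (H : completeNormedModType R[i]).
Variables (dot : {dot H for Num.conj}) (pi : A -> H -> H).
Hypothesis irr : irreducible_rep dot pi.
Let dotxx : forall x, dot x x = `|x| ^+ 2. Proof. by case: irr. Qed.
Let rep : star_representation dot pi. Proof. by case: irr. Qed.

(** Such an L is trivially invariant. The lemma is used as a density principle: an identity between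
    bounded linear maps on H need only be checked on the vectors [pi a x]. *)
Lemma irreducible_full (L : set H) : closed_subspace L ->
  (forall a x, L (pi a x)) -> L = setT.
Proof.
move=> subL Lpi; have [_ _ [[a [x ax]] Lirr]] := irr.
have [a' x' _|L0|//] := Lirr L subL; first exact: Lpi.
by move: (Lpi a x); rewrite L0 /= => ax0; rewrite ax0 eqxx in ax.
Qed.

Lemma closed_subspace_ker (V : normedModType R[i]) (g : H -> V) (M : R) :
  linear g -> (forall x, rn (g x) <= M * rn x) -> closed_subspace [set x | g x = 0].
Proof.
move=> gl gM; have g0 := linear_at0 gl; split=> //=.
  by move=> k x y gx gy; rewrite gl gx gy scaler0 addr0.
apply: (@closed_eq_lip _ _ _ _ M) => x y.
have -> : g x - g y = g (x - y).
  by have := gl (-1) y x; rewrite !scaleN1r ![- _ + _]addrC.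
exact: gM.
Qed.

Lemma rep_nondegenerate x : (forall a, pi a x = 0) -> x = 0.
Proof.
move=> hx; have : [set x | forall a, pi a x = 0] = [set 0].
  have [_ _ [[a [y ay]] Lirr]] := irr.
  case: (Lirr [set x | forall a, pi a x = 0]) => //.
  - split=> [b|k u v hu hv b|].
    + exact: (rep0r rep).
    + by rewrite (repDr rep) (repZr rep) hu hv scaler0 addr0.
    + have -> : [set x | forall a, pi a x = 0] =
          \bigcap_(b in setT) [set x | pi b x = 0].
        by apply/seteqP; split=> z /= h b *; apply: h.
      apply: closed_bigI => b _.
      apply: (@closed_eq_lip _ _ _ _ (rn b)) => u v.
      by rewrite -(repBr rep); exact: (rep_contractive dotxx rep).
  - by move=> b z hz c; rewrite -(repM rep); exact: hz.
  - move/seteqP => [_ /(_ y I) /(_ a) ay0]; by rewrite ay0 eqxx in ay.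
by move/seteqP => [/(_ x hx)].
Qed.

Variable u : nat -> A.
Hypothesis u1 : forall n, rn (u n) <= 1.
Hypothesis ul : forall a, scvg (fun n => u n ** a) a.

Lemma scvg_rep (v : nat -> A) a x : scvg v a -> scvg (fun n => pi (v n) x) (pi a x).
Proof.
apply: (@scvg_lip _ _ _ (fun a => pi a x) (rn x)) => b c.
by rewrite -(repB rep) mulrC; exact: (rep_contractive dotxx rep).
Qed.

(** On a vector [pi a x] the limit is [pi (lmult b a) x]. The operators are bounded by [rn b]
    uniformly in n, so the vectors at which the limit exists form a closed subspace. *)
Lemma ext_exists (b : multiplier A) y :
  exists l, scvg (fun n => pi (lmult b (u n)) y) l.
Proof.
suff /seteqP [_ /(_ y I)] :
  [set y | exists l, scvg (fun n => pi (lmult b (u n)) y) l] = setT by [].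
apply: irreducible_full => [|a x /=]; last first.
  exists (pi (lmult b a) x).
  rewrite (_ : (fun n => _) = fun n => pi (lmult b (u n ** a)) x).
    apply: scvg_rep; apply: (@scvg_lip _ _ _ (lmult b) (rn b)) (ul a) => c d.
    by rewrite -lmultB; exact: rn_lmult.
  by apply/funext => n; rewrite -(repM rep) lmultM.
have bound n x : rn (pi (lmult b (u n)) x) <= rn b * rn x.
  apply: le_trans (rep_contractive dotxx rep _ _) _; rewrite ler_wpM2r ?rn_ge0 //.
  by apply: le_trans (rn_lmult _ _) _; rewrite ler_piMr ?rn_ge0.
split=> /=.
- exists 0; rewrite (_ : (fun n => _) = fun=> 0); first exact: scvg_cst.
  by apply/funext => n; rewrite (rep0r rep).
- move=> k x z [l xl] [m zm]; exists (k *: l + m).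
  rewrite (_ : (fun n => _) = fun n => k *: pi (lmult b (u n)) x + pi (lmult b (u n)) z).
    by apply: scvgD => //; exact: scvg_scale.
  by apply/funext => n; rewrite (repDr rep) (repZr rep).
- apply: scvg_closed => v l vP vl.
  apply: scauchy_cvg => e e0; have K0 : 0 < rn b + 1 by have := rn_ge0 b; lra.
  pose d := e / 4 / (rn b + 1); have d0 : 0 < d by rewrite !divr_gt0.
  have [N NP] := vl d d0; have [m vm] := vP N.
  have [N1 N1P] := scvg_cauchy vm (ltac:(lra) : 0 < e / 2).
  exists N1 => i j Ni Nj; have := N1P i j Ni Nj.
  have h1 := bound i (l - v N); have h2 := bound j (v N - l).
  rewrite (repBr rep) in h1; rewrite (repBr rep) in h2.
  have := rn_triangle (pi (lmult b (u i)) (v N)) (pi (lmult b (u i)) l) (pi (lmult b (u j)) l).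
  have := rn_triangle (pi (lmult b (u j)) (v N)) (pi (lmult b (u i)) (v N)) (pi (lmult b (u j)) l).
  have h3 : rn b * rn (v N - l) <= (rn b + 1) * d.
    apply: ler_pM; rewrite ?rn_ge0 //; first by lra.
    by apply/ltW/NP.
  have : (rn b + 1) * d = e / 4 by rewrite /d; field; lra.
  move: h1; rewrite (rnBC l (v N)); lra.
Qed.

Definition ext (b : multiplier A) y : H := projT1 (cid (ext_exists b y)).

Lemma extP b y : scvg (fun n => pi (lmult b (u n)) y) (ext b y).
Proof. by rewrite /ext; case: cid. Qed.

Lemma ext_lim b y (l : H) : scvg (fun n => pi (lmult b (u n)) y) l -> ext b y = l.
Proof. exact: scvg_unique (extP b y). Qed.

Lemma ext_pi b a x : ext b (pi a x) = pi (lmult b a) x.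
Proof.
apply: ext_lim; rewrite (_ : (fun n => _) = fun n => pi (lmult b (u n ** a)) x).
  apply: scvg_rep; apply: (@scvg_lip _ _ _ (lmult b) (rn b)) (ul a) => c d.
  by rewrite -lmultB; exact: rn_lmult.
by apply/funext => n; rewrite -(repM rep) lmultM.
Qed.

Lemma rn_ext b y : rn (ext b y) <= rn b * rn y.
Proof.
apply: scvg_le (extP b y) => n.
apply: le_trans (rep_contractive dotxx rep _ _) _; rewrite ler_wpM2r ?rn_ge0 //.
by apply: le_trans (rn_lmult _ _) _; rewrite ler_piMr ?rn_ge0.
Qed.

Lemma ext_linear b : linear (ext b).
Proof.
move=> k x y; apply: ext_lim.
rewrite (_ : (fun n => _) = fun n => k *: pi (lmult b (u n)) x + pi (lmult b (u n)) y).
  by apply: scvgD; [apply: scvg_scale|]; exact: extP.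
by apply/funext => n; rewrite (repDr rep) (repZr rep).
Qed.

Lemma extDl (k : R[i]) b c y : ext (k *: b + c) y = k *: ext b y + ext c y.
Proof.
apply: ext_lim.
rewrite (_ : (fun n => _) = fun n => k *: pi (lmult b (u n)) y + pi (lmult c (u n)) y).
  by apply: scvgD; [apply: scvg_scale|]; exact: extP.
by apply/funext => n; rewrite lmultDl lmultZl (repD rep) (repZ rep).
Qed.

Lemma extM b c y : ext (b ** c) y = ext b (ext c y).
Proof.
suff /seteqP [_ /(_ y I)] :
    [set y | ext (b ** c) y - ext b (ext c y) = 0] = setT.
  by move=> /= /eqP; rewrite subr_eq0 => /eqP.
apply: irreducible_full => [|a x]; last first.
  by rewrite /= !ext_pi lmultMl subrr.
apply: (@closed_subspace_ker _ _ (rn (b ** c) + rn b * rn c)) => [k x z|x].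
  rewrite !ext_linear scalerBr opprD addrACA.
  by [].
apply: le_trans (rnB _ _) _; rewrite mulrDl; apply: lerD; first exact: rn_ext.
apply: le_trans (rn_ext _ _) _; rewrite -mulrA ler_wpM2l ?rn_ge0 //; exact: rn_ext.
Qed.

Lemma unit_scvg y : scvg (fun n => pi (u n) y) y.
Proof.
have := extP sone y; rewrite (_ : ext sone y = y) //.
suff /seteqP [_ /(_ y I)] : [set y | ext sone y - y = 0] = setT.
  by move=> /= /eqP; rewrite subr_eq0 => /eqP.
apply: irreducible_full => [|a x]; last by rewrite /= ext_pi subrr.
apply: (@closed_subspace_ker _ _ (1 + 1)) => [k x z|x].
  by rewrite ext_linear scalerBr opprD addrACA.
apply: le_trans (rnB _ _) _; rewrite mulrDl mul1r lerD2r.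
apply: le_trans (rn_ext _ _) _; rewrite ler_piMl ?rn_ge0 //; exact: rn1.
Qed.

Lemma ext_adj_redot b x y : redot dot (ext b x) y = redot dot x (ext (star b) y).
Proof.
have cont c z : scvg (fun n => ext c (pi (u n) z)) (ext c z).
  apply: (@scvg_lip _ _ _ (ext c) (rn c)) (unit_scvg z) => p q.
  have -> : ext c p - ext c q = ext c (p - q).
    by have := @ext_linear c (-1) q p; rewrite !scaleN1r ![- _ + _]addrC.
  exact: rn_ext.
apply: (redot_scvg_eq dotxx (cont b x) (unit_scvg y) (unit_scvg x) (cont (star b) y)).
move=> n; rewrite !ext_pi (rep_adj rep) (rep_adj rep) -!(repM rep).
by rewrite star_lmult.
Qed.

Lemma ext_rep : star_representation dot ext.
Proof.
split.
- move=> b; split; first exact: ext_linear.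
  apply: (lip_continuous (rn_ge0 b)) => p q.
  have -> : ext b p - ext b q = ext b (p - q).
    by have := @ext_linear b (-1) q p; rewrite !scaleN1r ![- _ + _]addrC.
  exact: rn_ext.
- by move=> y k b c; exact: extDl.
- by move=> b c y; exact: extM.
- move=> b x y.
  have e0 : ext b 0 = 0 by exact: linear_at0 (@ext_linear b).
  have extZ (k : R[i]) z : ext b (k *: z) = k *: ext b z.
    by have := @ext_linear b k z 0; rewrite e0 !addr0.
  apply/eqP; rewrite eq_complex; apply/andP; split; apply/eqP.
    exact: ext_adj_redot.
  (* Since Re (-i z) = Im z, the real identity at -i x is the imaginary part of the complex one at
     x. *)
  have := ext_adj_redot b (- 'i *: x) y; rewrite extZ /redot !linearZl_LR.
  by rewrite !Re_mulNi.
Qed.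

Lemma ext_mulin a y : ext (mulin a) y = pi a y.
Proof.
suff /seteqP [_ /(_ y I)] : [set y | ext (mulin a) y - pi a y = 0] = setT.
  by move=> /= /eqP; rewrite subr_eq0 => /eqP.
apply: irreducible_full => [|c x]; last by rewrite /= ext_pi -(repM rep) subrr.
apply: (@closed_subspace_ker _ _ (rn (mulin a) + rn a)) => [k x z|x].
  by rewrite ext_linear (repDr rep) (repZr rep) scalerBr opprD addrACA.
apply: le_trans (rnB _ _) _; rewrite mulrDl; apply: lerD; first exact: rn_ext.
exact: (rep_contractive dotxx rep).
Qed.

Lemma ext_irreducible : irreducible_rep dot ext.
Proof.
split; [exact: dotxx|exact: ext_rep|].
have [_ _ [[a [x ax]] Lirr]] := irr; split.
  by exists (mulin a), x; rewrite ext_mulin.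
move=> L subL inv; apply: Lirr => // b y Ly.
by rewrite -ext_mulin; exact: inv.
Qed.

(** This is what makes the ideal P~ of M(A) primitive. *)
Lemma ext_ker : [set b | forall x, ext b x = 0] =
  ideal_tilde [set a | forall x, pi a x = 0].
Proof.
apply/seteqP; split=> b /= hb.
  move=> a; split=> x; first by rewrite -ext_pi hb.
  by rewrite -ext_mulin -mulin_smul extM hb ext_mulin (rep0r rep).
move=> x; suff /seteqP [_ /(_ x I)] : [set y | ext b y = 0] = setT by [].
apply: irreducible_full => [|a y]; last by rewrite /= ext_pi; case: (hb a).
exact: (@closed_subspace_ker _ _ (rn b) (@ext_linear b) (rn_ext b)).
Qed.

End Irreducible.

(** * Restricting an irreducible representation of M(A) to A *)

Section Restriction.
Variables (R : realType) (A : cstarAlgType R) (H : completeNormedModType R[i]).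
Variables (dot : {dot H for Num.conj}) (rho : multiplier A -> H -> H).
Hypothesis irr : irreducible_rep dot rho.
Let dotxx : forall x, dot x x = `|x| ^+ 2. Proof. by case: irr. Qed.
Let rep : star_representation dot rho. Proof. by case: irr. Qed.

(** For an A-invariant closed L, the vectors of L whose M(A)-orbit stays in L form an M(A)-invariant
    closed subspace [L1] that contains A L. If [L1] is 0, then A kills L, so L = 0, because the
    vectors killed by A also form an M(A)-invariant closed subspace and [x0] is not among them. *)
Lemma restriction_irreducible (a0 : A) x0 : rho (mulin a0) x0 != 0 ->
  irreducible_rep dot (fun a => rho (mulin a)).
Proof.
move=> ax0; split; [exact: dotxx| |].
  have [rl rr rM radj] := rep; split.
  - by move=> a; exact: rl.
  - by move=> x k a b; rewrite mulinD mulinZ; exact: rr.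
  - by move=> a b x; rewrite mulinM rM.
  - by move=> a x y; rewrite mulin_star radj.
have [_ _ [_ Lirr]] := irr; split; first by exists a0, x0.
have closedZ (D : set (multiplier A)) : closed_subspace [set x | forall b, D b -> rho b x = 0].
  split=> /=.
  - by move=> b _; rewrite (rep0r rep).
  - by move=> k x y hx hy b Db; rewrite (repDr rep) (repZr rep) hx // hy // scaler0 addr0.
  - have -> : [set x | forall b, D b -> rho b x = 0] =
        \bigcap_(b in D) [set x | rho b x = 0] by [].
    apply: closed_bigI => b _; apply: (@closed_eq_lip _ _ _ _ (rn b)) => x y.
    by rewrite -(repBr rep); exact: (rep_contractive dotxx rep).
have Z0 x : (forall a, rho (mulin a) x = 0) -> x = 0.
  move=> hx; have := Lirr [set x | forall b, range (@mulin R A) b -> rho b x = 0].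
  case=> //.
  - move=> b y hy _ [a _ <-]; rewrite -(repM rep) mulin_smul.
    by apply: hy; exists (rmult a b).
  - by move/seteqP => [/(_ x) h _]; apply: h => b [a _ <-].
  - move/seteqP => [_ /(_ x0 I) /(_ (mulin a0))]; move=> h.
    by rewrite h ?eqxx // in ax0; exists a0.
move=> L subL inv; have [L0 LD cL] := subL.
pose L1 := [set y | L y /\ forall b, L (rho b y)].
have [||e|e] := Lirr L1.
- split.
  + by split=> // b; rewrite (rep0r rep).
  + move=> k x y [Lx hx] [Ly hy]; split; first exact: LD.
    by move=> b; rewrite (repDr rep) (repZr rep); exact: LD.
  + apply: scvg_closed => v l vL vl; split.
      by apply: (closed_scvg cL _ vl) => n; case: (vL n).
    move=> b; apply: (closed_scvg cL (u := fun n => rho b (v n))).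
      by move=> n; case: (vL n).
    apply: (@scvg_lip _ _ _ (rho b) (rn b)) vl => x y.
    by rewrite -(repBr rep); exact: (rep_contractive dotxx rep).
- move=> c y [Ly hy]; split=> // b; rewrite -(repM rep); exact: hy.
- left; apply/seteqP; split=> [x Lx|_ ->//]; apply: Z0 => a.
  suff : L1 (rho (mulin a) x) by rewrite e.
  split=> [|b]; first exact: inv.
  by rewrite -(repM rep) smul_mulin; exact: inv.
- by right; apply/seteqP; split=> // x _; move/seteqP: e => [_ /(_ x I) []].
Qed.

End Restriction.

Lemma rep_ker_star (R : realType) (A : starAlgType R)
    (H : completeNormedModType R[i]) (dot : {dot H for Num.conj})
    (pi : A -> H -> H) (a : A) :
  irreducible_rep dot pi -> (forall x, pi a x = 0) -> forall x, pi (star a) x = 0.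
Proof.
move=> [dotxx rep _] pa x; apply: (dot_ext dotxx) => z.
by rewrite redot0l (rep_adj rep) starK pa redotC redot0l.
Qed.

Lemma irreducible_ker_mult (R : realType) (A : cstarAlgType R)
    (H : completeNormedModType R[i]) (dot : {dot H for Num.conj})
    (pi : A -> H -> H) (j : A) (b : multiplier A) :
  irreducible_rep dot pi -> (forall x, pi j x = 0) ->
  (forall x, pi (lmult b j) x = 0) /\ (forall x, pi (rmult j b) x = 0).
Proof.
move=> irr pj; have [_ rep _] := irr.
have lker i c : (forall x, pi i x = 0) -> forall x, pi (lmult c i) x = 0.
  move=> pi0 x; apply: (rep_nondegenerate irr) => a.
  by rewrite -(repM rep) -rlmult (repM rep) pi0 (rep0r rep).
split; first exact: lker.
by rewrite rmultE; apply/(rep_ker_star irr)/lker/(rep_ker_star irr).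
Qed.

(** Stability of J under multipliers makes its image an ideal of the unital algebra M(A). The
    representation found there does not vanish on [a], so it restricts irreducibly to A. *)
Theorem exists_irreducible_nonunital (R : realType) (A : cstarAlgType R)
    (J : set A) (a : A) (eps : R) :
  J 0 -> (forall (k : R[i]) x y, J x -> J y -> J (k *: x + y)) ->
  (forall b j, J j -> J (lmult b j) /\ J (rmult j b)) ->
  (forall j, J j -> J (star j)) ->
  0 < eps -> (forall j, J j -> eps <= rn (a - j)) ->
  exists (H : completeNormedModType R[i]) (dot : {dot H for Num.conj})
         (pi : A -> H -> H),
    [/\ irreducible_rep dot pi, forall j x, J j -> pi j x = 0 &
        exists2 x, x != 0 & eps * rn x <= rn (pi a x)].
Proof.
move=> J0 JD JM JS e0 da.
have [||H [dot [rho [dxx rrep rirr rJ [x x0 xe]]]]] :=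
    @exists_irreducible _ (multiplier A) (@mulin R A @` J) (mulin a) eps _ e0.
- split.
  + by exists 0 => //; rewrite mulin0.
  + by move=> k _ _ [x Jx <-] [y Jy <-]; exists (k *: x + y); rewrite ?mulinD ?mulinZ //; exact: JD.
  + move=> b _ [j Jj <-]; rewrite smul_mulin mulin_smul; have [h1 h2] := JM b j Jj.
    by split; [exists (lmult b j)|exists (rmult j b)].
  + by move=> _ [j Jj <-]; exists (star j); rewrite ?mulin_star //; exact: JS.
- by move=> _ [j Jj <-]; rewrite -mulinB rn_mulin; exact: da.
have irr : irreducible_rep dot rho by [].
exists H, dot, (fun c => rho (mulin c)); split.
- apply: (restriction_irreducible irr (a0 := a) (x0 := x)).
  apply/eqP => z; move: xe; rewrite z rn0.
  have : 0 < eps * rn x by rewrite mulr_gt0 // rn_gt0.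
  by lra.
- by move=> j y Jj; apply: rJ; exists j.
- by exists x.
Qed.

(** * Compact sets of primitive ideals *)

Section FiniteSubcovers.
Variable T : topologicalType.
Implicit Types (K : set T) (D : set (set T)) (s : seq (set T)).

Fixpoint all_in (X : Type) (D : set X) (s : seq X) : Prop :=
  if s is x :: s' then D x /\ all_in D s' else True.

Lemma all_in_cat (X : Type) (D : set X) (s t : seq X) :
  all_in D s -> all_in D t -> all_in D (s ++ t).
Proof. by elim: s => //= x s IH [Dx Ds] Dt; split=> //; exact: IH. Qed.

Definition union_of s : set T := foldr setU set0 s.

Lemma union_of_cat s t : union_of (s ++ t) = union_of s `|` union_of t.
Proof. by elim: s => [|U s IH] /=; rewrite ?set0U // IH setUA. Qed.

Lemma compact_of_covers K :
  (forall D, (forall U, D U -> open U) -> (forall x, K x -> exists2 U, D U & U x) ->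
    exists s, all_in D s /\ K `<=` union_of s) -> compact K.
Proof.
move=> cov F PF FK; apply: contrapT => ncl.
have [||s [sD Ks]] := cov [set U | open U /\ F (~` U)].
- by move=> U [].
- move=> x Kx; apply: contrapT => nU; apply: ncl; exists x; split=> // B V FB.
  rewrite nbhsE => -[W [oW Wx] WV]; apply: contrapT => BV; apply: nU.
  exists W => //; split=> //; apply: filterS FB => y By Wy.
  by apply: BV; exists y; split=> //; exact: WV.
suff : F (~` union_of s).
  by move=> h; have [x [Kx]] := filter_ex (filterI FK h); apply; exact: Ks.
elim: s sD {Ks} => [|U s IH] /= => [_|[[oU FU] Ds]].
  by rewrite setC0; exact: filterT.
by rewrite setCU; apply: filterI => //; exact: IH.
Qed.

Lemma compact_subcover K D : compact K -> (forall U, D U -> open U) ->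
  (forall x, K x -> exists2 U, D U & U x) ->
  exists s, all_in D s /\ K `<=` union_of s.
Proof.
move=> cK oD cov; apply: contrapT => ncov.
pose F := [set B | exists s, all_in D s /\ K `\` union_of s `<=` B].
have FF : Filter F.
  split.
  - by exists [::].
  - move=> B C [s [sD sB]] [t [tD tC]]; exists (s ++ t); split; first exact: all_in_cat.
    rewrite union_of_cat => x [Kx nst]; split.
      by apply: sB; split=> // h; apply: nst; left.
    by apply: tC; split=> // h; apply: nst; right.
  - by move=> B C BC [s [sD sB]]; exists s; split=> //; exact: subset_trans BC.
have PF : ProperFilter F.
  split=> // -[s [sD sB]]; apply: ncov; exists s; split=> // x Kx.
  by apply: contrapT => nx; exact: (sB x).
have [|x [Kx clx]] := cK F PF; first by exists [::]; split=> // x [].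
have [U DU Ux] := cov x Kx.
have FU : F (~` U) by exists [:: U]; split=> //= y [_ ny] Uy; apply: ny; left.
have [y [nUy Uy]] := clx _ _ FU (open_nbhs_nbhs (conj (oD U DU) Ux)).
exact: nUy.
Qed.

End FiniteSubcovers.

(** * Primitive ideals and the compact sets on which an element has norm at least eps *)

Section PrimitiveSpectrum.
Variables (R : realType) (A : cstarAlgType R).
Implicit Types (P Q : Prim A) (a : A).

Lemma prim_rep P : exists (H : completeNormedModType R[i])
    (dot : {dot H for Num.conj}) (pi : A -> H -> H),
  irreducible_rep dot pi /\ ideal_of P = [set a | forall x, pi a x = 0].
Proof. by have [H [dot [pi [dxx rep irr PE]]]] := primP P; exists H, dot, pi. Qed.

Lemma prim_of_rep (H : completeNormedModType R[i]) (dot : {dot H for Num.conj})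
    (pi : A -> H -> H) : irreducible_rep dot pi ->
  exists P : Prim A, ideal_of P = [set a | forall x, pi a x = 0].
Proof.
move=> [dxx rep irr].
have pP : primitive [set a | forall x, pi a x = 0] by exists H, dot, pi.
by exists (MkPrim pP).
Qed.

Lemma prim_openP (U : set (Prim A)) :
  open U <-> forall P, ker (~` U) `<=` ideal_of P -> ~ U P.
Proof. by []. Qed.

Lemma prim_open_notin (I : set A) : open [set P : Prim A | ~ I `<=` ideal_of P].
Proof.
apply/prim_openP => P kP nIP; apply: nIP => a Ia; apply: kP => Q /= nnIQ.
exact: (contrapT nnIQ).
Qed.

Lemma prim_open_notin1 a : open [set P : Prim A | ~ ideal_of P a].
Proof.
have -> : [set P : Prim A | ~ ideal_of P a] = [set P : Prim A | ~ [set a] `<=` ideal_of P].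
  apply/seteqP; split=> P /= h; last by move=> Pa; apply: h => _ ->.
  by move=> aP; apply: h; apply: aP.
exact: prim_open_notin.
Qed.

Lemma prim0 P : ideal_of P 0.
Proof.
by have [H [dot [pi [[_ rep _] ->]]]] := prim_rep P => x; exact: (rep0 rep).
Qed.

Lemma prim_lin P (k : R[i]) a c : ideal_of P a -> ideal_of P c ->
  ideal_of P (k *: a + c).
Proof.
have [H [dot [pi [[_ rep _] ->]]]] := prim_rep P => /= ha hc x.
by rewrite (repD rep) (repZ rep) ha hc scaler0 addr0.
Qed.

Lemma prim_star P a : ideal_of P a -> ideal_of P (star a).
Proof. by have [H [dot [pi [irr ->]]]] := prim_rep P; exact: (rep_ker_star irr). Qed.

Lemma prim_mult P (b : multiplier A) a : ideal_of P a ->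
  ideal_of P (lmult b a) /\ ideal_of P (rmult a b).
Proof. by have [H [dot [pi [irr ->]]]] := prim_rep P; exact: (irreducible_ker_mult b irr). Qed.

Lemma prim_closed P : closed (ideal_of P).
Proof.
have [H [dot [pi [[dxx rep _] ->]]]] := prim_rep P.
have -> : [set a | forall x, pi a x = 0] = \bigcap_(x in setT) [set a | pi a x = 0].
  by apply/seteqP; split=> z /= h; [move=> x _; exact: h|move=> x; exact: (h x I)].
apply: closed_bigI => x _; apply: (@closed_eq_lip _ _ _ _ (rn x)) => a c.
by rewrite -(repB rep) mulrC; exact: (rep_contractive dxx rep).
Qed.

(* A lower bound for the norm of the image of [a] modulo [P]. *)
Definition attains P a (eps : R) := exists (H : completeNormedModType R[i])
    (dot : {dot H for Num.conj}) (pi : A -> H -> H),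
  [/\ irreducible_rep dot pi, ideal_of P = [set a | forall x, pi a x = 0] &
      exists2 x, x != 0 & eps * rn x <= rn (pi a x)].

Lemma attains_dist P a eps j : attains P a eps -> ideal_of P j -> eps <= rn (a - j).
Proof.
move=> [H [dot [pi [[dxx rep _] -> [x x0 h]]]]] /= pj.
have := rep_contractive dxx rep (a - j) x.
rewrite (repB rep) pj subr0 => h1.
by rewrite -(ler_pM2r (rn_gt0 x0)); exact: le_trans h h1.
Qed.

Lemma attains_notin P a eps : 0 < eps -> attains P a eps -> ~ ideal_of P a.
Proof.
by move=> e0 h Pa; have := attains_dist h Pa; rewrite subrr rn0; lra.
Qed.

Section IdealSum.
Variables (I : Type) (K : I -> set A).

Fixpoint ideal_sum (s : seq I) : set A :=
  if s is i :: s' then [set a | exists x y, [/\ K i x, ideal_sum s' y & a = x + y]]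
  else [set 0].

Lemma ideal_sum_cat s t a c : ideal_sum s a -> ideal_sum t c ->
  ideal_sum (s ++ t) (a + c).
Proof.
elim: s a => [|i s IH] a /=; first by move=> ->; rewrite add0r.
move=> [x [y [Kx sy ->]]] tc; exists x, (y + c); split=> //; last by rewrite addrA.
exact: IH.
Qed.

Lemma ideal_sum_map (g : A -> A) : g 0 = 0 -> (forall x y, g (x + y) = g x + g y) ->
  (forall i x, K i x -> K i (g x)) -> forall s a, ideal_sum s a -> ideal_sum s (g a).
Proof.
move=> g0 gD gK; elim=> [|i s IH] a /=; first by move=> ->.
by move=> [x [y [Kx sy ->]]]; exists (g x), (g y); split=> //; [exact: gK|exact: IH].
Qed.

Lemma ideal_sum1 i a : K i a -> ideal_sum [:: i] a.
Proof. by move=> Ka; exists a, 0; rewrite addr0. Qed.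

Lemma ideal_sum_prim P s : all_in [set i | K i `<=` ideal_of P] s ->
  ideal_sum s `<=` ideal_of P.
Proof.
elim: s => [|i s IH] /= h a; first by move=> ->; exact: prim0.
move=> [x [y [Kx sy ->]]]; rewrite -[x]scale1r; apply: prim_lin; first exact: h.1.
exact: IH h.2 y sy.
Qed.

End IdealSum.

Theorem attains_compact a eps : 0 < eps -> compact [set P : Prim A | attains P a eps].
Proof.
move=> e0; apply: compact_of_covers => D oD cov; apply: contrapT => nofin.
pose K (U : set (Prim A)) := ker (~` U).
pose J := [set c | exists s, all_in D s /\ ideal_sum K s c].
have Jfar j : J j -> eps <= rn (a - j).
  move=> [s [sD sj]]; apply: contrapT => lt; apply: nofin.
  exists s; split=> // P PK; apply: contrapT => nc; apply: lt.
  apply: attains_dist PK _; apply: (ideal_sum_prim _ sj).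
  elim: (s) nc => //= U t IH nc; split; last by apply: IH => h; apply: nc; right.
  by move=> c; apply=> UP; apply: nc; left.
have JS (g : A -> A) : g 0 = 0 -> (forall x y, g (x + y) = g x + g y) ->
    (forall P x, ideal_of P x -> ideal_of P (g x)) -> forall j, J j -> J (g j).
  move=> g0 gD gP j [s [sD sj]]; exists s; split=> //.
  by apply: ideal_sum_map sj => // i x Kx P fP; apply: gP; exact: Kx.
have [|||||H [dot [pi [irr piJ xe]]]] :=
    @exists_irreducible_nonunital _ A J a eps _ _ _ _ e0.
- by exists [::].
- move=> k x y Jx [t [tD ty]].
  have [||P z Pz|s [sD sx]] := JS ( *:%R k) _ _ _ x Jx.
  + by rewrite scaler0.
  + exact: scalerDr.
  + by rewrite -[_ *: z]addr0; apply: prim_lin => //; exact: prim0.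
  by exists (s ++ t); split; [exact: all_in_cat|exact: ideal_sum_cat].
- move=> b j Jj; split.
    apply: (JS (lmult b)) => //; [exact: lmult0r|exact: lmultD|].
    by move=> P x Px; case: (prim_mult b Px).
  apply: (JS (fun c => rmult c b) _ _ _ j Jj).
  + by rewrite rmultE star0 lmult0r star0.
  + by move=> x y; rewrite !rmultE starD lmultD starD.
  + by move=> P x Px; case: (prim_mult b Px).
- by apply: JS; [exact: star0|exact: starD|exact: prim_star].
- exact: Jfar.
have [P PE] := prim_of_rep irr.
have [|U DU UP] := cov P; first by exists H, dot, pi.
have /prim_openP /(_ P) := oD U DU; apply=> // c Kc; rewrite PE /= => x.
by apply: piJ; exists [:: U]; split; [split|exact: ideal_sum1].
Qed.

Lemma prim_faithful a : (forall P, ideal_of P a) -> a = 0.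
Proof.
move=> Pa; apply/eqP; apply: contraT => a0; exfalso; have ra := rn_gt0 a0.
have [|||||H [dot [pi [irr _ [x x0 xe]]]]] :=
    @exists_irreducible_nonunital _ A [set 0] a (rn a) _ _ _ _ ra.
- by [].
- by move=> k x y /= -> ->; rewrite scaler0 addr0.
- move=> b j /= ->; split; first exact: lmult0r.
  by rewrite rmultE star0 lmult0r star0.
- by move=> j /= ->; rewrite star0.
- by move=> j /= ->; rewrite subr0.
have [P PE] := prim_of_rep irr; have := Pa P; rewrite PE => /(_ x) z.
by move: xe; rewrite z rn0; have := mulr_gt0 ra (rn_gt0 x0); lra.
Qed.

End PrimitiveSpectrum.

(** * Upper bounds for self-adjoint elements modulo primitive ideals *)

Section Cut.
Variables (R : realType) (B : unitalCStarAlgType R).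
Implicit Types (h c d b : B) (Q : Prim B).

Lemma rep_one (H : completeNormedModType R[i]) (dot : {dot H for Num.conj})
    (rho : B -> H -> H) : irreducible_rep dot rho -> forall x, rho sone x = x.
Proof.
move=> irr x; have [_ rep _] := irr.
apply/eqP; rewrite -subr_eq0; apply/eqP/(rep_nondegenerate irr) => a.
by rewrite (repBr rep) -(repM rep) smul1r subrr.
Qed.

Lemma rep_sc (H : completeNormedModType R[i]) (dot : {dot H for Num.conj})
    (rho : B -> H -> H) t : irreducible_rep dot rho ->
  forall x, rho (sc B t) x = t%:C *: x.
Proof.
by move=> irr x; have [_ rep _] := irr; rewrite (repZ rep) (rep_one irr).
Qed.

Lemma rep_pos (H : completeNormedModType R[i]) (dot : {dot H for Num.conj})
    (rho : B -> H -> H) h : irreducible_rep dot rho -> pos h ->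
  forall x, 0 <= redot dot (rho h x) x.
Proof.
move=> [dxx rep _] /pos_sqrt[r [pr rE _]] x.
by rewrite -rE (repM rep) (rep_adj rep) (pos_selfadj pr) (redotxx dxx) sqr_ge0.
Qed.

(** Since dc = 0, the operator of h acts on the range of c as c does. So if h <= 0 there, <c (c y),
    c y> <= 0, which kills r c for the root r of c, then c^2, then c. *)
Lemma rep_neg_part (H : completeNormedModType R[i]) (dot : {dot H for Num.conj})
    (rho : B -> H -> H) h c d : irreducible_rep dot rho ->
  pos c -> pos d -> h = c - d -> d ** c = 0 ->
  (forall x, rho c x = 0) <-> (forall x, redot dot (rho h x) x <= 0).
Proof.
move=> irr pc pd hE dc; have [dxx rep _] := irr; split=> hx x.
  by rewrite hE (repB rep) hx sub0r redotNl oppr_le0; exact: (rep_pos irr).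
have [r [pr rE _]] := pos_sqrt pc.
have r3 y : rho (r ** c) y = 0.
  apply: rn0_eq0; apply/eqP; rewrite -sqrf_eq0; apply/eqP/le_anti; rewrite sqr_ge0 andbT.
  rewrite -(redotxx dxx) (repM rep) (rep_adj rep) (pos_selfadj pr) -(repM rep) rE.
  have := hx (rho c y); rewrite hE (repB rep) -[rho d _](repM rep) dc (rep0 rep) subr0.
  by rewrite redotC.
have cc y : rho (c ** c) y = 0.
  by rewrite -{1}rE -smulA (repM rep) r3 (rep0r rep).
apply: rn0_eq0; apply/eqP; rewrite -sqrf_eq0 -(redotxx dxx) (rep_adj rep).
by rewrite (pos_selfadj pc) -(repM rep) cc redotC redot0l.
Qed.

(* [h <= t] modulo [Q]. *)
Definition bounded_at Q h (t : R) := forall (H : completeNormedModType R[i])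
    (dot : {dot H for Num.conj}) (rho : B -> H -> H),
  irreducible_rep dot rho -> ideal_of Q = [set a | forall x, rho a x = 0] ->
  forall x, redot dot (rho h x) x <= t * rn x ^+ 2.

Lemma cut_parts h c d (t : R) : pos c -> pos d -> h - sc B t = c - d ->
  d ** c = 0 -> forall (H : completeNormedModType R[i])
    (dot : {dot H for Num.conj}) (rho : B -> H -> H) Q,
  irreducible_rep dot rho -> ideal_of Q = [set a | forall x, rho a x = 0] ->
  ideal_of Q c <-> forall x, redot dot (rho h x) x <= t * rn x ^+ 2.
Proof.
move=> pc pd hE dc H dot rho Q irr ->.
have [dxx rep _] := irr; rewrite /= (rep_neg_part irr pc pd hE dc).
split=> hx x; move: (hx x); rewrite (repB rep) (rep_sc _ irr) redotDl redotNl redotZl;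
by rewrite (redotxx dxx); lra.
Qed.

(** The positive part of h - t turns an inequality of quadratic forms into membership of one element
    in Q, hence into a closed condition on Q. *)
Lemma cut_exists h (t : R) : star h = h -> exists c, forall Q,
  ideal_of Q c <-> bounded_at Q h t.
Proof.
move=> hs; have [|c [d [pc pd hE cd dc]]] := @pos_part _ _ (h - sc B t).
  by rewrite starB hs star_sc.
exists c => Q; split=> [Qc H dot rho irr QE|bQ].
  exact: (iffLR (cut_parts pc pd hE dc irr QE)).
have [H [dot [rho [irr QE]]]] := prim_rep Q.
by apply/(cut_parts pc pd hE dc irr QE); apply: bQ.
Qed.

(** The inequality depends on the kernel alone, since it amounts to membership of the positive part
    of h - t; so one representation decides it for all. *)
Lemma bounded_at_rep h (t : R) Q (H : completeNormedModType R[i])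
    (dot : {dot H for Num.conj}) (rho : B -> H -> H) : star h = h ->
  irreducible_rep dot rho -> ideal_of Q = [set a | forall x, rho a x = 0] ->
  (forall x, redot dot (rho h x) x <= t * rn x ^+ 2) -> bounded_at Q h t.
Proof.
move=> hs irr QE hx.
have [|c [d [pc pd hE cd dc]]] := @pos_part _ _ (h - sc B t).
  by rewrite starB hs star_sc.
move=> H' dot' rho' irr' QE'.
by apply/(cut_parts pc pd hE dc irr' QE')/(cut_parts pc pd hE dc irr QE).
Qed.

Lemma bounded_at_open h (t : R) : star h = h -> open [set Q | ~ bounded_at Q h t].
Proof.
move=> hs; have [c cP] := cut_exists t hs.
rewrite (_ : [set Q | _] = [set Q | ~ ideal_of Q c]); first exact: prim_open_notin1.
by apply/seteqP; split=> Q /= h1 h2; apply: h1; apply/cP.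
Qed.

Lemma bounded_at_zero b Q : (forall e : R, 0 < e -> bounded_at Q (star b ** b) e) ->
  ideal_of Q b.
Proof.
move=> bQ; have [H [dot [rho [irr QE]]]] := prim_rep Q; rewrite QE /= => x.
have [dxx rep _] := irr.
apply: rn0_eq0; apply/eqP; rewrite -sqrf_eq0; apply/eqP/le_anti; rewrite sqr_ge0 andbT.
apply/ler_addgt0Pr => e e0; rewrite add0r.
have d0 : 0 < e / (rn x ^+ 2 + 1) by rewrite divr_gt0 // ltr_wpDl ?sqr_ge0.
have := bQ _ d0 H dot rho irr QE x.
rewrite (repM rep) (rep_adj rep) starK (redotxx dxx) => h1; apply: le_trans h1 _.
have := sqr_ge0 (rn x); move: (rn x ^+ 2) => s s0.
by rewrite mulrAC ler_pdivrMr ?ler_wpM2l ?(ltW e0) //; lra.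
Qed.

End Cut.

Definition approximate_unit (R : realType) (A : cstarAlgType R) (u : nat -> A) :=
  [/\ forall n, rn (u n) <= 1, forall a, scvg (fun n => u n ** a) a &
      forall a, scvg (fun n => a ** u n) a].

Lemma prod_eval_continuous (I : Type) (K : I -> topologicalType) (i : I) :
  continuous (fun g : prod_topology K => g i).
Proof.
move=> g V Vgi; have /cvg_sup /(_ i) h : nbhs g --> g by exact: cvg_id.
apply: h; exact: (@initial_continuous (prod_topology K) (K i) (fun g => g i) g V).
Qed.

Lemma stone_cech_coord_continuous (R : realType) (X : topologicalType)
    (f : {f : X -> R | unit_continuous f}) :
  continuous (fun z : stone_cech R X => sval z f).
Proof.
move=> z; apply: (@continuous_comp _ _ _ (fun z : stone_cech R X => sval z)
  (fun g => g f)).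
  exact: initial_continuous.
exact: prod_eval_continuous.
Qed.

(** * The ideals P~ inside Prim(M(A)) *)

Section TildeSpectrum.
Variables (R : realType) (A : cstarAlgType R) (u : nat -> A).
Hypothesis unit_u : approximate_unit u.
Implicit Types (P : Prim A) (Q : Prim (multiplier A)) (b : multiplier A).

(** Realises P and P~ on the same Hilbert space, so that estimates can pass between A and M(A). *)
Lemma prim_ext P : exists (H : completeNormedModType R[i])
    (dot : {dot H for Num.conj}) (pi : A -> H -> H) (rho : multiplier A -> H -> H),
  [/\ irreducible_rep dot pi, ideal_of P = [set a | forall x, pi a x = 0],
      irreducible_rep dot rho,
      ideal_tilde (ideal_of P) = [set b | forall x, rho b x = 0] &
      (forall a x, rho (mulin a) x = pi a x) /\
      forall x, scvg (fun n => pi (u n) x) x].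
Proof.
have [u1 ul _] := unit_u.
have [H [dot [pi [irr PE]]]] := prim_rep P.
exists H, dot, pi, (ext irr u1 ul); split=> //.
- exact: ext_irreducible.
- by rewrite PE -(ext_ker irr u1 ul).
- by split; [exact: ext_mulin|exact: (unit_scvg irr u1 ul)].
Qed.

Lemma tilde_prim P : exists Q, ideal_of Q = ideal_tilde (ideal_of P).
Proof.
have [H [dot [pi [rho [_ _ irr -> _]]]]] := prim_ext P.
exact: (prim_of_rep irr).
Qed.

Lemma tilde_zero b : (forall P, ideal_tilde (ideal_of P) b) -> b = 0.
Proof.
move=> hb; apply: mult_eq_l => a; apply: prim_faithful => P.
by case: (hb P a).
Qed.

(** Otherwise the complement of G contains all P~. Their intersection is 0 by [tilde_zero], so the
    complement, being closed, would be everything. *)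
Lemma tilde_dense (G : set (Prim (multiplier A))) Q : open G -> G Q ->
  exists P Q', ideal_of Q' = ideal_tilde (ideal_of P) /\ G Q'.
Proof.
move=> /prim_openP oG GQ; apply: contrapT => no; apply: (oG Q) => // b kb.
suff -> : b = 0 by exact: prim0.
apply: tilde_zero => P; have [Q' Q'E] := tilde_prim P; rewrite -Q'E; apply: kb.
by move=> GQ'; apply: no; exists P, Q'.
Qed.

Section Criterion.
Variables (X : topologicalType) (phi : Prim A -> X).
Variable phibar : Prim (multiplier A) -> stone_cech R X.
Hypothesis X_locally_compact : locally_compact [set: X].
Hypothesis X_hausdorff : hausdorff_space X.
Hypothesis phibar_continuous : continuous phibar.
Hypothesis phibar_extends : forall (P : Prim A) (Q : Prim (multiplier A)),
       ideal_of Q = ideal_tilde (ideal_of P) ->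
       phibar Q = to_stone_cech R (phi P).

Lemma image_space_separate (Y : set (image_space phi)) (x : image_space phi) :
  ~ closure Y x -> exists f : X -> R, unit_continuous f /\
    f (set_val x) = 0 /\ forall y, Y y -> f (set_val y) = 1.
Proof.
move=> nYx; have : nbhs x (~` closure Y).
  by apply: open_nbhs_nbhs; split=> //; exact/closed_openC/closed_closure.
rewrite nbhsE /= => -[W [[V oV VW] Wx] Wsub].
have Vx : V (set_val x) by move: Wx; rewrite -VW.
have : uniform_separator [set set_val x] (~` V).
  apply: (@locally_compact_completely_regular X R X_locally_compact X_hausdorff).
    exact: open_closedC.
  by move=> nV; exact: nV Vx.
move=> /(@uniform_separatorP _ R)[f [cf f01 fx fV]].
exists f; split; first split=> //.
  by move=> y; move: (f01 (f y) (imageT _ y)); rewrite /= in_itv.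
split; first by apply: fx; exists (set_val x).
move=> y Yy; apply: fV; exists (set_val y) => // Vy.
have : W y by rewrite -VW.
by move/Wsub; apply; exact: subset_closure.
Qed.

(** Transfers a question about Q over x to Prim(A). If b^* b exceeded e at Q, a function f with f(x)
    = 0 and f = 1 on the image of W would define a nonempty open set of ideals where b^* b exceeds e
    and f < 1/2. By density it contains some P~, but W contains P, so f is 1 there. *)
Lemma criterion b Q (x : image_space phi) :
  phibar Q = to_stone_cech R (set_val x) ->
  (forall e : R, 0 < e -> exists W : set (Prim A),
    ~ closure (corestriction phi @` W) x /\
    forall P Q', ideal_of Q' = ideal_tilde (ideal_of P) -> ~ W P ->
      bounded_at Q' (star b ** b) e) ->
  ideal_of Q b.
Proof.
move=> Qx hW; apply: bounded_at_zero => e e0.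
apply: contrapT => nQ; have [W [nWx WP]] := hW e e0.
have [f [fu [fx fW]]] := image_space_separate nWx.
have bs : star (star b ** b) = star b ** b by rewrite starM starK.
pose ev (z : stone_cech R X) : R := sval z (exist _ f fu).
have cev : continuous ev by exact: stone_cech_coord_continuous.
pose G := [set Q' | ~ bounded_at Q' (star b ** b) e] `&`
  (ev \o phibar) @^-1` [set t | t < 2^-1].
have oG : open G.
  apply: openI; first exact: bounded_at_open.
  apply: open_comp => [Q' _|]; last exact: open_lt.
  by apply: continuous_comp; [exact: phibar_continuous|exact: cev].
have [|P [Q' [Q'E [nb lt]]]] := @tilde_dense G Q oG.
  by split=> //=; rewrite Qx /ev /= /stone_cech_eval /= fx invr_gt0.
apply: nb; apply: (WP P Q' Q'E) => WP0.
move: lt; rewrite /= (phibar_extends Q'E) /ev /= /stone_cech_eval /=.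
have := fW (corestriction phi P); rewrite /corestriction /= => ->; last by exists P.
by lra.
Qed.

End Criterion.
End TildeSpectrum.

(** * Separation in spaces with finite connecting order *)

(* [T] with the open sets that are unions of classes of the relation [rho]. *)
Definition sat_space (T : Type) (rho : T -> T -> Prop) : Type := T.

Section SaturatedTopology.
Variables (T : topologicalType) (rho : T -> T -> Prop).

Definition sat_open (U : set (sat_space rho)) :=
  open (U : set T) /\ forall P Q : T, rho P Q -> U P -> U Q.

Fact sat_openT : sat_open setT.
Proof. by split=> //; exact: openT. Qed.

Fact sat_openI : setI_closed sat_open.
Proof.
move=> U V [oU sU] [oV sV]; split; first exact: openI.
by move=> P Q PQ [UP VP]; split; [exact: sU PQ UP|exact: sV PQ VP].
Qed.

Fact sat_open_bigU (I : Type) (f : I -> set (sat_space rho)) :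
  (forall i, sat_open (f i)) -> sat_open (\bigcup_i f i).
Proof.
move=> of_; split; first by apply: bigcup_open => i _; case: (of_ i).
by move=> P Q PQ [i _ fP]; exists i => //; apply: (of_ i).2 PQ fP.
Qed.

HB.instance Definition _ := Choice.copy (sat_space rho) T.
HB.instance Definition _ := isOpenTopological.Build (sat_space rho)
  sat_openT sat_openI sat_open_bigU.

Lemma sat_space_openP (U : set (sat_space rho)) : open U <-> sat_open U.
Proof. by []. Qed.

End SaturatedTopology.

Section PointSetTopology.
Variable T : topologicalType.
Implicit Types (P Q : T) (K S Y U V : set T).

Lemma closure_openP S P :
  closure S P <-> forall U, open U -> U P -> exists2 Q, S Q & U Q.
Proof.
split=> [cS U oU UP|h B].
  by have [Q [SQ UQ]] := cS U (open_nbhs_nbhs (conj oU UP)); exists Q.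
rewrite nbhsE => -[U [oU UP] UB]; have [Q SQ UQ] := h U oU UP.
by exists Q; split=> //; exact: UB.
Qed.

Lemma closureE_closed S : closed S -> closure S = S.
Proof. by move=> cS; apply/esym/closure_id. Qed.

Lemma closure_minimal S Y : closed Y -> S `<=` Y -> closure S `<=` Y.
Proof. by move=> cY SY; rewrite -(closureE_closed cY); exact: closureS. Qed.

Lemma disjoint_not S Y P : S `&` Y = set0 -> S P -> Y P -> False.
Proof. by move=> SY SP YP; have : (S `&` Y) P by []; rewrite SY. Qed.

(** The relation [inseparable] for an arbitrary space, and [iwalk] likewise for [walk]: the
    separation argument is purely topological and is applied to Prim(A) only at the end. *)
Definition insep P Q := ~ exists U V,
  [/\ open U, open V, U P, V Q & U `&` V = set0].

Lemma insep_refl P : insep P P.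
Proof. by move=> [U [V [_ _ UP VP UV]]]; exact: disjoint_not UV UP VP. Qed.

Lemma insep_sym P Q : insep P Q -> insep Q P.
Proof.
by move=> PQ [U [V [oU oV UQ VP UV]]]; apply: PQ; exists V, U; rewrite setIC.
Qed.

Lemma insep_meet P Q U V : insep P Q -> open U -> open V -> U P -> V Q ->
  exists2 S, U S & V S.
Proof.
move=> PQ oU oV UP VQ; apply: contrapT => no; apply: PQ; exists U, V; split=> //.
by apply/seteqP; split=> // S [US VS]; apply: no; exists S.
Qed.

Fixpoint iwalk (n : nat) P Q : Prop :=
  if n is m.+1 then exists2 S, insep P S & iwalk m S Q else P = Q.

Lemma separate_compact P K : compact K -> (forall Q, K Q -> ~ insep P Q) ->
  exists U V, [/\ open U, open V, U P, K `<=` V & U `&` V = set0].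
Proof.
move=> cK nK.
pose D := [set V : set T | open V /\ exists U, [/\ open U, U P & U `&` V = set0]].
have [||s [sD Ks]] := compact_subcover cK (D := D).
- by move=> V [].
- move=> Q KQ; have /contrapT [U [V [oU oV UP VQ UV]]] := nK Q KQ.
  by exists V => //; split=> //; exists U.
suff [U [oU UP Us oV]] : exists U, [/\ open U, U P, U `&` union_of s = set0 & open (union_of s)].
  by exists U, (union_of s).
elim: s sD {Ks} => [|V s IH] /= sD.
  by exists setT; rewrite setI0; split=> //; [exact: openT|exact: open0].
have [[oV [U [oU UP UV]]] Ds] := sD.
have [W [oW WP Ws os]] := IH Ds.
exists (U `&` W); split; [exact: openI|by []| |exact: openU].
apply/seteqP; split=> // S [[US WS] [VS|sS]].
  exact: (disjoint_not UV US VS).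
exact: (disjoint_not Ws WS sS).
Qed.

Definition nbr Y : set T := [set P | exists2 Q, Y Q & insep P Q].

Lemma closed_of_nbhs S :
  (forall P, ~ S P -> exists U, [/\ open U, U P & U `&` S = set0]) -> closed S.
Proof.
move=> h P /closure_openP cS; apply: contrapT => nS.
have [U [oU UP US]] := h P nS; have [Q SQ UQ] := cS U oU UP.
exact: disjoint_not US UQ SQ.
Qed.

Lemma nbr_closed K : compact K -> closed (nbr K).
Proof.
move=> cK; apply: closed_of_nbhs => P nP.
have [|U [V [oU oV UP KV UV]]] := @separate_compact P K cK.
  by move=> Q KQ PQ; apply: nP; exists Q.
exists U; split=> //; apply/seteqP; split=> // S [US [Q KQ SQ]].
have [W UW VW] := insep_meet SQ oU oV US (KV _ KQ).
exact: disjoint_not UV UW VW.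
Qed.

Variable Kn : nat -> set T.
Hypothesis Kn_compact : forall n, compact (Kn n).
Hypothesis Kn_cover : forall P, exists n, Kn n P.

Lemma countable_cover S (good : set T -> Prop) : closed S ->
  good set0 -> (forall U V, good U -> good V -> good (U `|` V)) ->
  (forall P, S P -> exists U, [/\ open U, U P & good U]) ->
  exists f : nat -> set T,
    [/\ forall n, open (f n), forall n, good (f n) & forall P, S P -> exists n, f n P].
Proof.
move=> cS g0 gU cov.
have fin n : exists U, [/\ open U, good U & Kn n `&` S `<=` U].
  have [||s [sD Ks]] := compact_subcover (compact_closedI (@Kn_compact n) cS)
    (D := [set U | open U /\ good U]).
  - by move=> U [].
  - by move=> P [_ SP]; have [U [oU UP gdU]] := cov P SP; exists U.
  exists (union_of s); suff [] : open (union_of s) /\ good (union_of s) by [].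
  elim: s sD {Ks} => [|U s IH] /=; first by split=> //; exact: open0.
  by move=> [[oU gdU] /IH [os gs]]; split; [exact: openU|exact: gU].
have [f fP] := boolp.choice fin; exists f; split.
- by move=> n; case: (fP n).
- by move=> n; case: (fP n).
- move=> P SP; have [n KP] := Kn_cover P; exists n.
  by have [_ _] := fP n; apply.
Qed.

(** The argument that regular Lindelof spaces are normal: cover S and Y by countably many open sets
    whose closures avoid the other set, and remove from each the closures of the opposite ones with
    index up to its own. *)
Lemma lindelof_separate S Y : closed S -> closed Y ->
  (forall P, S P -> exists U, [/\ open U, U P & closure U `&` Y = set0]) ->
  (forall P, Y P -> exists U, [/\ open U, U P & closure U `&` S = set0]) ->
  exists U V, [/\ open U, open V, S `<=` U, Y `<=` V & U `&` V = set0].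
Proof.
move=> cS cY hS hY.
have cov (E F : set T) : closed E ->
    (forall P, E P -> exists U, [/\ open U, U P & closure U `&` F = set0]) ->
    exists f : nat -> set T, [/\ forall n, open (f n),
      forall n, closure (f n) `&` F = set0 & forall P, E P -> exists n, f n P].
  move=> cE hE; apply: (@countable_cover E (fun U => closure U `&` F = set0)) => //.
    by rewrite closure0 set0I.
  by move=> U V UF VF; rewrite closureU setIUl UF VF setU0.
have [f [of_ fY fS]] := cov S Y cS hS; have [g [og gS gY]] := cov Y S cY hY.
pose avoid (h : nat -> set T) n := [set P | forall m, (m <= n)%N -> ~ closure (h m) P].
have oavoid h n : open (avoid h n).
  elim: n => [|n IH].
    rewrite (_ : avoid h 0%N = ~` closure (h 0%N)).
      by apply: closed_openC; exact: closed_closure.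
    apply/seteqP; split=> P /=; first by move=> aP; exact: aP.
    by move=> nP m; rewrite leqn0 => /eqP ->.
  rewrite (_ : avoid h n.+1 = avoid h n `&` ~` closure (h n.+1)).
    by apply: openI => //; apply: closed_openC; exact: closed_closure.
  apply/seteqP; split=> P /=.
    by move=> aP; split; [move=> m mn; apply: aP; exact: leqW|exact: aP].
  by move=> [aP nP] m; rewrite leq_eqVlt ltnS => /orP[/eqP ->|/aP].
exists (\bigcup_n (f n `&` avoid g n)), (\bigcup_n (g n `&` avoid f n)); split.
- by apply: bigcup_open => n _; exact: openI.
- by apply: bigcup_open => n _; exact: openI.
- move=> P SP; have [n fP] := fS P SP; exists n => //; split=> // m _ gP.
  exact: disjoint_not (gS m) gP SP.
- move=> P YP; have [n gP] := gY P YP; exists n => //; split=> // m _ fP.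
  exact: disjoint_not (fY m) fP YP.
- apply/seteqP; split=> // P [[n _ [fP aP]] [m _ [gP bP]]].
  have [mn|nm] := leqP m n; first by apply: (aP m mn); exact: subset_closure.
  by apply: (bP n (ltnW nm)); exact: subset_closure.
Qed.

End PointSetTopology.

(** * A Urysohn lemma for spaces with bounded walks *)

Section Urysohn.
Variables (R : realType) (T : topologicalType) (Kn : nat -> set T).
Hypothesis Kn_compact : forall n, compact (Kn n).
Hypothesis Kn_cover : forall P, exists n, Kn n P.
Variable k : nat.
Hypothesis walk_bound : forall n (P Q : T), iwalk n P Q -> iwalk k P Q.
Variable H : set T.
Hypothesis closed_H : closed H.
Hypothesis sat_H : forall P Q, insep P Q -> H P -> H Q.
Hypothesis regular_H : forall Q, ~ H Q ->
  exists U, [/\ open U, U Q & closure U `&` H = set0].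
Hypothesis compact_off_H : forall P, H P ->
  exists U, [/\ open U, U P & compact (closure (U `\` H))].
Implicit Types (P Q : T) (Y : set T).

Lemma iwalk_sat (S : set T) n P Q : (forall P Q, insep P Q -> S P -> S Q) ->
  iwalk n P Q -> S P -> S Q.
Proof.
by move=> sS; elim: n P => [|n IH] P /=; [move=> ->|move=> [P' /sS h /IH g] /h].
Qed.

Lemma off_H_closure U P : closure U P -> ~ H P -> closure (U `\` H) P.
Proof.
move=> /closure_openP cP nHP; apply/closure_openP => W oW WP.
have [Q UQ [WQ nHQ]] := cP _ (openI oW (closed_openC closed_H)) (conj WP nHP).
by exists Q.
Qed.

(** Near P, the points of S lie in the compact set [closure (U0]\[H)]. None of them is inseparable
    from P, because H is saturated and misses S. *)
Lemma separate_at_H P (S : set T) : H P -> closed S -> S `&` H = set0 ->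
  exists U, [/\ open U, U P & closure U `&` S = set0].
Proof.
move=> HP cS SH; have [U0 [oU0 U0P cU0]] := compact_off_H HP.
have [||U [V [oU oV UP KV UV]]] :=
  @separate_compact T P (closure (U0 `\` H) `&` S).
- exact: compact_closedI.
- by move=> Q [_ SQ] PQ; exact: disjoint_not SH SQ (sat_H PQ HP).
exists (U0 `&` U); split; [exact: openI|by []|].
apply/seteqP; split=> // Q [cQ SQ].
have nHQ : ~ H Q by move=> HQ; exact: disjoint_not SH SQ HQ.
have KQ : closure (U0 `\` H) Q.
  by apply: off_H_closure => //; apply: closureS cQ; exact: subIsetl.
have [Q' [_ UQ'] VQ'] := (closure_openP _ _).1 cQ V oV (KV _ (conj KQ SQ)).
exact: disjoint_not UV UQ' VQ'.
Qed.

(** [C] is asked to be closed as well as compact, since in a space that is not Hausdorff neither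
    implies the other. *)
Definition confined j U C := [/\ open U, compact C, closed C &
  forall Q n Q', (U `\` H) Q -> (n <= j)%N -> iwalk n Q Q' -> C Q'].

Lemma confined0 j : confined j set0 set0.
Proof.
split; [exact: open0|exact: compact0|exact: closed0|].
by move=> Q n Q' [].
Qed.

Lemma confinedU j U C V D : confined j U C -> confined j V D ->
  confined j (U `|` V) (C `|` D).
Proof.
move=> [oU kC cC UC] [oV kD cD VD]; split.
- exact: openU.
- exact: compactU.
- exact: closedU.
- move=> Q n Q' [[UQ|VQ] nHQ] nj w.
    by left; exact: (UC Q n Q').
  by right; exact: (VD Q n Q').
Qed.

(** Induction on the length of the walks. Near P, a first step off H lands in the compact set [K0].
    The part of [K0] in H is covered by finitely many sets confined for the remaining j steps. The
    rest of [K0] is compact and contains no point inseparable from P, so a smaller neighbourhood of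
    P has no step into it. *)
Lemma exists_confined j P : H P -> exists U C, U P /\ confined j U C.
Proof.
elim: j P => [|j IH] P HP; have [U0 [oU0 U0P kU0]] := compact_off_H HP.
  exists U0, (closure (U0 `\` H)); split=> //; split=> //.
    exact: closed_closure.
  by move=> Q n Q' UQ; rewrite leqn0 => /eqP -> /= <-; exact: subset_closure.
set K0 := closure (U0 `\` H) in kU0.
have [||s [sD Ks]] := compact_subcover (compact_closedI kU0 closed_H)
    (D := [set U | exists C, confined j U C]).
- by move=> U [C []].
- move=> Q [_ HQ]; have [U [C [UQ UC]]] := IH Q HQ.
  by exists U => //; exists C.
have [C1 [oU1 kC1 cC1 UC1]] : exists C, confined j (union_of s) C.
  elim: s sD {Ks} => [|U s IHs] /=.
    by exists set0; exact: confined0.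
  by move=> [[C UC] /IHs [D sD]]; exists (C `|` D); exact: confinedU.
set U1 := union_of s in oU1 UC1 Ks.
have [||U [V [oU oV UP DV UV]]] := @separate_compact T P (K0 `&` ~` U1).
- by apply: compact_closedI => //; exact: open_closedC.
- move=> Q [KQ nUQ] PQ; apply: nUQ; apply: Ks; split=> //.
  exact: sat_H PQ HP.
exists (U0 `&` U), (K0 `|` C1); split=> //; split.
- exact: openI.
- exact: compactU.
- by apply: closedU => //; exact: closed_closure.
- move=> Q [|n] Q' [[U0Q UQ] nHQ] nj /=.
    by move=> <-; left; exact: subset_closure.
  move=> [S QS w]; right.
  have nHS : ~ H S by move=> HS; apply: nHQ; exact: sat_H (insep_sym QS) HS.
  have KS : K0 S.
    apply/closure_openP => W oW WS.
    have [S' [US' nHS'] WS'] := insep_meet QS (openI oU0 (closed_openC closed_H))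
      oW (conj U0Q nHQ) WS.
    by exists S'.
  apply: (UC1 S n Q') => //; split=> //.
  apply: contrapT => nUS.
  have [S' US' VS'] := insep_meet QS oU oV UQ (DV _ (conj KS nUS)).
  exact: disjoint_not UV US' VS'.
Qed.

Definition confined_part : set T :=
  \bigcup_(U in [set U | exists C, confined k U C]) U.

Lemma confined_part_open : open confined_part.
Proof. by apply: bigcup_open => U [C []]. Qed.

Lemma sub_confined_part : H `<=` confined_part.
Proof.
by move=> P /(exists_confined k) [U [C [UP UC]]]; exists U => //; exists C.
Qed.

Lemma confined_all U C Q n Q' : confined k U C -> U Q -> ~ H Q ->
  iwalk n Q Q' -> C Q'.
Proof.
by move=> [_ _ _ UC] UQ nHQ /walk_bound; apply: UC => //; exact: leqnn.
Qed.

(** By [walk_bound] this is the full saturation of Y: walks longer than k reach nothing new. *)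
Definition sat Y : set T := [set P | exists2 Q, Y Q & iwalk k P Q].

Lemma sub_sat Y : Y `<=` sat Y.
Proof. by move=> P YP; exists P => //; apply: (@walk_bound 0%N). Qed.

Lemma sat_saturated Y P Q : insep P Q -> sat Y P -> sat Y Q.
Proof.
move=> PQ [S YS w]; exists S => //; apply: (@walk_bound k.+1).
by exists P => //; exact: insep_sym.
Qed.

Lemma sat_meets Y (S : set T) P : (forall P Q, insep P Q -> S P -> S Q) ->
  sat Y P -> S P -> exists2 Q, Y Q & S Q.
Proof.
by move=> sS [Q YQ w] SP; exists Q => //; exact: iwalk_sat sS w SP.
Qed.

(** The points of C that reach Y in j steps inside C. Every stage is compact and closed, because the
    neighbours of a compact set form a closed set; this is how the bound on walks makes saturations
    closed. *)
Fixpoint reach Y C j : set T :=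
  if j is i.+1 then nbr (reach Y C i) `&` C else Y `&` C.

Lemma reach_compact Y C j : closed Y -> closed C -> compact C ->
  closed (reach Y C j) /\ compact (reach Y C j).
Proof.
move=> cY cC kC; elim: j => [|j [cR kR]] /=.
  by split; [exact: closedI|rewrite setIC; exact: compact_closedI].
have cN := nbr_closed kR.
by split; [exact: closedI|rewrite setIC; exact: compact_closedI].
Qed.

Lemma reach_walk Y C j P : reach Y C j P -> exists2 Q, Y Q & iwalk j P Q.
Proof.
elim: j P => [|j IH] P /=; first by move=> [YP _]; exists P.
by move=> [[S /IH [Q YQ w] PS] _]; exists Q => //; exists S.
Qed.

Lemma walk_reach Y C j P Q : (forall n S, iwalk n P S -> C S) ->
  iwalk j P Q -> Y Q -> reach Y C j P.
Proof.
elim: j P => [|j IH] P hC /=.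
  by move=> <- YP; split=> //; exact: (hC 0%N).
move=> [S PS w] YQ; split; last exact: (hC 0%N).
exists S => //; apply: IH => // n S' wS; apply: (hC n.+1).
by exists S.
Qed.

(** Around P and off H, [sat Y] agrees with the closed set [reach Y C k], as walks from there are
    confined to C. Walks from points of H are not, which is why Y must either miss H, so that its
    saturation does too, or contain H. *)
Lemma sat_closed_in Y P : closed Y -> Y `&` H = set0 \/ H `<=` Y ->
  confined_part P -> closure (sat Y) P -> sat Y P.
Proof.
move=> cY YH [U [C cUC] UP] /closure_openP cP.
have [oU kC cC _] := cUC; have [cR _] := reach_compact k cY cC kC.
have sub Q : sat Y Q -> U Q -> ~ H Q -> reach Y C k Q.
  move=> [Q' YQ' w] UQ nHQ; apply: walk_reach w YQ' => n S.
  exact: confined_all cUC UQ nHQ.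
have [HP|nHP] := pselect (H P); last first.
  suff : reach Y C k P by exact: reach_walk.
  rewrite -(closureE_closed cR); apply/closure_openP => W oW WP.
  have [Q sQ [[WQ UQ] nHQ]] := cP _
    (openI (openI oW oU) (closed_openC closed_H)) (conj (conj WP UP) nHP).
  by exists Q => //; exact: sub.
case: YH => [YH|HY]; last by apply: sub_sat; exact: HY.
suff : reach Y C k P by exact: reach_walk.
rewrite -(closureE_closed cR); apply/closure_openP => W oW WP.
have [Q sQ [WQ UQ]] := cP _ (openI oW oU) (conj WP UP).
exists Q => //; apply: sub => // HQ.
have [S YS HS] := sat_meets sat_H sQ HQ.
exact: disjoint_not YH YS HS.
Qed.

(** Makes a closed set compatible with identifying Y to a point: Y is added exactly when it is met.
    The last clause remembers why a new point was added. *)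
Lemma absorb_closed (F Y : set T) : closed F -> closed Y ->
  exists F', [/\ closed F', F `<=` F', F' `&` Y = set0 \/ Y `<=` F',
    (F' `<=` F `|` Y) & forall P, F' P -> F P \/ exists2 Q, F Q & Y Q /\ Y P].
Proof.
move=> cF cY; have [[Q [FQ YQ]]|/nonemptyPn FY] := pselect (F `&` Y !=set0); last first.
  exists F; split; [by []|by []|by left|by move=> P; left|by move=> P; left].
exists (F `|` Y); split.
- exact: closedU.
- by left.
- by right=> P; right.
- by [].
- by move=> P [FP|YP]; [left|right; exists Q].
Qed.

(* Identifying all points of [H], and all points of the saturation [Z] of [S]
   and of the part away from [H], leaves a normal space: there the walks from a
   point stay in a compact set, so that saturations of closed sets are closed. *)
Theorem separating_function S : closed S -> S `&` H = set0 ->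
  exists f : T -> R, [/\ continuous f, forall P, 0 <= f P <= 1,
    forall P, H P -> f P = 1 & forall P, S P -> f P = 0].
Proof.
move=> cS SH.
have oG := confined_part_open; have HG := sub_confined_part.
set G0 := confined_part in oG HG.
(* [N] is a neighbourhood of H whose closure lies in [G0], the region where walks starting off H are
   confined. *)
have [||N [N' [oN oN' HN GN' NN']]] := lindelof_separate Kn_compact Kn_cover closed_H
    (open_closedC oG).
- move=> P HP; apply: separate_at_H => //; first exact: open_closedC.
  by apply/seteqP; split=> // Q [nGQ HQ]; apply: nGQ; exact: HG.
- by move=> P nGP; apply: regular_H => /HG.
have NG P : closure N P -> G0 P.
  move=> cNP; apply: contrapT => nG.
  have [Q NQ N'Q] := (closure_openP _ _).1 cNP _ oN' (GN' _ nG).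
  exact: disjoint_not NN' NQ N'Q.
(* Everything outside [N] is put into the class [Z]. Points outside [G0] then have neighbourhoods
   with closure in [Z], so nothing has to be known about walks in that region. *)
pose Y0 := S `|` ~` N.
have cY0 : closed Y0 by apply: closedU => //; exact: open_closedC.
have Y0H : Y0 `&` H = set0.
  apply/seteqP; split=> // P [[SP|nNP] HP]; last by apply: nNP; exact: HN.
  exact: disjoint_not SH SP HP.
pose Z := sat Y0.
have SZ : S `<=` Z by move=> P SP; apply: sub_sat; left.
have NZ P : ~ N P -> Z P by move=> nNP; apply: sub_sat; right.
have ZH : Z `&` H = set0.
  apply/seteqP; split=> // P [ZP HP]; have [Q YQ HQ] := sat_meets sat_H ZP HP.
  exact: disjoint_not Y0H YQ HQ.
have sat_Z P Q : insep P Q -> Z P -> Z Q by exact: sat_saturated.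
have near_off_G P : ~ G0 P -> exists U, [/\ open U, U P & closure U `<=` Z].
  move=> nGP; exists (~` closure N); split.
  - by apply: closed_openC; exact: closed_closure.
  - by move=> /NG.
  - move=> Q cQ; apply: NZ => NQ.
    have [Q' nc NQ'] := (closure_openP _ _).1 cQ _ oN NQ.
    by apply: nc; exact: subset_closure.
have off_G_Z P : ~ G0 P -> Z P.
  by move=> nGP; have [U [_ UP UZ]] := near_off_G P nGP; apply: UZ; exact: subset_closure.
have cZ : closed Z.
  move=> P cP; have [GP|] := pselect (G0 P); last exact: off_G_Z.
  by apply: sat_closed_in => //; left.
pose rho P Q := [\/ insep P Q, H P /\ H Q | Z P /\ Z Q].
have rho_sym P Q : rho P Q -> rho Q P.
  by case=> [/insep_sym|[]|[]]; [constructor 1|constructor 2|constructor 3].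
have closedP (F : set (sat_space rho)) : closed F <->
    closed (F : set T) /\ forall P Q, rho P Q -> F P -> F Q.
  split=> [/closed_openC /sat_space_openP [oF sF]|[cF sF]].
    split; first by rewrite -[F]setCK; exact: (@open_closedC T).
    move=> P Q PQ FP; apply: contrapT => nFQ.
    exact: sF (rho_sym _ _ PQ) nFQ FP.
  rewrite -[F]setCK; apply: open_closedC; apply/sat_space_openP; split.
    exact: (@closed_openC T).
  by move=> P Q PQ nFP FQ; apply: nFP; exact: sF (rho_sym _ _ PQ) FQ.
(* Outside [G0] a neighbourhood has its closure in the class [Z], which F avoids; at points of H
   [separate_at_H] applies; in [G0] off H the compact set [C] of a confined neighbourhood is
   used. *)
have points (F : set T) P : closed F -> (forall P Q, rho P Q -> F P -> F Q) ->
    ~ F P -> exists U, [/\ open U, U P & closure U `&` F = set0].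
  move=> cF sF nFP.
  have [GP|nGP] := pselect (G0 P); last first.
    have [U [oU UP UZ]] := near_off_G P nGP; exists U; split=> //.
    apply/seteqP; split=> // Q [/UZ ZQ FQ]; apply: nFP; apply: sF FQ.
    by constructor 3; split=> //; exact: off_G_Z.
  have [HP|nHP] := pselect (H P).
    apply: separate_at_H => //; apply/seteqP; split=> // Q [FQ HQ].
    by apply: nFP; apply: sF FQ; constructor 2.
  have [U [C cUC] UP] := GP; have [oU kC cC _] := cUC.
  have [|V [W [oV oW VP CW VW]]] := @separate_compact T P _ (compact_closedI kC cF).
    by move=> Q [_ FQ] PQ; apply: nFP; apply: sF FQ; constructor 1; exact: insep_sym.
  exists (V `&` (U `\` H)); split=> //.
    by apply: openI => //; apply: openI => //; exact: closed_openC.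
  apply/seteqP; split=> // Q [cQ FQ].
  have CQ : C Q.
    apply: (closure_minimal cC _ cQ) => Q' [_ [UQ' nHQ']].
    exact: (confined_all cUC UQ' nHQ' (erefl : iwalk 0%N Q' Q')).
  have [Q' [VQ' _] WQ'] := (closure_openP _ _).1 cQ _ oW (CW _ (conj CQ FQ)).
  exact: disjoint_not VW VQ' WQ'.
have shrink (F U : set T) : closed F -> (forall P Q, rho P Q -> F P -> F Q) ->
    open U -> F `<=` U -> exists V : set (sat_space rho), [/\ open V, F `<=` V & V `<=` U].
  move=> cF sF oU FU.
  have [F1 [cF1 UF1 F1H _ F1E]] := absorb_closed (open_closedC oU) closed_H.
  have [F2 [cF2 F12 F2Z F2s F2E]] := absorb_closed cF1 cZ.
  have F2H : F2 `&` H = set0 \/ H `<=` F2.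
    case: F1H => [F1H|HF]; last by right=> P /HF /F12.
    left; apply/seteqP; split=> // P [/F2s [F1P|ZP] HP].
      exact: disjoint_not F1H F1P HP.
    exact: disjoint_not ZH ZP HP.
  have sat_F2 P Q : rho P Q -> sat F2 P -> sat F2 Q.
    case=> [PQ|[HP HQ]|[ZP ZQ]] sP.
    - exact: sat_saturated PQ sP.
    - have [S' F2S HS] := sat_meets sat_H sP HP.
      case: F2H => [F2H|HF2]; last by apply: sub_sat; exact: HF2.
      by case: (disjoint_not F2H F2S HS).
    - have [S' F2S ZS] := sat_meets sat_Z sP ZP.
      case: F2Z => [F2Z|ZF2]; last by apply: sub_sat; exact: ZF2.
      by case: (disjoint_not F2Z F2S ZS).
  have csat : closed (sat F2).
    move=> P cP; have [GP|nGP] := pselect (G0 P); first exact: sat_closed_in.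
    have [V [oV VP VZ]] := near_off_G P nGP.
    have [Q sQ VQ] := (closure_openP _ _).1 cP V oV VP.
    apply: sat_F2 sQ; constructor 3; split; last exact: off_G_Z.
    by apply: VZ; exact: subset_closure.
  exists (~` sat F2); split.
  - apply/sat_space_openP; split; first exact: (@closed_openC T).
    by move=> P Q /rho_sym QP nP sQ; apply: nP; exact: sat_F2 QP sQ.
  - move=> P FP [Q F2Q w].
    have FQ : F Q.
      by apply: (iwalk_sat _ w FP) => P' Q' PQ'; apply: sF; constructor 1.
    have F1F Q' : F1 Q' -> ~ F Q'.
      move=> /F1E [nUQ /FU //|[Q1 nU1 [HQ1 HQ']] FQ'].
      by apply: nU1; apply: FU; apply: sF FQ'; constructor 2.
    case: (F2E _ F2Q) => [/F1F//|[Q1 F1Q1 [ZQ1 ZQ]]].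
    by apply: (F1F Q1) => //; apply: sF FQ; constructor 3.
  - move=> P nP; apply: contrapT => nUP; apply: nP.
    by apply: sub_sat; apply: F12; exact: UF1.
have normal : normal_space (sat_space rho).
  apply/(@normal_openP R) => A B /closedP [cA sA] /closedP [cB sB] AB.
  have [||U [V [oU oV AU BV UV]]] := lindelof_separate Kn_compact Kn_cover cA cB.
  - by move=> P AP; apply: points => // BP; exact: disjoint_not AB AP BP.
  - by move=> P BP; apply: points => // AP; exact: disjoint_not AB AP BP.
  have [U' [oU' AU' UU']] := shrink A U cA sA oU AU.
  have [V' [oV' BV' VV']] := shrink B V cB sB oV BV.
  exists U', V'; split=> //; apply/seteqP; split=> // P [/UU' UP /VV' VP].
  exact: disjoint_not UV UP VP.
have cHs : closed (H : set (sat_space rho)).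
  apply/closedP; split=> // P Q [PQ HP|[]|[ZP _] HP] //; first exact: sat_H PQ HP.
  by case: (disjoint_not ZH ZP HP).
have cZs : closed (Z : set (sat_space rho)).
  apply/closedP; split=> // P Q [PQ ZP|[HP _] ZP|[]] //; first exact: sat_Z PQ ZP.
  by case: (disjoint_not ZH ZP HP).
have sep := normal_separatorP.1 normal _ _ cZs cHs ZH.
have [f [cf f01 fZ fH]] := (@uniform_separatorP _ R _ _).1 (sep R).
exists f; split.
- apply/continuousP => B oB.
  by have /sat_space_openP [] := (continuousP f).1 cf B oB.
- by move=> P; have := f01 (f P) (imageT f P); rewrite /= in_itv.
- by move=> P HP; apply: fH; exists P.
- by move=> P /SZ ZP; apply: fZ; exists P.
Qed.

End Urysohn.

(** * Local modularity implies strict closedness *)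

Section SigmaUnital.
Variables (R : realType) (A : cstarAlgType R).

Lemma pos_positive (a : A) : positive a -> pos (mulin a).
Proof. by move=> [b ->]; rewrite mulinM mulin_star; exact: pos_starM. Qed.

Definition increasing_unit (u : nat -> A) := [/\ approximate_unit u,
  forall n, pos (mulin (u n)) & forall n m, (n <= m)%N -> pos (mulin (u m - u n))].

Lemma sigma_unital_increasing : sigma_unital A -> exists u, increasing_unit u.
Proof.
move=> [u [u1 du ul ur]]; exists u; split; first split.
- by move=> n; have [_] := u1 n; rewrite rnE lecR.
- by move=> a; apply/scvgP; exact: ul.
- by move=> a; apply/scvgP; exact: ur.
- by move=> n; apply: pos_positive; case: (u1 n).
- move=> n m /subnK <-; elim: (m - n)%N => [|k IH].
    by rewrite add0n subrr mulin0; exact: pos0.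
  rewrite addSn (_ : _ - _ = (u (k + n).+1 - u (k + n)%N) + (u (k + n)%N - u n)).
    by rewrite mulinD; apply: posD => //; exact: pos_positive.
  by rewrite addrA subrK.
Qed.

(** Since u n acts on a fixed vector as almost the identity for large n, its norm there exceeds 1/2.
    Together with [attains_compact] this makes Prim(A) sigma-compact. *)
Lemma approximate_unit_cover u (P : Prim A) : approximate_unit u ->
  exists n, attains P (u n) 2^-1.
Proof.
move=> unit_u; have [H [dot [pi [rho [irr PE _ _ [_ ux]]]]]] := prim_ext unit_u P.
have [dxx rep [[a [x0 ax0]] _]] := irr; have x0n : x0 != 0.
  by apply: contraNneq ax0 => ->; rewrite (rep0r rep).
have x0p := rn_gt0 x0n.
have [|n /(_ n (leqnn n)) un] := ux x0 (2^-1 * rn x0); first by rewrite mulr_gt0.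
exists n; exists H, dot, pi; split=> //; exists x0 => //.
by have := rn_subl x0 (pi (u n) x0); rewrite rnBC; lra.
Qed.

Lemma walk_iwalk n (P Q : Prim A) : walk n P Q <-> iwalk n P Q.
Proof. by elim: n P => [|n IH] P //=. Qed.

Lemma iwalk_pad (T : topologicalType) (n m : nat) (P Q : T) : (n <= m)%N ->
  iwalk n P Q -> iwalk m P Q.
Proof.
move=> /subnK <-; elim: (m - n)%N => [//|k IH] /IH w.
by exists P => //; exact: insep_refl.
Qed.

(** Padding by reflexivity of [insep] turns a walk of length at most k into one of length exactly k,
    the form used by the topological part. *)
Lemma Orc_walk_bound : (Orc A < +oo)%E ->
  exists k, forall n (P Q : Prim A), iwalk n P Q -> iwalk k P Q.
Proof.
move=> fin.
have [k Ok] : exists k : nat, (Orc A <= (k%:R : R)%:E)%E.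
  case: (Orc A) fin => [r| |] // _; last by exists 0%N; rewrite leNye.
  exists (Num.truncn r).+1; rewrite lee_fin ltW //; exact: truncnS_gt.
exists k => n P Q w.
have cQ : component P Q by exists n; exact/walk_iwalk.
have cP : component P P by exists 0%N.
have : (diameter (component P) <= (k%:R : R)%:E)%E.
  by apply: le_trans Ok; apply: ereal_sup_ubound; exists P.
(* In a singleton component both ends agree, and the walk of length 0 is padded. *)
rewrite /diameter; case: asboolP => [[P' PE] _|_ dk].
  by move: cP cQ; rewrite PE => /= -> ->; apply: (@iwalk_pad _ 0%N).
(* A strict bound k + 1 on the infimum is met by an actual walk, whose length is then at most k. *)
have lt : (connecting_dist P Q < (k.+1%:R : R)%:E)%E.
  apply: (@le_lt_trans _ _ (k%:R%:E)%E); last by rewrite lte_fin ltr_nat.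
  apply: le_trans dk; apply: ereal_sup_ubound.
  by exists (P, Q).
have [_ [m wm <-]] := ereal_inf_lt lt.
rewrite lte_fin ltr_nat ltnS => mk; apply: iwalk_pad mk _; exact/walk_iwalk.
Qed.

End SigmaUnital.

Section LocalModularity.
Variables (R : realType) (A : cstarAlgType R).
Implicit Types (P Q : Prim A) (V : set (Prim A)).

Lemma ker_closure V Q : closure V Q -> ker V `<=` ideal_of Q.
Proof.
move=> /closure_openP cQ a ka; apply: contrapT => nQa.
have [P VP nPa] := cQ _ (@prim_open_notin1 _ _ a) nQa.
by apply: nPa; exact: ka.
Qed.

Lemma unit_mod_rep P e (H : completeNormedModType R[i])
    (dot : {dot H for Num.conj}) (pi : A -> H -> H) :
  irreducible_rep dot pi -> ideal_of P = [set a | forall x, pi a x = 0] ->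
  (forall a, ideal_of P (e ** a - a)) -> forall x, pi e x = x.
Proof.
move=> irr PE he x; have [dxx rep _] := irr.
suff LT : [set x | pi e x - x = 0] = setT.
  have : [set x | pi e x - x = 0] x by rewrite LT.
  by move=> /eqP; rewrite subr_eq0 => /eqP.
apply: (irreducible_full irr).
  apply: (@closed_subspace_ker _ _ H (fun x => pi e x - x) (rn e + 1)).
    by move=> k y z /=; rewrite (repDr rep) (repZr rep) scalerBr addrACA opprD.
  move=> y; apply: (le_trans (rnB _ _)); rewrite mulrDl mul1r lerD2r.
  exact: rep_contractive.
move=> a y /=; rewrite -(repM rep) -(repB rep).
by have := he a; rewrite PE; apply.
Qed.

Lemma irreducible_nontrivial (H : completeNormedModType R[i])
    (dot : {dot H for Num.conj}) (pi : A -> H -> H) :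
  irreducible_rep dot pi -> exists x : H, x != 0.
Proof.
move=> [_ rep [[a [x ax]] _]]; exists x.
by apply: contraNneq ax => ->; rewrite (rep0r rep).
Qed.

Lemma unit_mod_attains V e P : (forall a, ker V (e ** a - a)) ->
  closure V P -> attains P e 1.
Proof.
move=> he cP; have [H [dot [pi [irr PE]]]] := prim_rep P.
have [x x0] := irreducible_nontrivial irr.
exists H, dot, pi; split=> //; exists x => //.
rewrite (unit_mod_rep irr PE) ?mul1r // => a.
exact: ker_closure cP _ (he a).
Qed.

(** An element that is a unit modulo [ker V] acts as the identity at every point of the closure of
    V, hence attains norm 1 there. *)
Lemma unit_mod_compact V e : (forall a, ker V (e ** a - a)) ->
  compact (closure V).
Proof.
move=> he; apply: (subclosed_compact (@closed_closure _ V)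
  (attains_compact (a := e) ltr01)) => P.
exact: unit_mod_attains.
Qed.

End LocalModularity.

Section HullOver.
Variables (R : realType) (A : cstarAlgType R) (X : topologicalType).
Variables (phi : Prim A -> X) (E : set (image_space phi)).
Hypothesis X_locally_compact : locally_compact [set: X].
Hypothesis X_hausdorff : hausdorff_space X.
Hypothesis phi_continuous : continuous phi.
Hypothesis E_closed : closed E.
Implicit Types (P Q : Prim A).

Lemma corestriction_continuous : continuous (corestriction phi).
Proof.
apply/continuousP => B [V oV <-].
exact: (continuousP phi).1.
Qed.

Lemma hull_over_closed : closed (hull_over E).
Proof. by apply: closed_comp => // P _; exact: corestriction_continuous. Qed.

Lemma insep_image P Q : insep P Q -> corestriction phi P = corestriction phi Q.
Proof.
move=> PQ; apply: val_inj => /=; apply: X_hausdorff => U V.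
rewrite !nbhsE => -[U' [oU UP] U'U] [V' [oV VQ] V'V].
have [S US VS] := insep_meet PQ ((continuousP phi).1 phi_continuous _ oU)
  ((continuousP phi).1 phi_continuous _ oV) UP VQ.
by exists (phi S); split; [exact: U'U|exact: V'V].
Qed.

Lemma hull_over_sat P Q : insep P Q -> hull_over E P -> hull_over E Q.
Proof. by rewrite /hull_over /= => /insep_image ->. Qed.

Lemma hull_over_regular Q : ~ hull_over E Q ->
  exists U, [/\ open U, U Q & closure U `&` hull_over E = set0].
Proof.
move=> nQ; have nE : ~ closure E (corestriction phi Q).
  by rewrite (closureE_closed E_closed).
have [f [[cf _] [fQ fE]]] := image_space_separate X_locally_compact X_hausdorff nE.
have cfp : continuous (f \o phi).
  by move=> P; apply: continuous_comp; [exact: phi_continuous|exact: cf].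
exists ((f \o phi) @^-1` [set t | t < 2^-1]); split.
- by apply: open_comp => [P _|]; [exact: cfp|exact: open_lt].
- by rewrite /= [f _]fQ invr_gt0.
- apply/seteqP; split=> // P [cP HP].
  have : ((f \o phi) @^-1` [set t | t <= 2^-1]) P.
    apply: (closure_minimal _ _ cP); last by move=> P' /ltW.
    by apply: closed_comp => [P' _|]; [exact: cfp|exact: closed_le].
  by have := fE _ HP; rewrite /= => ->; lra.
Qed.

(** Translates local modularity into the compactness assumption of the Urysohn argument. At interior
    points of the hull the set in question is empty. *)
Lemma modular_compact_off P : locally_modular E -> hull_over E P ->
  exists U, [/\ open U, U P & compact (closure (U `\` hull_over E))].
Proof.
move=> lm HP; have [iP|niP] := pselect ((hull_over E)° P).
  exists (hull_over E)°; split=> //; first exact: open_interior.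
  rewrite (_ : _ `\` _ = set0) ?closure0; first exact: compact0.
  by apply/seteqP; split=> // Q [/interior_subset].
have [|V [[U oU VE] VP [e he]]] := lm P.
  by split=> //; exact: subset_closure.
exists U; split=> //; first by move: VP; rewrite VE => -[].
have cV : compact (closure V) by apply: (@unit_mod_compact _ _ V e) => a; case: (he a).
apply: (subclosed_compact (@closed_closure _ _) cV); apply: closureS.
move=> Q [UQ nHQ]; rewrite VE; split=> //.
by move=> /interior_subset.
Qed.

End HullOver.

Section MultiplierIdeal.
Variables (R : realType) (A : cstarAlgType R) (X : topologicalType).
Variables (phi : Prim A -> X) (phibar : Prim (multiplier A) -> stone_cech R X).
Variable E : set (image_space phi).
Hypothesis X_locally_compact : locally_compact [set: X].
Hypothesis X_hausdorff : hausdorff_space X.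
Hypothesis phi_continuous : continuous phi.
Hypothesis phibar_continuous : continuous phibar.
Hypothesis phibar_extends : forall (P : Prim A) (Q : Prim (multiplier A)),
       ideal_of Q = ideal_tilde (ideal_of P) ->
       phibar Q = to_stone_cech R (phi P).
Hypothesis E_closed : closed E.
Variable u : nat -> A.
Hypothesis unit_u : approximate_unit u.
Implicit Types (P : Prim A) (Q : Prim (multiplier A)) (b : multiplier A).
Local Notation H := (hull_over E).
Local Notation J := (ideal_over E).

Lemma multiplier_ideal_sub : multiplier_ideal_over phibar E `<=` ideal_tilde J.
Proof.
move=> b Hb a; suff h P : H P -> ideal_of P (lmult b a) /\ ideal_of P (rmult a b).
  by split=> P HP; case: (h P HP).
move=> HP; have [Q QE] := tilde_prim unit_u P.
have : ideal_of Q b.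
  apply: Hb; rewrite /= (phibar_extends QE).
  by exists (phi P) => //; exists (corestriction phi P).
by rewrite QE; apply.
Qed.

Lemma tilde_over b P : ideal_tilde J b -> H P -> ideal_tilde (ideal_of P) b.
Proof. by move=> Jb HP a; have [l r] := Jb a; split; [exact: l|exact: r]. Qed.

(** If b is outside, then ba or ab is outside I for some a, at a positive distance from it; the
    corresponding seminorm ball around b is strictly open and avoids the set. *)
Lemma strict_ball_closed (I : set A) : closed I ->
  closed (ideal_tilde I : set (strict A)).
Proof.
move=> cI; apply: closed_of_nbhs => b nb.
have ball (y : A) : ~ I y -> exists2 e : R, 0 < e & forall z, rn (z - y) < e -> ~ I z.
  move=> nI; apply: contrapT => no; apply: nI.
  have /boolp.choice [z zP] : forall n : nat, exists z : A, rn (z - y) < n.+1%:R^-1 /\ I z.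
    move=> n; apply: contrapT => no'; apply: no; exists n.+1%:R^-1; first by rewrite invr_gt0.
    by move=> z lt Iz; apply: no'; exists z.
  apply: (closed_scvg cI (u := z)); first by move=> n; case: (zP n).
  move=> e e0; have [N NP] := exists_invS_lt e0; exists N => n Nn.
  by apply: (lt_trans (zP n).1); exact: NP.
have nbr_open (U : set (strict A)) : strict_subbase U -> open U.
  by move=> sU; exists [set U]; [move=> V ->; exact: finI_from1|rewrite bigcup_set1].
suff [U sU [Ub UI]] : exists2 U : set (strict A), strict_subbase U &
    U b /\ forall c, U c -> ~ ideal_tilde I c.
  exists U; split; [exact: nbr_open|exact: Ub|].
  by apply/seteqP; split=> // c [Uc Ic]; case: (UI c Uc).
have [a /not_andP [/ball|/ball]] := (existsNP _).2 nb.
- move=> [e e0 eP]; exists [set c | `|lmult (c - b) a| < e%:C].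
    by exists b, a, e%:C; split; [rewrite ltcR|left].
  split; first by rewrite /= lmultBl subrr normr0 ltcR.
  move=> c /=; rewrite rnE ltcR lmultBl => /eP nI Ic; apply: nI.
  by case: (Ic a).
- move=> [e e0 eP]; exists [set c | `|rmult a (c - b)| < e%:C].
    by exists b, a, e%:C; split; [rewrite ltcR|right].
  have rB c : rmult a (c - b) = rmult a c - rmult a b.
    by rewrite !rmultE starB lmultBl starB.
  split; first by rewrite /= rB subrr normr0 ltcR.
  move=> c /=; rewrite rB rnE ltcR => /eP nI Ic; apply: nI.
  by case: (Ic a).
Qed.

Lemma ideal_over_closed : closed J.
Proof. by apply: closed_bigI => P _; exact: prim_closed. Qed.

(* [exceeds h e] is where the image of [h] in [M(A) / P~] is not at most [e]. *)
Definition exceeds h (e : R) : set (Prim A) := [set P | exists2 Q,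
  ideal_of Q = ideal_tilde (ideal_of P) & ~ bounded_at Q h e].

Lemma exceeds_rep h e P (H : completeNormedModType R[i])
    (dot : {dot H for Num.conj}) (rho : multiplier A -> H -> H) :
  star h = h -> irreducible_rep dot rho -> ideal_tilde (ideal_of P) = [set b | forall x, rho b x = 0] ->
  exceeds h e P -> exists x, e * rn x ^+ 2 < redot dot (rho h x) x.
Proof.
move=> hs irr PE [Q QE nb]; apply: contrapT => no; apply: nb.
apply: (bounded_at_rep hs irr); first by rewrite QE.
by move=> x; rewrite leNgt; apply/negP => lt; apply: no; exists x.
Qed.

(** A local unit [e0] turns a lower bound on the multiplier h modulo P~ into one on the element h e0
    of A modulo P, where [attains_compact] is available. *)
Lemma exceeds_attains h e V e0 P : star h = h -> (forall a, ker V (e0 ** a - a)) ->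
  closure V P -> exceeds h e P -> attains P (lmult h e0) e.
Proof.
move=> hs he cP ex.
have [K [dot [pi [rho [irr PE irr' PE' [rp _]]]]]] := prim_ext unit_u P.
have [x lt] := exceeds_rep hs irr' PE' ex.
have ex0 : pi e0 x = x.
  apply: (unit_mod_rep irr PE) => a; exact: ker_closure cP _ (he a).
exists K, dot, pi; split=> //.
have [dxx rep' _] := irr'.
have x0 : x != 0.
  by apply: contraTneq lt => ->; rewrite (rep0r rep') redot0l rn0 expr0n mulr0 ltxx.
exists x => //; rewrite -rp -smul_mulin (repM rep') rp ex0.
have xp := rn_gt0 x0; rewrite -(ler_pM2r xp) -mulrA -expr2.
by apply: (le_trans (ltW lt)); exact: redot_le.
Qed.

(** Near a boundary point P with local unit f, the set lies in the compact set of points in the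
    closure of V where b^* b f attains e. Since b^* b f is in J_E and the hull is saturated, no
    point of that compact set is inseparable from P, so a neighbourhood of P avoids it. *)
Lemma exceeds_off_hull b e : 0 < e -> locally_modular E -> ideal_tilde J b ->
  closure (exceeds (star b ** b) e) `&` H = set0.
Proof.
move=> e0 lm Jb.
have off P : exceeds (star b ** b) e P -> ~ H P.
  move=> [Q QE nb] HP; apply: nb => K dot rho irr QE' x.
  have : ideal_of Q b by rewrite QE; exact: tilde_over.
  rewrite QE' => bx; have [_ rep _] := irr.
  by rewrite (repM rep) bx (rep0r rep) redot0l; apply: mulr_ge0; [exact: ltW|exact: exprn_ge0 (rn_ge0 x)].
apply/seteqP; split=> // P [cP HP].
have [iP|niP] := pselect (H° P).
  have [Q exQ HQ] := (closure_openP _ _).1 cP _ (@open_interior _ _) iP.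
  by apply: (off Q) => //; exact: interior_subset.
have [|V [[U oU VE] VP [f hf]]] := lm P.
  by split=> //; exact: subset_closure.
have hl a : ker V (f ** a - a) by case: (hf a).
set a := lmult (star b ** b) f.
have kK : compact (closure V `&` [set Q | attains Q a e]).
  by rewrite setIC; apply: compact_closedI; [exact: attains_compact|exact: closed_closure].
have [|N1 [N2 [oN1 oN2 N1P KN2 N12]]] := separate_compact (P := P) kK.
  move=> Q [_ aQ] PQ; apply: (attains_notin e0 aQ).
  rewrite /a lmultMl; apply: (prim_mult (star b) _).1.
  exact: (Jb f).1 _ (hull_over_sat X_hausdorff phi_continuous PQ HP).
have UP : U P by move: VP; rewrite VE => -[].
have [Q exQ [UQ N1Q]] := (closure_openP _ _).1 cP _ (openI oU oN1) (conj UP N1P).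
apply: (disjoint_not N12 N1Q); apply: KN2.
have cQ : closure V Q.
  apply: subset_closure; rewrite VE; split=> // iQ.
  by apply: (off Q) => //; exact: interior_subset.
by split=> //; apply: (@exceeds_attains (star b ** b) e V f Q) => //; rewrite starM starK.
Qed.

Lemma creg_map_surj (q : creg R (Prim A)) : exists c, q = creg_map R c.
Proof. by exists (repr q); rewrite /creg_map reprK. Qed.

Lemma creg_induced_continuous f : continuous (@creg_induced R (Prim A) f).
Proof.
move=> q V Vq; have /cvg_sup /(_ f) h : nbhs q --> q by exact: cvg_id.
apply: h; exact: (@initial_continuous (creg R (Prim A)) R (creg_induced f) q V).
Qed.

Variable psi : creg R (Prim A) -> image_space phi.
Hypothesis psi_factor : forall P, corestriction phi P = psi (creg_map R P).
Hypothesis Orc_finite : (Orc A < +oo)%E.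

Lemma exceeds_image b e x : 0 < e -> locally_modular E -> locally_closed_at psi E ->
  ideal_tilde J b -> E x -> ~ closure (corestriction phi @` exceeds (star b ** b) e) x.
Proof.
move=> e0 lm lc Jb Ex cx.
have [k wk] := Orc_walk_bound Orc_finite.
have [f [cf f01 fH fW]] : exists f : Prim A -> R, [/\ continuous f,
    forall P, 0 <= f P <= 1, forall P, H P -> f P = 1 &
    forall P, closure (exceeds (star b ** b) e) P -> f P = 0].
  apply: (@separating_function R _ (fun n => [set P | attains P (u n) 2^-1]) _ _ k).
  - by move=> n; apply: attains_compact; rewrite invr_gt0.
  - by move=> P; exact: approximate_unit_cover.
  - exact: wk.
  - exact: hull_over_closed.
  - by move=> P Q; exact: hull_over_sat.
  - by move=> Q; exact: hull_over_regular.
  - by move=> P; exact: modular_compact_off.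
  - exact: closed_closure.
  - exact: exceeds_off_hull.
have bf : bounded_continuous f.
  split=> //; exists 1; split; first exact: num_real.
  move=> M M1 P _; have /andP[f0 f1] := f01 P.
  by rewrite /= ger0_norm //; exact: le_trans f1 (ltW M1).
pose g := exist _ f bf : {f : Prim A -> R | bounded_continuous f}.
pose W := closure [set creg_map R P | P in exceeds (star b ** b) e].
have gW q : W q -> creg_induced g q = 0.
  move=> Wq; have : (creg_induced g @^-1` [set 0]) q.
    apply: (closure_minimal _ _ Wq).
      apply: closed_comp => [q' _|]; first exact: creg_induced_continuous.
      exact: closed_eq.
    move=> _ [P exP <-]; apply: (etrans (creg_inducedE g P)); apply: fW.
    exact: subset_closure.
  by [].
have WE : psi @` W `&` E = set0.
  apply/seteqP; split=> // _ [[q Wq <-] Eq].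
  have [c qc] := creg_map_surj q; have := gW q Wq; rewrite qc creg_inducedE /=.
  rewrite fH; first by move/eqP; rewrite oner_eq0.
  by rewrite /hull_over /= psi_factor -qc.
have := lc W (@closed_closure _ _) WE.
suff cl : closure (psi @` W) x by move=> d; exact: disjoint_not d cl Ex.
apply: closureS cx => _ [P exP <-]; rewrite psi_factor.
by exists (creg_map R P) => //; apply: subset_closure; exists P.
Qed.

Lemma strictly_closed_of_modular : locally_modular E -> locally_closed_at psi E ->
  closed (multiplier_ideal_over phibar E : set (strict A)).
Proof.
move=> lm lc.
have -> : multiplier_ideal_over phibar E = ideal_tilde J; last first.
  by apply: strict_ball_closed; exact: ideal_over_closed.
apply/seteqP; split; first exact: multiplier_ideal_sub.
move=> b Jb Q [_ [x Ex <-] Qx].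
apply: (criterion unit_u X_locally_compact X_hausdorff phibar_continuous
  phibar_extends (esym Qx)) => e e0.
exists (exceeds (star b ** b) e); split; first exact: exceeds_image.
move=> P Q' QE nex; apply: contrapT => nb; apply: nex; by exists Q'.
Qed.

End MultiplierIdeal.

(** * Strict closedness implies local modularity *)

Section StrictlyClosed.
Variables (R : realType) (A : cstarAlgType R) (X : topologicalType).
Variables (phi : Prim A -> X) (phibar : Prim (multiplier A) -> stone_cech R X).
Variable E : set (image_space phi).
Hypothesis X_locally_compact : locally_compact [set: X].
Hypothesis X_hausdorff : hausdorff_space X.
Hypothesis phi_continuous : continuous phi.
Hypothesis phibar_continuous : continuous phibar.
Hypothesis phibar_extends : forall (P : Prim A) (Q : Prim (multiplier A)),
       ideal_of Q = ideal_tilde (ideal_of P) ->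
       phibar Q = to_stone_cech R (phi P).
Variable u : nat -> A.
Hypothesis unit_u : approximate_unit u.
Implicit Types (P : Prim A) (Q : Prim (multiplier A)) (b : multiplier A).
Local Notation H := (hull_over E).
Local Notation J := (ideal_over E).

Lemma exceeds_mulin a t P : 0 < t -> star a = a -> exceeds (mulin a) t P ->
  attains P a t.
Proof.
move=> t0 sa ex.
have [K [dot [pi [rho [irr PE irr' PE' [rp _]]]]]] := prim_ext unit_u P.
have [|x lt] := exceeds_rep _ irr' PE' ex; first by rewrite -mulin_star sa.
exists K, dot, pi; split=> //.
have [dxx rep _] := irr; rewrite rp in lt.
have x0 : x != 0.
  by apply: contraTneq lt => ->; rewrite (rep0r rep) redot0l rn0 expr0n mulr0 ltxx.
exists x => //; rewrite -(ler_pM2r (rn_gt0 x0)) -mulrA -expr2.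
by apply: (le_trans (ltW lt)); exact: redot_le.
Qed.

Lemma image_space_hausdorff : hausdorff_space (image_space phi).
Proof.
move=> x y xy; apply: val_inj; apply: X_hausdorff => U V Ux Vy.
have c : continuous (set_val : image_space phi -> X) by exact: initial_continuous.
by have [z [Uz Vz]] := xy _ _ (c x U Ux) (c y V Vy); exists (set_val z).
Qed.

(** The points where j^* j attains e form a compact set, whose image in the Hausdorff space X_phi is
    closed. It misses E because j vanishes on the hull, so [criterion] applies. *)
Lemma mulin_ideal_over j : J j -> multiplier_ideal_over phibar E (mulin j).
Proof.
move=> Jj Q [_ [x Ex <-] Qx].
apply: (criterion unit_u X_locally_compact X_hausdorff phibar_continuous
  phibar_extends (esym Qx)) => e e0.
pose K := [set P : Prim A | attains P (star j ** j) e].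
have cK : closed (corestriction phi @` K).
  apply: compact_closed; first exact: image_space_hausdorff.
  apply: continuous_compact; last exact: attains_compact.
  exact/continuous_subspaceT/corestriction_continuous.
exists (exceeds (star (mulin j) ** mulin j) e); split; last first.
  by move=> P Q' QE nex; apply: contrapT => nb; apply: nex; exists Q'.
move=> cx; have : (corestriction phi @` K) x.
  apply: (closure_minimal cK _ cx) => _ [P exP <-]; exists P => //.
  apply: exceeds_mulin => //; first by rewrite starM starK.
  by rewrite mulinM mulin_star.
move=> [P aP Px]; apply: (attains_notin e0 aP).
apply: (prim_ideal (star j) _).2; apply: Jj.
by rewrite /hull_over /= Px.
Qed.

Lemma exceeds_mult_attains h t Q : 0 < t -> ~ bounded_at Q h t -> attains Q h t.
Proof.
move=> t0 nb; apply: contrapT => na; apply: nb => K dot rho irr QE x.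
rewrite leNgt; apply/negP => lt; apply: na; exists K, dot, rho; split=> //.
have [dxx rep _] := irr.
have x0 : x != 0.
  by apply: contraTneq lt => ->; rewrite (rep0r rep) redot0l rn0 expr0n mulr0 ltxx.
exists x => //; rewrite -(ler_pM2r (rn_gt0 x0)) -mulrA -expr2.
by apply: (le_trans (ltW lt)); exact: redot_le.
Qed.

(** In Prim(M(A)) the ideals where b attains t form a compact set, none of whose points lies over x.
    Each has a Stone-Cech coordinate separating it from x; a finite subcover then yields one
    neighbourhood of x in X_phi over which no P~ belongs to the compact set. *)
Lemma exceeds_no_limit b t x : 0 < t -> multiplier_ideal_over phibar E b -> E x ->
  ~ closure (corestriction phi @` exceeds b t) x.
Proof.
move=> t0 Hb Ex cx.
pose D := [set U : set (Prim (multiplier A)) | open U /\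
  exists V : set (image_space phi), [/\ open V, V x & forall P Q,
    phibar Q = to_stone_cech R (phi P) -> V (corestriction phi P) -> ~ U Q]].
have [||s [sD Ks]] := compact_subcover
    (attains_compact (a := b : multiplier A) t0) (D := D).
- by move=> U [].
- move=> Q aQ; have nQ : phibar Q <> to_stone_cech R (set_val x).
    move=> Qx; apply: (attains_notin t0 aQ); apply: Hb; rewrite /= Qx.
    by exists (set_val x) => //; exists x.
  have [f nf] : exists f, sval (phibar Q) f <> sval f (set_val x).
    apply: contrapT => no; apply: nQ; apply: val_inj; apply: funext => f.
    by apply: contrapT => nf; apply: no; exists f.
  have [cf _] := svalP f.
  pose r := `|sval (phibar Q) f - sval f (set_val x)| / 2.
  have r0 : 0 < r by rewrite divr_gt0 // normr_gt0 subr_eq0; exact/eqP.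
  pose g Q' := `|sval (phibar Q') f - sval f (set_val x)|.
  have cd : continuous (fun v : R => `|v - sval f (set_val x)|).
    by move=> v; apply: cvg_norm; apply: cvgB; [exact: cvg_id|exact: cvg_cst].
  have cg : continuous g.
    move=> Q'; apply: (@continuous_comp _ _ _ (fun Q' => sval (phibar Q') f)
      (fun v => `|v - sval f (set_val x)|)); last exact: cd.
    apply: (@continuous_comp _ _ _ phibar (fun z => sval z f)); first exact: phibar_continuous.
    exact: stone_cech_coord_continuous.
  exists (g @^-1` [set t | r < t]); last first.
    by rewrite /= /r /g ltr_pdivrMr // ltr_pMr ?normr_gt0 ?subr_eq0 ?ltr1n //; exact/eqP.
  split; first by apply: open_comp => [Q' _|]; [exact: cg|exact: open_gt].
  pose g' (y : image_space phi) := `|sval f (set_val y) - sval f (set_val x)|.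
  have cg' : continuous g'.
    move=> y; apply: (@continuous_comp _ _ _ (fun y : image_space phi => sval f (set_val y))
      (fun v => `|v - sval f (set_val x)|));
      last exact: cd.
    apply: (@continuous_comp _ _ _ (set_val : image_space phi -> X) (sval f)); last exact: cf.
    exact: initial_continuous.
  exists (g' @^-1` [set t | t < r]); split.
  - by apply: open_comp => [y _|]; [exact: cg'|exact: open_lt].
  - by rewrite /= /g' subrr normr0.
  - move=> P Q' QP; rewrite /= /g /g' QP /= => lt gt.
    by move: (lt_trans lt gt); rewrite ltxx.
have [V [oV Vx VU]] : exists V : set (image_space phi), [/\ open V, V x & forall P Q,
    phibar Q = to_stone_cech R (phi P) -> V (corestriction phi P) -> ~ union_of s Q].
  elim: s sD {Ks} => [|U s IH] /=.
    by move=> _; exists setT; split; [exact: openT|by []|move=> P Q _ _ []].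
  move=> [[_ [V [oV Vx VP]]] /IH [V' [oV' Vx' VP']]].
  exists (V `&` V'); split=> //; first exact: openI.
  by move=> P Q QP [VP1 VP2] [UQ|sQ]; [exact: VP QP VP1 UQ|exact: VP' QP VP2 sQ].
have [_ [P [Q QE nb] <-] VP] := (closure_openP _ _).1 cx V oV Vx.
apply: (VU P Q) VP _; first exact: phibar_extends.
by apply: Ks; exact: exceeds_mult_attains.
Qed.

Lemma strict_scvg (c : nat -> multiplier A) b (U : set (strict A)) : open U -> U b ->
  (forall a, scvg (fun n => lmult (c n) a) (lmult b a)) ->
  (forall a, scvg (fun n => rmult a (c n)) (rmult a b)) -> exists n, U (c n).
Proof.
move=> [D Dsub <-] [V DV Vb] cl cr.
have [F FS VE] := Dsub V DV.
suff cV : (c @ \oo) V by case: cV => N _ NP; exists N; exists V => //; exact: NP (leqnn N).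
move: Vb; rewrite -VE => Vb; apply: filter_bigI => S SF; have Vb' := Vb S SF.
have /set_mem [d [a [e [e0 SE]]]] := FS S SF.
have eE : e = (complex.Re e)%:C.
  by apply/eqP; rewrite eq_complex /= eqxx; move: e0; rewrite ltcE /= => /andP[].
have lip (x y z : A) : complex.Re e - rn (y - z) > 0 -> rn (x - y) < complex.Re e - rn (y - z) ->
    `|x - z| < e.
  move=> _ lt; rewrite rnE eE ltcR; apply: le_lt_trans (rn_triangle y _ _) _.
  by move: lt; rewrite ltrBrDr.
have rB d1 d2 : rmult a (d1 - d2) = rmult a d1 - rmult a d2.
  by rewrite !rmultE starB lmultBl starB.
case: SE => SE; move: Vb'; rewrite /isSubBaseTopological.b /= SE /=.
- rewrite rnE eE ltcR lmultBl -subr_gt0 => lt; have [N NP] := cl a _ lt.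
  exists N => // n /= Nn; rewrite -eE lmultBl; apply: lip lt _; exact: NP.
- rewrite rnE eE ltcR rB -subr_gt0 => lt; have [N NP] := cr a _ lt.
  exists N => // n /= Nn; rewrite -eE rB; apply: lip lt _; exact: NP.
Qed.

(** The elements b u_n lie in J_E, hence in H_E by [mulin_ideal_over], and converge strictly to
    b. *)
Lemma sub_strictly_closed b : closed (multiplier_ideal_over phibar E : set (strict A)) ->
  ideal_tilde J b -> multiplier_ideal_over phibar E b.
Proof.
move=> cH Jb; apply: contrapT => nHb.
have [_ ul ur] := unit_u.
have [||n] := strict_scvg (c := fun n => b ** mulin (u n)) (closed_openC cH) nHb.
- move=> a; apply: (@scvg_lip _ _ _ (lmult b) (rn b) (fun n => u n ** a)) (ul a).
  by move=> x y; rewrite -lmultB; exact: rn_lmult.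
- move=> a; apply: (ur (rmult a b)).
by apply; rewrite smul_mulin; apply: mulin_ideal_over; case: (Jb (u n)).
Qed.

End StrictlyClosed.

Section DenseSequence.
Variables (R : realType) (A : cstarAlgType R).

Lemma separable_sequence : separable A ->
  exists d : nat -> A, forall a (e : R), 0 < e -> exists n, rn (a - d n) < e.
Proof.
move=> [D [cD dD]]; have /countable_injP [f finj] := cD.
have /boolp.choice [d dP] : forall n, exists y : A, forall a, D a -> f a = n -> a = y.
  move=> n; have [[y Dy fy]|no] := pselect (exists2 a, D a & f a = n).
    by exists y => a Da fa; apply: finj; rewrite ?inE // fa fy.
  by exists 0 => a Da fa; case: no; exists a.
exists d => a e e0.
have [||x [/= ax Dx]] := dD [set x | `|a - x| < e%:C].
- exists a; by rewrite /= subrr normr0 ltcR.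
- suff -> : [set x | `|a - x| < e%:C] = ball a e%:C by apply: ball_open; rewrite ltcR.
  by rewrite -ball_normE.
- by exists (f x); rewrite -(dP _ _ Dx erefl) -ltcR -rnE.
Qed.

(** For each dense point d i and precision 1/(N+1), a point of J that close is picked if there is
    one, and 0 otherwise. *)
Lemma dense_sequence_in (J : set A) : separable A -> J 0 ->
  exists j : nat -> A, (forall n, J (j n)) /\
    forall a (e : R), J a -> 0 < e -> exists n, rn (a - j n) < e.
Proof.
move=> /separable_sequence [d dd] J0.
have /boolp.choice [y yP] : forall p : nat * nat, exists y : A, J y /\
    ((exists2 z, J z & rn (z - d p.1) < p.2.+1%:R^-1) -> rn (y - d p.1) < p.2.+1%:R^-1).
  move=> p; have [[z Jz lt]|no] := pselect (exists2 z, J z & rn (z - d p.1) < p.2.+1%:R^-1).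
    by exists z.
  by exists 0; split=> // h; case: no.
exists (fun n => if unpickle n is Some p then y p else 0); split.
  by move=> n; case: unpickle => // p; case: (yP p).
move=> a e Ja e0.
have [|N /(_ N (leqnn N)) lt] := @exists_invS_lt R (e / 2); first by rewrite divr_gt0.
have [|i ai] := dd a N.+1%:R^-1; first by rewrite invr_gt0.
exists (pickle (i, N)); rewrite pickleK.
have [_ /(_ (ex_intro2 _ _ a Ja ai)) /= yi] := yP (i, N).
apply: le_lt_trans (rn_triangle (d i) _ _) _; rewrite (rnBC (d i)).
move: lt ai yi; move: (N.+1%:R^-1) => r; lra.
Qed.

End DenseSequence.

(** * Strictly positive elements of ideals in separable algebras *)

Section StrictlyPositive.
Variables (R : realType) (A : cstarAlgType R) (J : set A).
Hypothesis J_lin : forall (k : R[i]) a c, J a -> J c -> J (k *: a + c).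
Hypothesis J0 : J 0.
Hypothesis J_mult : forall (b : multiplier A) a, J a -> J (lmult b a) /\ J (rmult a b).
Hypothesis J_closed : closed J.

Lemma J_add a c : J a -> J c -> J (a + c).
Proof. by move=> Ja Jc; rewrite -(scale1r a); exact: J_lin. Qed.

Lemma J_scale (k : R[i]) a : J a -> J (k *: a).
Proof. by move=> Ja; rewrite -[_ *: _]addr0; exact: J_lin. Qed.

(** Strict positivity expressed through powers: the elements 1 - (1 - s)^n, which lie in J, form an
    approximate unit of J. *)
Definition strictly_positive (s : A) := [/\ J s, pos (mulin s),
  pos (sone - mulin s) & forall a, J a ->
    scvg (fun n => spow (sone - mulin s) n ** mulin a) 0].

(* [c |m^n a|^2 <= |m^n s m^n| = |(1 - m) m^(2n)|], which is at most
   [1 / (2n + 1)]. *)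
Lemma dominated_spow (s a : A) (c : R) : 0 < c ->
  pos (mulin s) -> pos (sone - mulin s) -> pos (mulin s - c%:C *: mulin (a ** star a)) ->
  scvg (fun n => spow (sone - mulin s) n ** mulin a) 0.
Proof.
move=> c0 ps pm psa; set m := sone - mulin s in pm *.
have sm := pos_selfadj pm.
have bound n : c * rn (spow m n ** mulin a) ^+ 2 <= n.+1%:R^-1.
  rewrite -rn_star -rn_starM starK.
  set p := spow m n; have sp : star p = p by apply: star_spow.
  have e1 : p ** mulin a ** star (p ** mulin a) = star p ** mulin (a ** star a) ** p.
    by rewrite starM sp mulinM mulin_star !smulA.
  rewrite e1; have := pos_conj p psa; rewrite smulBr smulBl smulZr smulZl.
  set x := star p ** mulin (a ** star a) ** p => px.
  have pos_x : pos x.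
    apply: pos_conj; rewrite mulinM mulin_star -{1}(starK (mulin a)).
    exact: pos_starM.
  have := pos_mono (posZ (ltW c0) pos_x) px.
  rewrite rnZr (ger0_norm (ltW c0)) => /le_trans; apply.
  have e2 : star p ** mulin s ** p = (sone - m) ** spow m (n + n).
    rewrite spowD -/p sp smulA.
    have -> : mulin s = sone - m by rewrite /m opprB addrC subrK.
    congr (_ ** _); apply/esym; apply: spow_comm.
    by move: (m) => m0; rewrite smulBl smulBr smul1l smul1r.
  rewrite e2; apply: (le_trans (rn_one_sub_spow (n + n) pm _)).
    by rewrite /m opprB addrC subrK.
  by rewrite lef_pV2 ?posrE // ler_nat ltnS leq_addr.
move=> e e0; have [|N NP] := @exists_invS_lt R (c * e ^+ 2).
  by rewrite mulr_gt0 // exprn_gt0.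
exists N => n Nn; rewrite subr0.
have := le_lt_trans (bound n) (NP n Nn); rewrite ltr_pM2l //.
by rewrite ltr_pXn2r // ?nnegrE ?rn_ge0 // ltW.
Qed.

Lemma rn_spow_le1 (m : multiplier A) n : pos m -> pos (sone - m) -> rn (spow m n) <= 1.
Proof.
move=> pm p1; have m1 : rn m <= 1 by apply: (pos_le_norm ler01 pm); rewrite sc1.
elim: n => [|n IH] /=; first exact: rn1.
apply: (le_trans (rn_smul _ _)).
by apply: mulr_ile1 => //; exact: rn_ge0.
Qed.

(** s is a weighted sum of j_i j_i^* over a dense sequence in J. It dominates each summand, so
    [dominated_spow] handles every j_i, and density together with the contractivity of the powers
    handles the rest. *)
Lemma exists_strictly_positive : separable A -> exists s, strictly_positive s.
Proof.
move=> sepA; have [j [Jj jd]] := dense_sequence_in sepA J0.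
(* The weights make the i-th summand at most 2^-(i+1) in norm, so the sum converges and has norm at
   most 1. *)
pose c i : R := 2^-1 ^+ i.+1 / (1 + rn (j i) ^+ 2).
have c0 i : 0 < c i.
  by rewrite divr_gt0 ?exprn_gt0 ?invr_gt0 // ltr_wpDr ?exprn_ge0 ?rn_ge0.
pose t i := (c i)%:C *: (j i ** star (j i)).
have Jt i : J (t i) by apply: J_scale; exact: (J_mult (mulin (star (j i))) (Jj i)).2.
have pt i : pos (mulin (t i)).
  rewrite mulinZ; apply: posZ; first exact: ltW.
  rewrite mulinM mulin_star -{1}(starK (mulin (j i))); exact: pos_starM.
have nt i : rn (t i) <= 2^-1 ^+ i.+1.
  rewrite rnZr (ger0_norm (ltW (c0 i))).
  apply: (@le_trans _ _ (c i * (1 + rn (j i) ^+ 2))).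
    rewrite ler_pM2l //; apply: (le_trans (rn_smul _ _)).
    by rewrite rn_star -expr2 lerDr.
  rewrite /c mulfVK // lt0r_neq0 // ltr_wpDr ?exprn_ge0 ?rn_ge0 //.
pose w := fix w n := if n is k.+1 then w k + t k else 0.
have wr n : rn (w n) <= 1 - 2^-1 ^+ n.
  elim: n => [|n IH] /=; first by rewrite rn0 expr0 subrr.
  apply: (le_trans (rnD _ _)); have := nt n; rewrite exprS; move: IH.
  by move: (rn (w n)) (rn (t n)) (2^-1 ^+ n) => x y z; lra.
have [s ws] : exists s, scvg w s.
  apply: scauchy_cvg; apply: (@scauchy_major _ _ w (fun n => 1 - 2^-1 ^+ n) 1).
    move=> n /=; rewrite addrAC subrr add0r; have := nt n; rewrite exprS.
    by move: (rn (t n)) (2^-1 ^+ n) => x y; lra.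
  by move=> n; rewrite gerBl exprn_ge0 // invr_ge0.
have mw k : scvg (fun n => mulin (w (n + k)%N)) (mulin s).
  apply: (@scvg_lip _ _ _ (@mulin R A) 1 (fun n => w (n + k)%N)).
    by move=> x y; rewrite mul1r -mulinB rn_mulin.
  exact: scvg_shift.
have pw n : pos (mulin (w n)).
  elim: n => [|n IH] /=; first by rewrite mulin0; exact: pos0.
  by rewrite mulinD; exact: posD.
have ps : pos (mulin s) by apply: pos_scvg (mw 0%N) => n; exact: pw.
have s1 : rn s <= 1.
  apply: scvg_le ws => n; apply: (le_trans (wr n)).
  by rewrite gerBl exprn_ge0 // invr_ge0.
have pm : pos (sone - mulin s).
  rewrite -sc1; apply: pos_sub_norm; last by rewrite rn_mulin.
  exact: pos_selfadj.
exists s; split=> //.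
  apply: (closed_scvg J_closed (u := w)) => //.
  by elim=> [|n IH] //=; exact: J_add.
have jP i : scvg (fun n => spow (sone - mulin s) n ** mulin (j i)) 0.
  apply: (dominated_spow (c := c i)) => //; rewrite -mulinZ -mulinB.
  apply: (@pos_scvg _ _ (fun n => mulin (w (n + i.+1)%N - t i))).
    elim=> [|n IH]; first by rewrite add0n /= addrK.
    by rewrite addSn /= addrAC mulinD; apply: posD.
  apply: (@scvg_lip _ _ _ (@mulin R A) 1 (fun n => w (n + i.+1)%N - t i)).
    by move=> x y; rewrite mul1r -mulinB rn_mulin.
  exact: scvg_sub (scvg_shift i.+1 ws) (scvg_cst (t i)).
move=> a Ja e e0; have e2 : 0 < e / 2 by rewrite divr_gt0.
have [i ai] := jd a (e / 2) Ja e2; have [N NP] := jP i (e / 2) e2.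
exists N => n Nn; have := NP n Nn; rewrite !subr0.
set p := spow _ n => lt.
have p1 : rn p <= 1.
  apply: rn_spow_le1 => //.
  by rewrite opprB addrC subrK.
have -> : p ** mulin a = p ** mulin (a - j i) + p ** mulin (j i).
  by rewrite -smulDr -mulinD subrK.
apply: (le_lt_trans (rnD _ _)).
have : rn (p ** mulin (a - j i)) <= rn (a - j i).
  apply: (le_trans (rn_smul _ _)); rewrite rn_mulin.
  by rewrite -[leRHS]mul1r; apply: ler_wpM2r => //; exact: rn_ge0.
move: lt ai; move: (rn _) (rn _) (rn _) => x y z; lra.
Qed.

Section Spectral.
Variable s : A.
Hypothesis s_pos : strictly_positive s.
Local Notation m := (sone - mulin s).

Lemma pos_m : pos m /\ pos (sone - m).
Proof. by case: s_pos => _ ps pm _; split=> //; rewrite opprB addrC subrK. Qed.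

Definition unit_part n : multiplier A := sone - spow m n.

Lemma unit_part_mem n : exists2 a, J a & mulin a = unit_part n.
Proof.
have [Js _ _ _] := s_pos.
elim: n => [|n [a Ja aE]]; first by exists 0 => //; rewrite /unit_part /= subrr mulin0.
exists (a + lmult (spow m n) s).
  by apply: J_add => //; case: (J_mult (spow m n) Js).
rewrite mulinD aE -smul_mulin /unit_part spowSr; move: (spow m n) => p.
by rewrite smulBr smul1r opprB -addrA (addrC (- p)).
Qed.

Lemma pos_unit_part n : pos (unit_part n).
Proof.
have [pm p1] := pos_m; rewrite /unit_part.
have := star_spow n (pos_selfadj pm); have := rn_spow_le1 n pm p1.
by move: (spow m n) => p np sp; rewrite -sc1; exact: pos_sub_norm.
Qed.

Lemma pos_unit_partC n : pos (sone - unit_part n).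
Proof.
have [pm p1] := pos_m; rewrite /unit_part opprB addrC subrK.
exact: pos_spow.
Qed.

Lemma pos_unit_part_incr n : pos (unit_part n.+1 - unit_part n).
Proof.
have [pm p1] := pos_m.
have -> : unit_part n.+1 - unit_part n = spow m n ** (sone - m).
  rewrite /unit_part spowSr; move: (spow m n) (m) => p k.
  by rewrite smulBr smul1r opprB addrC addrA subrK.
apply: pos_mul => //; first exact: pos_spow.
by apply/esym; apply: spow_comm; move: (m) => k; rewrite smulBl smulBr smul1l smul1r.
Qed.

(** Vectors [pi a x] with a in J satisfy the claim by strict positivity. The vectors that satisfy it
    together with all their images under A form a closed invariant subspace, which is nonzero
    because J is not killed; irreducibility makes it everything. *)
Lemma spow_strong (H : completeNormedModType R[i]) (dot : {dot H for Num.conj})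
    (pi : A -> H -> H) (rho : multiplier A -> H -> H) :
  irreducible_rep dot pi -> irreducible_rep dot rho ->
  (forall a x, rho (mulin a) x = pi a x) -> (exists2 a, J a & exists x, pi a x != 0) ->
  forall y, scvg (fun n => rho (spow m n) y) 0.
Proof.
move=> irr irr' rp [a0 Ja0 [x0 ax0]].
have [pm p1] := pos_m; have [dxx rep [_ irred]] := irr; have [dxx' rep' _] := irr'.
have [_ _ _ sJ] := s_pos.
pose L y := scvg (fun n => rho (spow m n) y) 0.
have contr n y : rn (rho (spow m n) y) <= rn y.
  apply: (le_trans (rep_contractive dxx' rep' _ _)).
  by rewrite -[leRHS]mul1r; apply: ler_wpM2r; [exact: rn_ge0|exact: rn_spow_le1].
have L_lin (k : R[i]) y z : L y -> L z -> L (k *: y + z).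
  move=> Ly Lz.
  have := scvgD (scvg_scale k Ly) Lz; rewrite scaler0 addr0 /L.
  by congr scvg; apply: funext => n; rewrite (repDr rep') (repZr rep').
have L_lim (v : nat -> H) l : (forall n, L (v n)) -> scvg v l -> L l.
  move=> Lv vl e e0; have e2 : 0 < e / 2 by rewrite divr_gt0.
  have [N /(_ N (leqnn N)) vN] := vl _ e2.
  have [M MP] := Lv N _ e2; exists M => n Mn; rewrite subr0.
  have -> : rho (spow m n) l = rho (spow m n) (l - v N) + rho (spow m n) (v N).
    by rewrite -(repDr rep') subrK.
  apply: (le_lt_trans (rnD _ _)); have := MP n Mn; rewrite subr0.
  have := contr n (l - v N); rewrite (rnBC l); move: vN.
  by move: (rn _) (rn _) (rn _) => x y z; lra.
pose M := [set y | L y /\ forall c, L (pi c y)].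
have LJ a x : J a -> L (pi a x).
  move=> Ja e e0; have [|N NP] := sJ a Ja (e / (1 + rn x)).
    by rewrite divr_gt0 // ltr_wpDr ?rn_ge0.
  exists N => n Nn; rewrite subr0 -rp -(repM rep').
  have := NP n Nn; rewrite subr0; set q := _ ** _ => lt.
  apply: (le_lt_trans (rep_contractive dxx' rep' q x)).
  move: lt; rewrite ltr_pdivlMr ?ltr_wpDr ?rn_ge0 //.
  by apply: le_lt_trans; apply: ler_wpM2l; [exact: rn_ge0|rewrite lerDr].
have [||M0|MT] := irred M.
- split.
  + split; first by move=> e e0; exists 0%N => n _; rewrite (rep0r rep') subr0 rn0.
    by move=> c e e0; exists 0%N => n _; rewrite (rep0r rep) (rep0r rep') subr0 rn0.
  + move=> k y z [Ly My] [Lz Mz]; split; first exact: L_lin.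
    by move=> c; rewrite (repDr rep) (repZr rep); exact: L_lin.
  + apply: scvg_closed => v l Mv vl; split.
      by apply: L_lim vl => n; case: (Mv n).
    move=> c; apply: (L_lim (fun n => pi c (v n))).
      by move=> n; case: (Mv n).
    apply: (@scvg_lip _ _ _ (pi c) (rn c) v) => // x y.
    by rewrite -(repBr rep); exact: rep_contractive.
- move=> a y [Ly My]; split; first exact: My.
  by move=> c; rewrite -(repM rep); exact: My.
- have : M (pi a0 x0).
    split; first exact: LJ.
    move=> c; rewrite -(repM rep); apply: LJ.
    exact: (J_mult (mulin c) Ja0).1.
  by rewrite M0 => /= e; move: ax0; rewrite e eqxx.
- by move=> y; have [] : M y by rewrite MT.
Qed.

End Spectral.
End StrictlyPositive.

Section ExceedsTopology.
Variables (R : realType) (A : cstarAlgType R) (u : nat -> A).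
Hypothesis unit_u : approximate_unit u.
Implicit Types (P : Prim A) (h : multiplier A).

Lemma exceeds_open h t : star h = h -> open (exceeds h t).
Proof.
move=> hs; have [c cP] := cut_exists t hs.
have -> : exceeds h t = \bigcup_a ([set P | ~ ideal_of P (lmult c a)] `|`
    [set P | ~ ideal_of P (rmult a c)]).
  apply/seteqP; split=> P.
    move=> [Q QE nb]; apply: contrapT => no; apply: nb; apply/cP; rewrite QE => a.
    by split; apply: contrapT => n; apply: no; exists a => //; [left|right].
  have [Q QE] := tilde_prim unit_u P.
  move=> [a _ nP]; exists Q => // /cP; rewrite QE => /(_ a) [l r].
  by case: nP => /=; apply.
by apply: bigcup_open => a _; apply: openU; exact: prim_open_notin1.
Qed.

Lemma exceeds_mono h h' t : star h = h -> pos (h' - h) -> exceeds h t `<=` exceeds h' t.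
Proof.
move=> hs ph P [Q QE nb]; exists Q => // nb'; apply: nb => K dot rho irr QE' x.
apply: le_trans (nb' K dot rho irr QE' x); rewrite -subr_ge0.
have [_ rep _] := irr.
by have := rep_pos irr ph x; rewrite (repB rep) redotDl redotNl.
Qed.

End ExceedsTopology.

Section ClosedKernel.
Variables (R : realType) (A : cstarAlgType R) (H : set (Prim A)).

Lemma ker_lin (k : R[i]) a c : ker H a -> ker H c -> ker H (k *: a + c).
Proof. by move=> Ja Jc P HP; apply: prim_lin; [exact: Ja|exact: Jc]. Qed.

Lemma ker0 : ker H 0. Proof. by move=> P _; exact: prim0. Qed.

Lemma ker_mult (b : multiplier A) a : ker H a -> ker H (lmult b a) /\ ker H (rmult a b).
Proof. by move=> Ja; split=> P HP; have := prim_mult b (Ja P HP); case. Qed.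

Lemma ker_closed : closed (ker H).
Proof. by apply: closed_bigI => P _; exact: prim_closed. Qed.

Lemma ker_notin P : closed H -> ~ H P -> exists2 a, ker H a & ~ ideal_of P a.
Proof.
move=> cH nHP; apply: contrapT => no.
have /prim_openP oH := closed_openC cH; apply: (oH P) => //.
rewrite setCK => a Ja; apply: contrapT => nPa; apply: no; by exists a.
Qed.

End ClosedKernel.

(** * Multipliers as strict sums over the steps of an approximate unit *)

Section Construction.
Variables (R : realType) (A : cstarAlgType R) (H : set (Prim A)).
Hypothesis closed_H : closed H.
Hypothesis sepA : separable A.
Variable v : nat -> A.
Hypothesis inc_v : increasing_unit v.
Variables (Z : nat -> set (Prim A)) (delta : R).
Hypothesis delta_gt0 : 0 < delta.
Hypothesis Z_compact : forall k, compact (Z k).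
Hypothesis Z_disjoint : forall k, Z k `&` H = set0.
Hypothesis Z_attains : forall k P, Z k P -> attains P (v k.+1 - v k) delta.
Local Notation J := (ker H).
Let unit_v : approximate_unit v. Proof. by case: inc_v. Qed.

Let D k : multiplier A := mulin (v k.+1 - v k).

Lemma pos_inc (n m : nat) : (n <= m)%N ->
  pos (mulin (v m - v n)) /\ rn (mulin (v m - v n)) <= 1.
Proof.
move=> nm; have [[v1 _ _] pv dv] := inc_v; split; first exact: dv.
apply: le_trans (pos_mono (dv _ _ nm) _) _; last first.
  by have := v1 m; rewrite -rn_mulin; exact.
by rewrite mulinB opprB addrC subrK; exact: pv.
Qed.

Lemma D_pos k : pos (D k) /\ pos (sone - D k).
Proof.
have [p n1] := pos_inc (leqnSn k); split=> //.
move: n1 p; rewrite -/(D k); move: (D k) => d n1 p.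
by rewrite -sc1; exact: pos_sub_norm (pos_selfadj p) n1.
Qed.

(** At P in Z k take y with |D y| >= delta |y| and z = D y. As N grows, <D e_N D y, y> = |z|^2 - <(1
    - s)^N z, z> tends to |z|^2, so at some N it is at least half of it and exceeds (delta^2 / 4)
    |y|^2. The sets where the bound is exceeded are open and increase with N, so compactness of Z k
    gives one N. *)
Lemma exists_stage s k : strictly_positive J s ->
  exists N, Z k `<=` exceeds (D k ** unit_part s N ** D k) (delta ^+ 2 / 4).
Proof.
move=> sp; have [pD _] := D_pos k; have sD := pos_selfadj pD.
have pe n := pos_unit_part sp n.
pose T N := D k ** unit_part s N ** D k.
have sT N : star (T N) = T N.
  by rewrite /T !starM sD (pos_selfadj (pe N)) smulA.
have t0 : 0 < delta ^+ 2 / 4 by rewrite divr_gt0 // exprn_gt0.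
have Tmono N M : (N <= M)%N ->
    exceeds (T N) (delta ^+ 2 / 4) `<=` exceeds (T M) (delta ^+ 2 / 4).
  move=> /subnK <-; elim: (M - N)%N => [//|i IH]; apply: (subset_trans IH).
  apply: exceeds_mono => //; rewrite addSn /T -smulBl -smulBr -{1}sD.
  by apply: pos_conj; exact: (pos_unit_part_incr sp).
have point P : Z k P -> exists N, exceeds (T N) (delta ^+ 2 / 4) P.
  move=> ZP; have [K [dot [pi [irr PE [y y0 ay]]]]] := Z_attains ZP.
  have [v1 vl _] := unit_v.
  have irr' := ext_irreducible irr v1 vl.
  have rp a x : ext irr v1 vl (mulin a) x = pi a x by exact: ext_mulin.
  have PE' : ideal_tilde (ideal_of P) = [set b | forall x, ext irr v1 vl b x = 0].
    by rewrite PE -(ext_ker irr v1 vl).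
  move: (ext irr v1 vl) irr' rp PE' => rho irr' rp PE'.
  have [Q QE] := prim_of_rep irr'.
  have [a Ja nPa] : exists2 a, J a & ~ ideal_of P a.
    by apply: ker_notin => // HP; exact: disjoint_not (@Z_disjoint k) ZP HP.
  have [x ax] : exists x, pi a x != 0.
    apply: contrapT => no; apply: nPa; rewrite PE => x /=.
    by apply/eqP; apply: contrapT => n; apply: no; exists x; apply/negP.
  have strong := @spow_strong _ _ _ (@ker_mult _ _ H) s sp _ dot pi rho irr irr' rp
    (ex_intro2 _ _ a Ja (ex_intro _ x ax)).
  have [dxx rep _] := irr'.
  set z := rho (D k) y.
  have yp := rn_gt0 y0.
  have zge : delta * rn y <= rn z by rewrite /z /D rp.
  have zp : 0 < rn z by apply: lt_le_trans zge; rewrite mulr_gt0.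
  have [|N /(_ N (leqnn N))] := strong z (rn z / 2); first by rewrite divr_gt0.
  rewrite subr0 => small.
  exists N, Q; first by rewrite QE.
  move=> /(_ K dot rho irr' QE y); apply/negP; rewrite -ltNge.
  have -> : redot dot (rho (T N) y) y =
      rn z ^+ 2 - redot dot (rho (spow (sone - mulin s) N) z) z.
    rewrite /T !(repM rep) (rep_adj rep) sD -/z /unit_part (repB rep).
    by rewrite redotDl redotNl (rep_one irr') (redotxx dxx).
  have := redot_le dxx (rho (spow (sone - mulin s) N) z) z.
  move: small; move: (redot _ _ _) (rn (rho _ z)) => p q small pq.
  have : p <= rn z ^+ 2 / 2.
    apply: (le_trans pq); rewrite expr2 mulrAC; apply: ler_wpM2r; first exact: ltW.
    exact: ltW.
  have : delta ^+ 2 * rn y ^+ 2 <= rn z ^+ 2.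
    rewrite -exprMn; apply: lerXn2r; rewrite ?nnegrE //; last exact: ltW.
    by apply: mulr_ge0; exact: ltW.
  have : 0 < delta ^+ 2 * rn y ^+ 2 by rewrite mulr_gt0 ?exprn_gt0.
  rewrite mulrAC; move: (delta ^+ 2 * rn y ^+ 2) (rn z ^+ 2) => c d; lra.
have [||l [lD Zl]] := compact_subcover (@Z_compact k)
    (D := [set U | exists N, U = exceeds (T N) (delta ^+ 2 / 4)]).
- by move=> U [N ->]; apply: (exceeds_open unit_v).
- move=> P /point [N NP]; exists (exceeds (T N) (delta ^+ 2 / 4)) => //.
  by exists N.
suff [N NP] : exists N, union_of l `<=` exceeds (T N) (delta ^+ 2 / 4).
  by exists N; apply: subset_trans Zl NP.
elim: l lD {Zl} => [|U l IH] /=; first by exists 0%N.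
move=> [[N ->] /IH [M MP]]; exists (maxn N M) => P [|/MP]; apply: Tmono.
  exact: leq_maxl.
exact: leq_maxr.
Qed.

(** |S x|^2 = |x^* S^2 x| <= |x^* S x| <= |x^* d x| for 0 <= S <= d of norm at most 1. With d a
    difference v_m - v_n this turns the convergence of the approximate unit into strict Cauchyness
    of the partial sums. *)
Lemma sandwich (S d x : multiplier A) : pos S -> pos (d - S) -> rn d <= 1 ->
  rn (S ** x) ^+ 2 <= rn x * rn (d ** x).
Proof.
move=> pS pdS d1; have sS := pos_selfadj pS.
have S1 : rn S <= 1 by apply: le_trans (pos_mono pS pdS) d1.
have pS1 : pos (sone - S) by rewrite -sc1; exact: pos_sub_norm.
rewrite -rn_starM starM sS.
have -> : star x ** S ** (S ** x) = star x ** (S ** S) ** x by rewrite !smulA.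
have p1 : pos (star x ** (S ** S) ** x).
  by apply: pos_conj; rewrite -{1}sS; exact: pos_starM.
have p2 := pos_conj x (pos_sub_sqr pS pS1); have p3 := pos_conj x pdS.
rewrite smulBr smulBl in p2; rewrite smulBr smulBl in p3.
apply: (le_trans (pos_mono p1 p2)); apply: (le_trans (pos_mono (pos_conj x pS) p3)).
by rewrite -smulA; apply: (le_trans (rn_smul _ _)); rewrite rn_star.
Qed.

Lemma pos_strict_limit (S : nat -> multiplier A) b :
  (forall n, pos (S n) /\ rn (S n) <= 1) ->
  (forall a, scvg (fun n => lmult (S n) a) (lmult b a)) ->
  (forall a, scvg (fun n => rmult a (S n)) (rmult a b)) -> pos b.
Proof.
move=> pS Sl Sr; split.
  apply: mult_eq_l => a; rewrite lmult_star.
  apply: (scvg_unique (u := fun n => lmult (S n) a)); last exact: Sl.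
  have -> : (fun n => lmult (S n) a) = star \o (fun n => rmult (star a) (S n)).
    by apply: funext => n /=; rewrite -lmult_star (pos_selfadj (pS n).1).
  apply: (@scvg_lip _ _ _ (@star R A) 1) => [x y|]; last exact: Sr.
  by rewrite mul1r -starB rn_star.
exists 1; rewrite sc1; apply: rn_mult_le => // a; rewrite mul1r.
apply: (scvg_le (u := fun n => lmult (sone - S n) a)).
  move=> n; apply: (le_trans (rn_lmult _ _)).
  rewrite -[leRHS]mul1r; apply: ler_wpM2r; first exact: rn_ge0.
  by rewrite -sc1; apply: pos_sub_le; case: (pS n).
rewrite lmultBl; have -> : (fun n => lmult (sone - S n) a) =
    (fun n => lmult sone a - lmult (S n) a) by apply: funext => n; rewrite lmultBl.
exact: scvg_sub (scvg_cst _) (Sl a).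
Qed.

(* The strict sum of the [d_k e_k d_k], where [d_k = v_(k+1) - v_k] and [e_k] in
   the ideal acts nearly as the identity at the points of [Z k]: each summand
   is at most [d_k], so the partial sums are strictly Cauchy. *)
Theorem exists_multiplier : exists b,
  ideal_tilde J b /\ forall k, Z k `<=` exceeds b (delta ^+ 2 / 4).
Proof.
have [s sp] := exists_strictly_positive (@ker_lin _ _ H) (@ker0 _ _ H)
  (@ker_mult _ _ H) (@ker_closed _ _ H) sepA.
have /boolp.choice [N NP] : forall k, exists N,
    Z k `<=` exceeds (D k ** unit_part s N ** D k) (delta ^+ 2 / 4).
  by move=> k; exact: exists_stage.
pose T k := D k ** unit_part s (N k) ** D k.
have pT k : pos (T k).
  have [pD _] := D_pos k; rewrite /T -{1}(pos_selfadj pD).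
  exact/pos_conj/(pos_unit_part sp).
have TD k : pos (D k - T k).
  have [pD pD1] := D_pos k.
  (* With e the chosen element of the ideal, D - D e D = (D - D^2) + D (1 - e) D, a sum of two
     positive elements. *)
  have -> : D k - T k = (D k - D k ** D k) + star (D k) ** (sone - unit_part s (N k)) ** D k.
    rewrite (pos_selfadj pD) /T; move: (D k) (unit_part _ _) => d e.
    by rewrite smulBr smulBl smul1r addrA subrK.
  by apply: posD; [exact: pos_sub_sqr|exact/pos_conj/(pos_unit_partC sp)].
have /boolp.choice [g gP] : forall k, exists a, J a /\ mulin a = T k.
  move=> k; have [a Ja aE] := unit_part_mem (@ker_lin _ _ H) (@ker0 _ _ H)
    (@ker_mult _ _ H) sp (N k).
  exists ((v k.+1 - v k) ** a ** (v k.+1 - v k)); split.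
    apply: (ker_mult (mulin _) _).2; exact: (ker_mult (mulin _) Ja).1.
  by rewrite !mulinM aE.
pose S := fix S n := if n is k.+1 then S k + T k else 0.
have [w [Jw wS]] : exists w : nat -> A, (forall n, J (w n)) /\ forall n, mulin (w n) = S n.
  exists (fix w n := if n is k.+1 then w k + g k else 0); split.
    elim=> [|n IH] /=; first exact: ker0.
    by rewrite -[X in X + _]scale1r; apply: ker_lin => //; case: (gP n).
  by elim=> [|n IH] /=; [rewrite mulin0|rewrite mulinD IH (gP n).2].
(* The bounds T k <= D k add up, and the D k telescope: a block of the sum lies between 0 and the
   corresponding difference of v. *)
have diff n i : pos (S (i + n)%N - S n) /\
    pos (mulin (v (i + n)%N - v n) - (S (i + n)%N - S n)).
  elim: i => [|i [IH1 IH2]]; first by rewrite add0n !subrr mulin0 subr0; split; exact: pos0.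
  rewrite addSn /=; split; first by rewrite addrAC; apply: posD; [exact: IH1|exact: pT].
  have -> : v (i + n).+1 - v n = (v (i + n).+1 - v (i + n)%N) + (v (i + n)%N - v n).
    by rewrite addrA subrK.
  rewrite mulinD [S _ + _ - _]addrAC [_ + T _]addrC opprD addrACA.
  by apply: posD; [exact: (TD (i + n)%N)|exact: IH2].
have nS n i : rn (S (i + n)%N - S n) <= 1.
  by have [p1 p2] := diff n i; apply: le_trans (pos_mono p1 p2) (pos_inc (leq_addl i n)).2.
have S0E n : S n = S (n + 0)%N - S 0%N by rewrite addn0 subr0.
have pS n : pos (S n) /\ rn (S n) <= 1.
  by rewrite S0E; split; [case: (diff 0%N n)|exact: nS].
have cauchy a : scauchy (fun n => lmult (S n) a).
  move=> e e0; have [_ vl _] := unit_v.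
  have ep : 0 < e ^+ 2 / (1 + rn a).
    by rewrite divr_gt0 ?exprn_gt0 // ltr_wpDr ?rn_ge0.
  have [M MP] := scvg_cauchy (vl a) ep; exists M.
  have key n i : (M <= n)%N -> rn (lmult (S (i + n)%N) a - lmult (S n) a) < e.
    move=> Mn; have [p1 p2] := diff n i.
    have := sandwich (mulin a) p1 p2 (pos_inc (leq_addl i n)).2.
    rewrite smul_mulin -mulinM !rn_mulin lmultBl => le.
    rewrite -(@ltr_pXn2r _ 2) ?nnegrE ?rn_ge0 //; last exact: ltW.
    apply: (le_lt_trans le).
    have := MP (i + n)%N n (leq_trans Mn (leq_addl i n)) Mn; rewrite -smulBl.
    rewrite ltr_pdivlMr ?ltr_wpDr ?rn_ge0 // mulrC; apply: le_lt_trans.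
    by apply: ler_wpM2r; [exact: rn_ge0|rewrite lerDr].
  move=> n m Mn Mm; have [nm|mn] := leqP n m.
    by rewrite rnBC -(subnK nm); exact: key.
  by rewrite -(subnK (ltnW mn)); exact: key.
have [|b [b1 bP]] := strict_limit (u := S) (M := 1) (fun n => (pS n).2) cauchy.
  move=> a e e0; have [M MP] := cauchy (star a) e e0; exists M => n m Mn Mm.
  rewrite !rmultE !(pos_selfadj (pS _).1) -starB rn_star; exact: MP.
exists b; split.
  move=> a; have [bl br] := bP a; split.
    apply: (closed_scvg (@ker_closed _ _ H) _ bl) => n.
    by rewrite -wS; exact: (ker_mult (mulin a) (Jw n)).2.
  apply: (closed_scvg (@ker_closed _ _ H) _ br) => n.
  by rewrite -wS; exact: (ker_mult (mulin a) (Jw n)).1.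
move=> k; apply: (subset_trans (NP k)); apply: exceeds_mono.
  by apply: pos_selfadj; exact: pT.
(* From index k + 1 on, the partial sums contain T k; removing it leaves positive elements, so b >=
   T k in the limit. *)
apply: (@pos_strict_limit (fun n => S (n + k.+1)%N - T k)).
- move=> n; have p : pos (S (n + k.+1)%N - T k).
    have -> : S (n + k.+1)%N - T k = (S (n + k.+1)%N - S k.+1) + S k.
      by rewrite /= [in RHS]opprD -!addrA (addrC (- T k)) addKr.
    by apply: posD; [case: (diff k.+1 n)|case: (pS k)].
  split=> //; apply: (@le_trans _ _ (rn (S (n + k.+1)%N))); last exact: (pS _).2.
  by apply: pos_mono p _; rewrite subKr; exact: pT.
- move=> a; have -> : (fun n => lmult (S (n + k.+1)%N - T k) a) =
      (fun n => lmult (S (n + k.+1)%N) a - lmult (T k) a).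
    by apply: funext => n; rewrite lmultBl.
  by rewrite lmultBl; exact: scvg_sub (scvg_shift k.+1 (bP a).1) (scvg_cst _).
- have rB a c d : rmult a (c - d) = rmult a c - rmult a d :> A.
    by rewrite !rmultE starB lmultBl starB.
  move=> a; have -> : (fun n => rmult a (S (n + k.+1)%N - T k)) =
      (fun n => rmult a (S (n + k.+1)%N) - rmult a (T k)).
    by apply: funext => n; rewrite rB.
  by rewrite rB; exact: scvg_sub (scvg_shift k.+1 (bP a).2) (scvg_cst _).
Qed.

End Construction.

Lemma increasing_choice (r : nat -> nat -> nat -> Prop) :
  (forall k n, exists m, (n < m)%N /\ r k n m) ->
  exists f : nat -> nat, forall k, (f k < f k.+1)%N /\ r k (f k) (f k.+1).
Proof.
move=> h; have /boolp.choice [g gP] : forall p : nat * nat, exists m,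
    (p.2 < m)%N /\ r p.1 p.2 m by move=> p; exact: h.
by exists (fix f k := if k is i.+1 then g (i, f i) else 0%N) => k; exact: gP (k, _).
Qed.

Section IncreasingUnits.
Variables (R : realType) (A : cstarAlgType R) (u : nat -> A).
Hypothesis inc_u : increasing_unit u.

Lemma increasing_unit_sub (f : nat -> nat) : (forall k, (f k < f k.+1)%N) ->
  increasing_unit (fun k => u (f k)).
Proof.
move=> f_lt; have [[u1 ul ur] pu du] := inc_u.
have f_le n m : (n <= m)%N -> (f n <= f m)%N.
  move=> /subnK <-; elim: (m - n)%N => [//|i IH].
  by apply: (leq_trans IH); rewrite addSn ltnW.
have f_ge k : (k <= f k)%N.
  by elim: k => [//|k IH]; exact: leq_ltn_trans IH (f_lt k).
split; [split=> //|by []|by move=> n m /f_le; exact: du].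
  by move=> a e /(ul a e) [N NP]; exists N => n Nn; apply: NP; exact: leq_trans Nn (f_ge n).
by move=> a e /(ur a e) [N NP]; exists N => n Nn; apply: NP; exact: leq_trans Nn (f_ge n).
Qed.

End IncreasingUnits.

Lemma increasing_unit_zero (R : realType) (A : cstarAlgType R) (u : nat -> A) :
  increasing_unit u -> increasing_unit (fun k => if k is i.+1 then u i else 0).
Proof.
move=> [[u1 ul ur] pu du]; split; first split.
- by case=> [|n]; rewrite ?rn0.
- by move=> a e /(ul a e) [N NP]; exists N.+1 => -[|n] //; exact: NP.
- by move=> a e /(ur a e) [N NP]; exists N.+1 => -[|n] //; exact: NP.
- by case=> [|n] //; rewrite mulin0; exact: pos0.
- case=> [|n] [|m] nm //; last exact: du.
    by rewrite subrr mulin0; exact: pos0.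
  by rewrite subr0.
Qed.

(** Each term is chosen late enough to act almost as a unit on its predecessor. The initial 0
    ensures in [step_attains] that the first term of large norm has a predecessor. *)
Lemma almost_idempotent_sub (R : realType) (A : cstarAlgType R) (u : nat -> A) (e : R) :
  increasing_unit u -> 0 < e -> exists v : nat -> A, [/\ increasing_unit v, v 0%N = 0 &
  forall k, rn (v k.+1 ** v k - v k) < e].
Proof.
move=> inc_u e0; have [[_ ul _] _ _] := inc_u.
have [|f fP] := @increasing_choice (fun _ n m => rn (u m ** u n - u n) < e).
  move=> _ n; have [N NP] := ul (u n) e e0.
  by exists (maxn N n.+1); split; [exact: leq_maxr|exact/NP/leq_maxl].
have f_lt k : (f k < f k.+1)%N by case: (fP k).
exists (fun k => if k is i.+1 then u (f i) else 0); split=> //.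
  exact: increasing_unit_zero (increasing_unit_sub inc_u f_lt).
case=> [|k]; last by case: (fP k).
by rewrite smul0r subr0 rn0.
Qed.

(** Let v_(k+1) be the first term with |v y| >= |y| / 2 for some y != 0, and put z = v_(k+1) y. Then
    v_(k+2) moves z by at most |y| / 8 <= |z| / 4, while v_k sends it to at most |z| / 2. So v_(k+2)
    - v_k has size at least |z| / 4 at z, and one of its two steps has at least |z| / 8. *)
Lemma step_attains (R : realType) (A : cstarAlgType R) (v : nat -> A) (P : Prim A) : increasing_unit v -> v 0%N = 0 ->
  (forall k, rn (v k.+1 ** v k - v k) < 8^-1) ->
  exists k, attains P (v k.+1 - v k) 8^-1.
Proof.
move=> [unit_v _ _] v0 vv.
have [K [dot [pi [_ [irr PE _ _ [_ vx]]]]]] := prim_ext unit_v P.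
have [dxx rep _] := irr.
pose p n := `[< exists2 y : K, y != 0 & 2^-1 * rn y <= rn (pi (v n) y) >].
have : exists n, p n.
  have [x0 x0n] := irreducible_nontrivial irr; have x0p := rn_gt0 x0n.
  have [|n /(_ n (leqnn n)) vn] := vx x0 (2^-1 * rn x0); first by rewrite mulr_gt0.
  exists n; apply/asboolP; exists x0 => //.
  by have := rn_subl x0 (pi (v n) x0); rewrite rnBC; lra.
move=> /ex_minnP [[|k] /asboolP [y y0 yv] min].
  have := rn_gt0 y0; move: yv; rewrite v0 (rep0 rep) rn0; lra.
have small z : rn (pi (v k) z) <= 2^-1 * rn z.
  rewrite leNgt; apply/negP => lt; have : p k.
    apply/asboolP; exists z; last exact: ltW.
    by apply: contraTneq lt => ->; rewrite (rep0r rep) rn0 mulr0 ltxx.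
  by move/min; rewrite ltnn.
set z := pi (v k.+1) y in yv.
have yp := rn_gt0 y0.
have z0 : z != 0 by apply: contraTneq yv => ->; rewrite rn0 -ltNge mulr_gt0.
have close : rn (pi (v k.+2) z - z) <= 8^-1 * rn y.
  rewrite /z -(repM rep) -(repB rep); apply: (le_trans (rep_contractive dxx rep _ _)).
  by apply: ler_wpM2r; [exact: ltW|exact: ltW (vv k.+1)].
have alt : 8^-1 * rn z <= rn (pi (v k.+1 - v k) z) \/
    8^-1 * rn z <= rn (pi (v k.+2 - v k.+1) z).
  have [h1|h1] := leP (8^-1 * rn z) (rn (pi (v k.+1 - v k) z)); first by left.
  have [h2|h2] := leP (8^-1 * rn z) (rn (pi (v k.+2 - v k.+1) z)); first by right.
  have := rn_triangle (pi (v k.+2) z) z 0; rewrite !subr0 (rnBC z) => t1.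
  have := rn_triangle (pi (v k.+1) z) (pi (v k.+2) z) (pi (v k) z).
  rewrite -!(repB rep) => t2; have t3 := rn_subl (pi (v k.+2) z) (pi (v k) z).
  rewrite -(repB rep) in t3.
  have := small z; have := rn_gt0 z0; move: close yv h1 h2 t1 t2 t3.
  move: (rn (pi (v k.+2) z - z)) (rn (pi (v k.+1 - v k) z))
    (rn (pi (v k.+2 - v k.+1) z)) (rn (pi (v k.+2 - v k) z)) (rn (pi (v k.+2) z))
    (rn (pi (v k) z)) (rn y) (rn z).
  by move=> ? ? ? ? ? ? ? ?; lra.
by case: alt => h; [exists k|exists k.+1]; exists K, dot, pi; split=> //; exists z.
Qed.

(** * Local units cut out of an approximate unit *)

Section LocalUnit.
Variables (R : realType) (A : cstarAlgType R) (u : nat -> A).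
Hypothesis inc_u : increasing_unit u.
Let unit_u : approximate_unit u. Proof. by case: inc_u. Qed.

(* e = min(1, 2h), obtained as h + g / 2 with 1 - g = |1 - 2h|. *)
Lemma truncated_double (h : A) : pos (mulin h) -> rn h <= 1 -> exists e d,
  [/\ pos (sone - mulin e), pos d,
      sone - (mulin h + mulin h) = (sone - mulin e) - d & d ** (sone - mulin e) = 0].
Proof.
move=> ph h1; have sh := pos_selfadj ph.
have ph1 : pos (sone - mulin h).
  by rewrite -sc1; apply: pos_sub_norm; rewrite ?rn_mulin.
(* w = 4 (h - h^2) is 1 - (1 - 2h)^2 but lies in A. Taking the root of 1 - w by [half_root] in A
   keeps g, and with it e, in A. *)
pose a := h - h ** h; pose w := (a + a) + (a + a).
pose x : multiplier A := sone - (mulin h + mulin h).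
have wE : mulin w = sone - x ** x.
  rewrite /w /a !mulinD !mulinN !mulinM /x; move: (mulin h) => k.
  by ncring.
have sx : star x = x by rewrite /x starB starD star1 sh.
have pa : pos (mulin a) by rewrite /a mulinB mulinM; exact: pos_sub_sqr.
have pw : pos (mulin w) by have := posD (posD pa pa) (posD pa pa); rewrite -!mulinD.
have w1 : rn w <= 1.
  rewrite -rn_mulin; apply: (pos_le_norm ler01 pw); rewrite sc1 wE.
  by move: (pos_sqr sx); move: (x ** x) => y; rewrite opprB addrC subrK.
have [g [gg g1 gS]] := half_root w1.
have sw : star w = w by apply: mulin_inj; rewrite mulin_star; exact: pos_selfadj.
have sg := half_root_selfadj sw gS.
have cg : mulin h ** mulin g = mulin g ** mulin h.
  (* The induction principle for g in A is pulled back along the isometry [mulin] to give the one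
     for [mulin g]. *)
  apply: (half_root_comm (w := mulin w)).
    move=> S cS S0 Sst; have : (@mulin R A @^-1` S) g; last by [].
    apply: gS.
    - apply: scvg_closed => v l Sv vl; apply: (closed_scvg cS Sv).
      by apply: (@scvg_lip _ _ _ (@mulin R A) 1 v) => // y z; rewrite mul1r -mulinB rn_mulin.
    - by rewrite /= mulin0.
    - by move=> c /Sst; rewrite /= mulinZ mulinD mulinM.
  by rewrite /w /a !mulinD !mulinN !mulinM; move: (mulin h) => k; ncring.
have pk : pos (sone - mulin g).
  by rewrite -sc1; apply: pos_sub_norm; rewrite ?rn_mulin // -mulin_star sg.
have kk : (sone - mulin g) ** (sone - mulin g) = x ** x.
  have -> : x ** x = sone - mulin w by rewrite wE subKr.
  have -> : mulin w = mulin g + mulin g - mulin g ** mulin g.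
    by rewrite -mulinD gg mulinD mulinM addrK.
  by move: (mulin g) => k; ncring.
have kx : (sone - mulin g) ** x = x ** (sone - mulin g).
  rewrite /x; move: (mulin h) (mulin g) cg => p q pq.
  have -> : (sone - q) ** (sone - (p + p)) = sone - q - (p + p) + (q ** p + q ** p).
    by ncring.
  by rewrite -pq; ncring.
have [pc pd xE _ dc] := abs_parts pk sx kk kx.
exists (h + 2^-1%:C *: g), (2^-1%:C *: (sone - mulin g - x)).
suff cE : 2^-1%:C *: (sone - mulin g + x) = sone - mulin (h + 2^-1%:C *: g).
  by rewrite -cE.
rewrite mulinD mulinZ /x; set q := 2^-1%:C *: mulin g.
have -> : sone - mulin g + (sone - (mulin h + mulin h)) =
    (sone - (mulin h + q)) + (sone - (mulin h + q)).
  rewrite -{1}(half_addxx (mulin g)) -/q; move: (mulin h) q => p q.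
  by ncring.
by rewrite scalerDr half_addxx.
Qed.

(** If no later increment reaches 1/4 at points of [Of] off H, then u_N is within 1/4 of the
    identity there. Hence 1 - 2 u_N <= 0, and its positive part 1 - e vanishes, so e = min(1, 2 u_N)
    is a unit. Points of [Of] outside the interior of H are in the closure of [Of] minus H, where
    the same relations persist. *)
Lemma local_unit (H Of : set (Prim A)) N : open Of ->
  (forall Q m, Of Q -> ~ H Q -> (N < m)%N -> ~ attains Q (u m - u N) 4^-1) ->
  unital_quotient (ker (Of `&` ~` H°)).
Proof.
move=> oO nat_; have [[u1 _ _] pu _] := inc_u.
have [e [d [pc pd xE dc]]] := truncated_double (pu N) (u1 N).
exists e.
suff unit_at Q a : Of Q -> ~ H Q -> ideal_of Q (e ** a - a) /\ ideal_of Q (a ** e - a).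
  have cl Q : (Of `&` ~` H°) Q -> closure (Of `\` H) Q.
    move=> [OQ nHQ]; apply/closure_openP => W oW WQ; apply: contrapT => no.
    apply: nHQ; rewrite /interior nbhsE /=; exists (W `&` Of).
      by split=> //; exact: openI.
    by move=> Q' [WQ' OQ']; apply: contrapT => nH; apply: no; exists Q'.
  move=> a; split=> Q /cl /ker_closure; apply=> Q' [OQ' nHQ'].
    by case: (unit_at Q' a OQ' nHQ').
  by case: (unit_at Q' a OQ' nHQ').
move=> OQ nHQ.
have [K [dot [pi [rho [irr PE irr' _ [rp ux]]]]]] := prim_ext unit_u Q.
have [dxx rep _] := irr; have [_ rep' _] := irr'.
have close y : rn (y - pi (u N) y) <= 4^-1 * rn y.
  have [->|y0] := eqVneq y 0; first by rewrite (rep0r rep) subr0 rn0 mulr0.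
  apply/ler_addgt0Pr => t t0; have [M MP] := ux y t t0.
  have := MP (maxn M N.+1) (leq_maxl _ _).
  have := rn_triangle (pi (u (maxn M N.+1)) y) y (pi (u N) y); rewrite -(repB rep).
  have : ~~ (4^-1 * rn y <= rn (pi (u (maxn M N.+1) - u N) y)).
    apply/negP => le; apply: (nat_ Q (maxn M N.+1)) => //; first exact: leq_maxr.
    by exists K, dot, pi; split=> //; exists y.
  rewrite -ltNge (rnBC y (pi (u (maxn M N.+1)) y)).
  move: (rn _) (rn _) (4^-1 * rn y) (rn _) => p q r s; lra.
have neg y : redot dot (rho (sone - (mulin (u N) + mulin (u N))) y) y <= 0.
  rewrite (repB rep') (repD rep') (rep_one irr') rp redotDl redotNl redotDl (redotxx dxx).
  have := redot_le dxx (y - pi (u N) y) y; rewrite redotDl redotNl (redotxx dxx).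
  have := close y; have := rn_ge0 y; move: (redot _ _ _) (rn (y - _)) (rn y) => p q r.
  by move=> r0 qr; nra.
have e1 x : pi e x = x.
  have := (rep_neg_part irr' pc pd xE dc).2 neg x.
  by rewrite (repB rep') (rep_one irr') rp => /eqP; rewrite subr_eq0 => /eqP.
rewrite PE; split=> x /=; rewrite (repB rep) (repM rep) e1 subrr //.
Qed.

End LocalUnit.

(** * The two conditions of (ii) from strict closedness *)

Section Converse.
Variables (R : realType) (A : cstarAlgType R) (X : topologicalType).
Variables (phi : Prim A -> X) (phibar : Prim (multiplier A) -> stone_cech R X).
Variable E : set (image_space phi).
Hypothesis X_locally_compact : locally_compact [set: X].
Hypothesis X_hausdorff : hausdorff_space X.
Hypothesis phi_continuous : continuous phi.
Hypothesis phibar_continuous : continuous phibar.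
Hypothesis phibar_extends : forall (P : Prim A) (Q : Prim (multiplier A)),
       ideal_of Q = ideal_tilde (ideal_of P) ->
       phibar Q = to_stone_cech R (phi P).
Hypothesis E_closed : closed E.
Hypothesis sepA : separable A.
Hypothesis strictly_closed : closed (multiplier_ideal_over phibar E : set (strict A)).
Variable u : nat -> A.
Hypothesis inc_u : increasing_unit u.
Implicit Types (P Q : Prim A).
Local Notation H := (hull_over E).
Let unit_u : approximate_unit u. Proof. by case: inc_u. Qed.

Lemma attained_no_limit v (Z : nat -> set (Prim A)) (delta : R) x :
  increasing_unit v -> 0 < delta -> (forall k, compact (Z k)) ->
  (forall k, Z k `&` H = set0) ->
  (forall k P, Z k P -> attains P (v k.+1 - v k) delta) ->
  E x -> ~ closure (corestriction phi @` \bigcup_k Z k) x.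
Proof.
move=> inc_v d0 cZ ZH Za Ex cx.
have cH : closed H by exact: hull_over_closed.
have [b [Jb Zb]] := exists_multiplier cH sepA inc_v d0 cZ ZH Za.
have t0 : 0 < delta ^+ 2 / 4 by rewrite divr_gt0 // exprn_gt0.
have Hb : multiplier_ideal_over phibar E b.
  exact: (sub_strictly_closed X_locally_compact X_hausdorff phi_continuous
    phibar_continuous phibar_extends unit_u).
apply: (exceeds_no_limit phibar_continuous phibar_extends t0 Hb Ex).
apply: closureS cx => _ [P [k _ ZP] <-]; exists P => //; exact: Zb ZP.
Qed.

Variable psi : creg R (Prim A) -> image_space phi.
Hypothesis psi_factor : forall P, corestriction phi P = psi (creg_map R P).

Lemma creg_map_continuous : continuous (@creg_map R (Prim A)).
Proof.
move=> P; have FF : Filter (nbhs P) by exact: nbhs_filter.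
apply/(@cvg_sup _ _ _ _ _ (fmap_filter _ FF)) => f.
have cf : continuous (sval f) by case: (svalP f).
move=> U [_ [[W oW <-]] /=]; rewrite creg_inducedE => WP /filterS; apply.
have : nbhs P (sval f @^-1` W) by apply: cf; exact: open_nbhs_nbhs.
by apply: filterS => Q; rewrite /= creg_inducedE.
Qed.

(** The preimage of W in Prim(A) need not be compact, so it is cut into the compact pieces where a
    step of the approximate unit attains 1/8. By [step_attains] these exhaust it. *)
Lemma locally_closed_of_strictly_closed : locally_closed_at psi E.
Proof.
move=> W cW WE.
pose Z := (@creg_map R (Prim A)) @^-1` W.
have cZ : closed Z by apply: closed_comp => // P _; exact: creg_map_continuous.
have ZH : Z `&` H = set0.
  apply/seteqP; split=> // P [ZP HP]; apply: (disjoint_not WE (P := psi (creg_map R P))).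
    by exists (creg_map R P).
  by move: HP; rewrite /hull_over /= psi_factor.
have e0 : 0 < 8^-1 :> R by rewrite invr_gt0.
have [v [inc_v v0 vv]] := almost_idempotent_sub inc_u e0.
pose Zk k := Z `&` [set P | attains P (v k.+1 - v k) 8^-1].
have sub : psi @` W `<=` corestriction phi @` \bigcup_k Zk k.
  move=> _ [q Wq <-]; have [P qP] := creg_map_surj q; exists P; last by rewrite psi_factor qP.
  have [k Pk] := step_attains P inc_v v0 vv; exists k => //.
  by split=> //; rewrite /Z /= -qP.
apply/seteqP; split=> // x [cx Ex].
apply: (attained_no_limit inc_v e0 (Z := Zk) _ _ _ Ex (closureS sub cx)).
- by move=> k; rewrite /Zk setIC; apply: compact_closedI => //; exact: attains_compact.
- move=> k; apply/seteqP; split=> // P [[ZP _] HP]; exact: disjoint_not ZH ZP HP.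
- by move=> k P [].
Qed.

Lemma redot_rep_starM (a : A) (H' : completeNormedModType R[i])
    (dot : {dot H' for Num.conj}) (pi : A -> H' -> H') (rho : multiplier A -> H' -> H') x :
  irreducible_rep dot pi -> irreducible_rep dot rho ->
  (forall a x, rho (mulin a) x = pi a x) ->
  redot dot (rho (mulin (star a ** a)) x) x = rn (pi a x) ^+ 2.
Proof.
move=> [dxx rep _] _ rp.
by rewrite rp (repM rep) (rep_adj rep) starK (redotxx dxx).
Qed.

(** Without a local unit at P, [local_unit] gives in every neighbourhood of P points off the hull
    where an increment of u attains 1/4. Choosing them in the sets of a countable family that
    shrinks to P makes their images accumulate at the image of P in E, which [attained_no_limit]
    forbids. *)
Lemma locally_modular_of_strictly_closed : locally_modular E.
Proof.
move=> P [clP niP]; apply: contrapT => noV.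
have find (Of : set (Prim A)) N : open Of -> Of P -> exists m, (N < m)%N /\
    exists Q, [/\ Of Q, ~ H Q & attains Q (u m - u N) 4^-1].
  move=> oO OP; apply: contrapT => no; apply: noV.
  exists (Of `&` ~` H°); split=> //; first by exists Of.
  apply: (local_unit inc_u (N := N)) => // Q m OQ nHQ Nm aQ; apply: no.
  by exists m; split=> //; exists Q.
have [d dd] := separable_sequence sepA.
pose B i := exceeds (mulin (star (d i) ** d i)) 4^-1.
have sB i : star (mulin (star (d i) ** d i)) = mulin (star (d i) ** d i).
  by rewrite -mulin_star starM starK.
have oB i : open (B i) by apply: (exceeds_open unit_u).
(* When P is not in [B i], no condition is put on the i-th point. *)
pose C i := if `[< B i P >] then B i else setT.
have oC i : open (C i) by rewrite /C; case: asboolP => // _; exact: openT.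
have CP i : C i P by rewrite /C; case: asboolP.
have [|f fP] := @increasing_choice (fun k n m => exists Q,
    [/\ C k Q, ~ H Q & attains Q (u m - u n) 4^-1]).
  by move=> k n; exact: find.
have inc_v := increasing_unit_sub inc_u (fun k => (fP k).1).
have /boolp.choice [q qP] := fun k => (fP k).2.
have HP : H P.
  by move: clP; rewrite closureE_closed //; exact: hull_over_closed.
have e0 : 0 < 4^-1 :> R by rewrite invr_gt0.
apply: (attained_no_limit inc_v e0 (Z := fun k => [set q k]) _ _ _ HP).
- by move=> k; exact: compact_set1.
- by move=> k; apply/seteqP; split=> // _ [-> Hq]; case: (qP k).
- by move=> k _ ->; case: (qP k).
apply/closure_openP => V oV VP.
have oU := (continuousP (corestriction phi)).1 (corestriction_continuous phi_continuous) V oV.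
set U := corestriction phi @^-1` V in oU.
suff [i Uq] : exists i, U (q i) by exists (corestriction phi (q i)) => //; exists (q i) => //; exists i.
have [a ka nPa] : exists2 a, ker (~` U) a & ~ ideal_of P a.
  apply: contrapT => no; move/prim_openP: oU => /(_ P) h; apply: h VP => a ka.
  by apply: contrapT => nPa; apply: no; exists a.
have [K [dot [pi [rho [irr PE irr' PE' [rp _]]]]]] := prim_ext unit_u P.
have [y ay] : exists y, pi a y != 0.
  apply: contrapT => no; apply: nPa; rewrite PE => y /=.
  by apply/eqP; apply: contrapT => n; apply: no; exists y; apply/negP.
have [dxx rep _] := irr.
have y0 : y != 0 by apply: contraNneq ay => ->; rewrite (rep0r rep).
have yp := rn_gt0 y0; have ap := rn_gt0 ay.
(* Scaled so that |c y| = |y| at P, while c still vanishes at all points outside U. *)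
pose c := (rn y / rn (pi a y))%:C *: a.
have cy : rn (pi c y) = rn y.
  by rewrite /c (repZ rep) rnZr ger0_norm ?divr_ge0 ?rn_ge0 // mulfVK // gt_eqF.
have kc : ker (~` U) c.
  by move=> Q UQ; rewrite /c -[_ *: _]addr0; apply: prim_lin; [exact: ka|exact: prim0].
(* An element d_i within 1/4 of c satisfies |d_i y| >= (3/4) |y| at P and |d_i x| <= (1/4) |x| for
   all x outside U. Since 1/16 < 1/4 < 9/16, the threshold 1/4 puts P in [B i] and [B i] inside
   U. *)
have [i di] := dd c _ e0; exists i.
have Bi : B i P.
  have [Q QE] := prim_of_rep irr'; exists Q; first by rewrite QE.
  move=> /(_ K dot rho irr' QE y); apply/negP; rewrite -ltNge.
  rewrite (redot_rep_starM _ _ irr irr' rp).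
  have lo : 3 / 4 * rn y <= rn (pi (d i) y).
    have := rn_subl (pi c y) (pi (d i) y); rewrite -(repB rep) cy.
    have := rep_contractive dxx rep (c - d i) y.
    have : rn (c - d i) * rn y <= 4^-1 * rn y by rewrite ler_pM2r // ltW.
    move: (rn (c - d i) * rn y) (rn (pi (c - d i) y)) (rn (pi (d i) y)) (rn y) => p r s t; lra.
  move: lo yp; move: (rn (pi (d i) y)) (rn y) => p r; nra.
have [Cq _ _] := qP i.
have {Cq} : B i (q i) by move: Cq; rewrite /C; case: asboolP.
move=> Bq; apply: contrapT => nU; have qc := kc _ nU.
have [K2 [dot2 [pi2 [rho2 [irr2 qE irr2' qE' [rp2 _]]]]]] := prim_ext unit_u (q i).
have [x] := exceeds_rep (sB i) irr2' qE' Bq.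
rewrite (redot_rep_starM _ _ irr2 irr2' rp2).
have [dxx2 rep2 _] := irr2.
have c0 : pi2 c x = 0 by move: qc; rewrite qE; apply.
have := rep_contractive dxx2 rep2 (c - d i) x.
rewrite (repB rep2) c0 sub0r rnN.
have : rn (c - d i) * rn x <= 4^-1 * rn x.
  by apply: ler_wpM2r; [exact: rn_ge0|exact: ltW].
have := rn_ge0 x; have := rn_ge0 (pi2 (d i) x).
move: (rn (c - d i) * rn x) (rn (pi2 (d i) x)) (rn x) => p r s; nra.
Qed.

End Converse.

Theorem corollary5p4 (R : realType) (A : cstarAlgType R) (X : topologicalType)
    (phi : Prim A -> X) (phibar : Prim (multiplier A) -> stone_cech R X)
    (psi : creg R (Prim A) -> image_space phi) (E : set (image_space phi))
    (X_locally_compact : locally_compact [set: X])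
    (X_hausdorff : hausdorff_space X)
    (phi_continuous : continuous phi)
    (phibar_continuous : continuous phibar)
    (phibar_extends : forall (P : Prim A) (Q : Prim (multiplier A)),
       ideal_of Q = ideal_tilde (ideal_of P) ->
       phibar Q = to_stone_cech R (phi P))
    (A_sigma_unital : sigma_unital A)
    (Orc_finite : (Orc A < +oo)%E)
    (psi_continuous : continuous psi)
    (psi_factor : forall P : Prim A, corestriction phi P = psi (creg_map R P))
    (E_closed : closed E)
    (E_nonempty : E !=set0) :
  let i := closed (multiplier_ideal_over phibar E : set (strict A)) in
  let ii := locally_modular E /\ locally_closed_at psi E in
  (ii -> i) /\ (separable A -> (i <-> ii)).
Proof.
move=> i ii; have [u inc_u] := sigma_unital_increasing A_sigma_unital.
have unit_u : approximate_unit u by case: inc_u.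
have ii_i : ii -> i by move=> [lm lc]; exact: strictly_closed_of_modular unit_u _ _ _ lm lc.
split=> // sepA; split=> // cl; split.
  exact: locally_modular_of_strictly_closed cl _ inc_u.
exact: locally_closed_of_strictly_closed cl _ inc_u _ psi_factor.
Qed.
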